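(* Let $q$ be a prime number and let $\mathcal{C}$ be a braided fusion category which is a $\mathbb{Z}_q$-extension of a pointed fusion category. Suppose that $\mathcal{C}$ is not pointed. Then $\mathcal{C}$ is equivalent, as a fusion category, to a Deligne tensor product $\mathcal{B}\boxtimes\mathcal{E}$, where $\mathcal{B}$ is a pointed fusion category and $\mathcal{E}$ is a fusion category whose Frobenius-Perron dimension is a power of $q$. In particular, $\mathcal{E}$ is of type $(1,m;\alpha,n)$ for some positive integers $m,n$ and some real number $\alpha>1$ such that $\alpha^2$ is a power of $q$.
   Context: All fusion categories are over an algebraically closed field $k$ of characteristic $0$: a fusion category is a $k$-linear semisimple rigid tensor category with finitely many isomorphism classes of simple objects, finite-dimensional morphism spaces, and simple unit object. $\operatorname{FPdim}$ denotes Frobenius-Perron dimension. A fusion category is pointed if all its simple objects are invertible. A $G$-grading on a fusion category $\mathcal{C}$ ($G$ a finite group with identity element written $0$) is a decomposition $\mathcal{C}=\oplus_{g\in G}\mathcal{C}_g$ as a direct sum of full abelian subcategories such that duality sends $\mathcal{C}_g$ into $\mathcal{C}_{g^{-1}}$ and $\otimes$ maps $\mathcal{C}_g\times\mathcal{C}_h$ into $\mathcal{C}_{gh}$. It is faithful if $\mathcal{C}_g\neq 0$ for all $g\in G$. $\mathcal{C}$ is a $G$-extension of $\mathcal{D}$ if it has a faithful $G$-grading with $\mathcal{C}_0=\mathcal{D}$. A fusion category is of type $(d_0,n_0;d_1,n_1;\ldots;d_s,n_s)$, where $1=d_0<d_1<\cdots<d_s$ are real numbers and $n_0,\ldots,n_s$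 are positive integers, if $n_i$ is the number of non-isomorphic simple objects of Frobenius-Perron dimension $d_i$ for all $0\le i\le s$ (so $d_0,\dots,d_s$ are all the dimensions of simple objects that occur). *)

(* Defs.v *)
From HB Require Import structures.
From mathcomp Require Import all_boot all_order all_algebra all_fingroup.
From mathcomp Require Import boolp classical_sets reals.
Set Implicit Arguments.
Unset Strict Implicit.
Unset Printing Implicit Defensive.
Import Order.TTheory GRing.Theory Num.Theory.
Local Open Scope ring_scope.

Declare Scope cat_scope.
Delimit Scope cat_scope with cat.
Local Open Scope cat_scope.

Record kcat (k : fieldType) := KCat {
  obj :> Type;
  hom : obj -> obj -> lmodType k;
  idm : forall X, hom X X;
  kcomp : forall X Y Z, hom Y Z -> hom X Y -> hom X Z;
  kcomp1m : forall X Y (f : hom X Y), kcomp (idm Y) f = f;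
  kcompm1 : forall X Y (f : hom X Y), kcomp f (idm X) = f;
  kcompA : forall X Y Z W (h : hom Z W) (g : hom Y Z) (f : hom X Y),
    kcomp h (kcomp g f) = kcomp (kcomp h g) f;
  kcomp_linearl : forall X Y Z (f : hom X Y),
    linear (fun g : hom Y Z => kcomp g f);
  kcomp_linearr : forall X Y Z (g : hom Y Z),
    linear (fun f : hom X Y => kcomp g f)
}.
Arguments hom {_ _} _ _.
Arguments idm {_ _} X.
Arguments kcomp {_ _ X Y Z} _ _.

Notation "g ∘ f" := (kcomp g f) (at level 40, left associativity) : cat_scope.
Notation "\id_ X" := (idm X) (at level 8, X at level 2) : cat_scope.

Record iso (k : fieldType) (C : kcat k) (X Y : C) := Iso {
  fwd : hom X Y;
  bwd : hom Y X;
  bwdK : bwd ∘ fwd = \id_X;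
  fwdK : fwd ∘ bwd = \id_Y
}.

Section Linear.
Variables (k : fieldType) (C : kcat k).
Implicit Types (X Y Z : C).

Definition isomorphic X Y : Prop := inhabited (iso X Y).
Definition is_iso X Y (f : hom X Y) : Prop := exists i : iso X Y, fwd i = f.
Definition mono X Y (f : hom X Y) : Prop :=
  forall Z (u v : hom Z X), f ∘ u = f ∘ v -> u = v.
Definition epi X Y (f : hom X Y) : Prop :=
  forall Z (u v : hom Y Z), u ∘ f = v ∘ f -> u = v.
Definition is_zero X : Prop := \id_X = 0.

Definition is_kernel X Y K (f : hom X Y) (i : hom K X) : Prop :=
  f ∘ i = 0 /\
  forall Z (h : hom Z X), f ∘ h = 0 -> exists! u : hom Z K, i ∘ u = h.
Definition is_cokernel X Y Q (f : hom X Y) (p : hom Y Q) : Prop :=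
  p ∘ f = 0 /\
  forall Z (h : hom Y Z), h ∘ f = 0 -> exists! u : hom Q Z, u ∘ p = h.

Definition is_dsum (I : finType) (s : I -> C) X : Prop :=
  exists (i : forall a, hom (s a) X) (p : forall a, hom X (s a)),
    [/\ forall a, p a ∘ i a = \id_(s a),
        forall a b, a != b -> p b ∘ i a = 0
      & \sum_a (i a ∘ p a) = \id_X].

(* The empty direct sum is the zero object. *)
Definition abelian_cat : Prop :=
  [/\ forall n (s : 'I_n -> C), exists X, is_dsum s X,
      forall X Y (f : hom X Y), exists K (i : hom K X), is_kernel f i,
      forall X Y (f : hom X Y), exists Q (p : hom Y Q), is_cokernel f p,
      forall X Y (f : hom X Y), mono f ->
        exists Z (g : hom Y Z), is_kernel g f
    & forall X Y (f : hom X Y), epi f ->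
        exists Z (g : hom Z X), is_cokernel g f].

Definition simple X : Prop :=
  ~ is_zero X /\ forall Y (i : hom Y X), mono i -> is_zero Y \/ is_iso i.

Definition semisimple_cat : Prop :=
  abelian_cat /\
  forall X, exists n (s : 'I_n -> C), (forall a, simple (s a)) /\ is_dsum s X.

Definition simple_reps n (s : 'I_n -> C) : Prop :=
  [/\ forall a, simple (s a),
      forall a b, isomorphic (s a) (s b) -> a = b
    & forall X, simple X -> exists a, isomorphic X (s a)].

Definition full_abelian_sub (P : C -> Prop) : Prop :=
  [/\ forall X Y, isomorphic X Y -> P X -> P Y,
      forall n (s : 'I_n -> C) X, (forall a, P (s a)) -> is_dsum s X -> P X,
      forall X Y K (f : hom X Y) (i : hom K X),
        P X -> P Y -> is_kernel f i -> P K
    & forall X Y Q (f : hom X Y) (p : hom Y Q),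
        P X -> P Y -> is_cokernel f p -> P Q].

End Linear.

Definition has_dim (k : fieldType) (V : lmodType k) (n : nat) : Prop :=
  inhabited (Vector.axiom n V).
(* 0 when V is infinite-dimensional. *)
Definition ldim (k : fieldType) (V : lmodType k) : nat :=
  xget 0%N [set n | has_dim V n].

Record kfunctor (k : fieldType) (C D : kcat k) := KFunctor {
  fobj :> C -> D;
  fmor : forall X Y : C, hom X Y -> hom (fobj X) (fobj Y);
  fmor1 : forall X : C, fmor \id_X = \id_(fobj X);
  fmorM : forall (X Y Z : C) (g : hom Y Z) (f : hom X Y),
    fmor (g ∘ f) = fmor g ∘ fmor f;
  fmor_linear : forall X Y : C, linear (@fmor X Y)
}.
Arguments fmor {_ _ _} _ {X Y} _.

Record bifunctor (k : fieldType) (B E D : kcat k) := BiFunctor {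
  bobj :> B -> E -> D;
  bmor : forall (X X' : B) (Y Y' : E),
    hom X X' -> hom Y Y' -> hom (bobj X Y) (bobj X' Y');
  bmor1 : forall (X : B) (Y : E), bmor \id_X \id_Y = \id_(bobj X Y);
  bmorM : forall (X X' X'' : B) (Y Y' Y'' : E)
      (f' : hom X' X'') (f : hom X X') (g' : hom Y' Y'') (g : hom Y Y'),
    bmor (f' ∘ f) (g' ∘ g) = bmor f' g' ∘ bmor f g;
  bmor_linearl : forall (X X' : B) (Y Y' : E) (g : hom Y Y'),
    linear (fun f : hom X X' => bmor f g);
  bmor_linearr : forall (X X' : B) (Y Y' : E) (f : hom X X'),
    linear (fun g : hom Y Y' => bmor f g)
}.
Arguments bmor {_ _ _ _} _ {X X' Y Y'} _ _.

Section BiComp.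
Variables (k : fieldType) (B E D A : kcat k).
Variables (G : kfunctor D A) (T : bifunctor B E D).

Lemma bicomp1 (X : B) (Y : E) :
  fmor G (bmor T \id_X \id_Y) = \id_(G (T X Y)).
Proof. by rewrite bmor1 fmor1. Qed.

Lemma bicompM (X X' X'' : B) (Y Y' Y'' : E)
    (f' : hom X' X'') (f : hom X X') (g' : hom Y' Y'') (g : hom Y Y') :
  fmor G (bmor T (f' ∘ f) (g' ∘ g)) =
  fmor G (bmor T f' g') ∘ fmor G (bmor T f g).
Proof. by rewrite bmorM fmorM. Qed.

Lemma bicomp_linearl (X X' : B) (Y Y' : E) (g : hom Y Y') :
  linear (fun f : hom X X' => fmor G (bmor T f g)).
Proof. by move=> a u v; rewrite bmor_linearl fmor_linear. Qed.

Lemma bicomp_linearr (X X' : B) (Y Y' : E) (f : hom X X') :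
  linear (fun g : hom Y Y' => fmor G (bmor T f g)).
Proof. by move=> a u v; rewrite bmor_linearr fmor_linear. Qed.

Definition bicomp : bifunctor B E A :=
  BiFunctor bicomp1 bicompM bicomp_linearl bicomp_linearr.

End BiComp.

Section Transformations.
Variables (k : fieldType) (B E D : kcat k).

Definition natural (F G : kfunctor B D)
    (t : forall X : B, hom (F X) (G X)) : Prop :=
  forall (X Y : B) (f : hom X Y), t Y ∘ fmor F f = fmor G f ∘ t X.

Definition binatural (F G : bifunctor B E D)
    (t : forall (X : B) (Y : E), hom (F X Y) (G X Y)) : Prop :=
  forall (X X' : B) (Y Y' : E) (f : hom X X') (g : hom Y Y'),
    t X' Y' ∘ bmor F f g = bmor G f g ∘ t X Y.

Definition bi_isomorphic (F G : bifunctor B E D) : Prop :=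
  exists t : forall (X : B) (Y : E), iso (F X Y) (G X Y),
    binatural (fun X Y => fwd (t X Y)).

Definition right_exact (F : kfunctor B D) : Prop :=
  forall (X Y Q : B) (f : hom X Y) (p : hom Y Q),
    is_cokernel f p -> is_cokernel (fmor F f) (fmor F p).

Definition right_exact2 (F : bifunctor B E D) : Prop :=
  (forall (X Y Q : B) (Z : E) (f : hom X Y) (p : hom Y Q),
     is_cokernel f p -> is_cokernel (bmor F f \id_Z) (bmor F p \id_Z)) /\
  (forall (Z : B) (X Y Q : E) (f : hom X Y) (p : hom Y Q),
     is_cokernel f p -> is_cokernel (bmor F \id_Z f) (bmor F \id_Z p)).

Definition is_equivalence (F : kfunctor B D) : Prop :=
  (forall X Y : B, bijective (fmor F : hom X Y -> hom (F X) (F Y))) /\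
  (forall Z : D, exists X : B, isomorphic (F X) Z).

End Transformations.

Record moncat (k : fieldType) := MonCat {
  ucat :> kcat k;
  tens : bifunctor ucat ucat ucat;
  one : ucat;
  asc : forall X Y Z : ucat, iso (tens (tens X Y) Z) (tens X (tens Y Z));
  lun : forall X : ucat, iso (tens one X) X;
  run : forall X : ucat, iso (tens X one) X;
  asc_natural : forall (X X' Y Y' Z Z' : ucat)
      (f : hom X X') (g : hom Y Y') (h : hom Z Z'),
    fwd (asc X' Y' Z') ∘ bmor tens (bmor tens f g) h =
    bmor tens f (bmor tens g h) ∘ fwd (asc X Y Z);
  lun_natural : forall (X X' : ucat) (f : hom X X'),
    fwd (lun X') ∘ bmor tens \id_one f = f ∘ fwd (lun X);
  run_natural : forall (X X' : ucat) (f : hom X X'),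
    fwd (run X') ∘ bmor tens f \id_one = f ∘ fwd (run X);
  pentagon : forall X Y Z W : ucat,
    fwd (asc X Y (tens Z W)) ∘ fwd (asc (tens X Y) Z W) =
    bmor tens \id_X (fwd (asc Y Z W)) ∘ fwd (asc X (tens Y Z) W)
      ∘ bmor tens (fwd (asc X Y Z)) \id_W;
  triangle : forall X Y : ucat,
    bmor tens \id_X (fwd (lun Y)) ∘ fwd (asc X one Y) =
    bmor tens (fwd (run X)) \id_Y
}.
Arguments tens {_ _}.
Arguments one {_ _}.
Arguments asc {_ _} X Y Z.
Arguments lun {_ _} X.
Arguments run {_ _} X.

Notation "X ⊗ Y" := (tens X Y) (at level 35, right associativity) : cat_scope.
Notation "f ⊗₁ g" := (bmor tens f g) (at level 35, right associativity)
  : cat_scope.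
Notation "𝟙" := one : cat_scope.

Section Monoidal.
Variables (k : fieldType) (C : moncat k).

(* Y is a left dual of X (equivalently, X is a right dual of Y). *)
Definition left_dual (X Y : C) : Prop :=
  exists (ev : hom (Y ⊗ X) 𝟙) (coev : hom 𝟙 (X ⊗ Y)),
    fwd (run X) ∘ (\id_X ⊗₁ ev) ∘ fwd (asc X Y X) ∘ (coev ⊗₁ \id_X)
      = fwd (lun X) /\
    fwd (lun Y) ∘ (ev ⊗₁ \id_Y) ∘ bwd (asc Y X Y) ∘ (\id_Y ⊗₁ coev)
      = fwd (run Y).

Definition rigid : Prop :=
  forall X : C, (exists Y, left_dual X Y) /\ (exists Y, left_dual Y X).

Definition invertible (X : C) : Prop :=
  exists Y : C, isomorphic (X ⊗ Y) 𝟙 /\ isomorphic (Y ⊗ X) 𝟙.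

Definition pointed : Prop := forall X : C, simple X -> invertible X.

Definition is_fusion : Prop :=
  [/\ semisimple_cat C,
      rigid,
      forall X Y : C, exists n, has_dim (hom X Y) n,
      exists r : {n : nat & 'I_n -> C}, simple_reps (projT2 r)
    & simple (𝟙 : C)].

End Monoidal.

Record fusionCat (k : fieldType) := FusionCat {
  fcat :> moncat k;
  fusionP : is_fusion fcat
}.

Record braiding (k : fieldType) (C : moncat k) := Braiding {
  braid : forall X Y : C, iso (X ⊗ Y) (Y ⊗ X);
  braid_natural : forall (X X' Y Y' : C) (f : hom X X') (g : hom Y Y'),
    fwd (braid X' Y') ∘ (f ⊗₁ g) = (g ⊗₁ f) ∘ fwd (braid X Y);
  hexagon1 : forall X Y Z : C,
    fwd (asc Y Z X) ∘ fwd (braid X (Y ⊗ Z)) ∘ fwd (asc X Y Z) =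
    (\id_Y ⊗₁ fwd (braid X Z)) ∘ fwd (asc Y X Z)
      ∘ (fwd (braid X Y) ⊗₁ \id_Z);
  hexagon2 : forall X Y Z : C,
    bwd (asc Z X Y) ∘ fwd (braid (X ⊗ Y) Z) ∘ bwd (asc X Y Z) =
    (fwd (braid X Z) ⊗₁ \id_Y) ∘ bwd (asc X Z Y)
      ∘ (\id_X ⊗₁ fwd (braid Y Z))
}.

Record braidedFusionCat (k : fieldType) := BraidedFusionCat {
  bfcat :> fusionCat k;
  bfbraiding : braiding bfcat
}.

Record monfunctor (k : fieldType) (C D : moncat k) := MonFunctor {
  mfun :> kfunctor C D;
  mfunJ : forall X Y : C, iso (mfun X ⊗ mfun Y) (mfun (X ⊗ Y));
  mfun1 : iso 𝟙 (mfun 𝟙);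
  mfunJ_natural : forall (X X' Y Y' : C) (f : hom X X') (g : hom Y Y'),
    fwd (mfunJ X' Y') ∘ (fmor mfun f ⊗₁ fmor mfun g) =
    fmor mfun (f ⊗₁ g) ∘ fwd (mfunJ X Y);
  mfun_asc : forall X Y Z : C,
    fmor mfun (fwd (asc X Y Z)) ∘ fwd (mfunJ (X ⊗ Y) Z)
      ∘ (fwd (mfunJ X Y) ⊗₁ \id_(mfun Z)) =
    fwd (mfunJ X (Y ⊗ Z)) ∘ (\id_(mfun X) ⊗₁ fwd (mfunJ Y Z))
      ∘ fwd (asc (mfun X) (mfun Y) (mfun Z));
  mfun_lun : forall X : C,
    fmor mfun (fwd (lun X)) ∘ fwd (mfunJ 𝟙 X) ∘ (fwd mfun1 ⊗₁ \id_(mfun X)) =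
    fwd (lun (mfun X));
  mfun_run : forall X : C,
    fmor mfun (fwd (run X)) ∘ fwd (mfunJ X 𝟙) ∘ (\id_(mfun X) ⊗₁ fwd mfun1) =
    fwd (run (mfun X))
}.

Definition fusion_equivalent (k : fieldType) (C D : fusionCat k) : Prop :=
  exists F : monfunctor C D, is_equivalence F.

(* Restriction along T is an equivalence from right exact functors P -> A to
   bifunctors B x E -> A that are right exact in each variable. *)
Definition deligne_universal (k : fieldType) (B E P : kcat k)
    (T : bifunctor B E P) : Prop :=
  right_exact2 T /\
  forall A : kcat k, abelian_cat A ->
    (forall F : bifunctor B E A, right_exact2 F ->
       exists G : kfunctor P A,
         right_exact G /\ bi_isomorphic (bicomp G T) F) /\
    (forall G H : kfunctor P A, right_exact G -> right_exact H ->
       forall t : forall (X : B) (Y : E), hom (G (T X Y)) (H (T X Y)),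
         @binatural _ _ _ _ (bicomp G T) (bicomp H T) t ->
         exists! u : forall Z : P, hom (G Z) (H Z),
           natural u /\ forall X Y, u (T X Y) = t X Y).

(* A tensor structure on T, identifying the tensor product of P with
   (X ⊠ Y) ⊗ (X' ⊠ Y') = (X ⊗ X') ⊠ (Y ⊗ Y'), with its constraints. *)
Record monbifunctor (k : fieldType) (B E P : moncat k) := MonBiFunctor {
  mbi :> bifunctor B E P;
  mbiJ : forall (X : B) (Y : E) (X' : B) (Y' : E),
    iso (mbi X Y ⊗ mbi X' Y') (mbi (X ⊗ X') (Y ⊗ Y'));
  mbi1 : iso 𝟙 (mbi 𝟙 𝟙);
  mbiJ_natural : forall (X Z : B) (Y W : E) (X' Z' : B) (Y' W' : E)
      (f : hom X Z) (g : hom Y W) (f' : hom X' Z') (g' : hom Y' W'),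
    fwd (mbiJ Z W Z' W') ∘ (bmor mbi f g ⊗₁ bmor mbi f' g') =
    bmor mbi (f ⊗₁ f') (g ⊗₁ g') ∘ fwd (mbiJ X Y X' Y');
  mbi_asc : forall (X1 X2 X3 : B) (Y1 Y2 Y3 : E),
    bmor mbi (fwd (asc X1 X2 X3)) (fwd (asc Y1 Y2 Y3))
      ∘ fwd (mbiJ (X1 ⊗ X2) (Y1 ⊗ Y2) X3 Y3)
      ∘ (fwd (mbiJ X1 Y1 X2 Y2) ⊗₁ \id_(mbi X3 Y3)) =
    fwd (mbiJ X1 Y1 (X2 ⊗ X3) (Y2 ⊗ Y3))
      ∘ (\id_(mbi X1 Y1) ⊗₁ fwd (mbiJ X2 Y2 X3 Y3))
      ∘ fwd (asc (mbi X1 Y1) (mbi X2 Y2) (mbi X3 Y3));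
  mbi_lun : forall (X : B) (Y : E),
    bmor mbi (fwd (lun X)) (fwd (lun Y)) ∘ fwd (mbiJ 𝟙 𝟙 X Y)
      ∘ (fwd mbi1 ⊗₁ \id_(mbi X Y)) = fwd (lun (mbi X Y));
  mbi_run : forall (X : B) (Y : E),
    bmor mbi (fwd (run X)) (fwd (run Y)) ∘ fwd (mbiJ X Y 𝟙 𝟙)
      ∘ (\id_(mbi X Y) ⊗₁ fwd mbi1) = fwd (run (mbi X Y))
}.

Definition is_deligne_product (k : fieldType) (B E P : fusionCat k) : Prop :=
  exists T : monbifunctor B E P, deligne_universal T.

Definition is_grading (k : fieldType) (C : fusionCat k) (G : finGroupType)
    (Cg : G -> C -> Prop) : Prop :=
  [/\ forall g, full_abelian_sub (Cg g),
      forall X : C, exists s : G -> C, (forall g, Cg g (s g)) /\ is_dsum s X,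
      forall (g h : G) (X Y : C), g != h -> Cg g X -> Cg h Y ->
        forall f : hom X Y, f = 0,
      forall (g : G) (X Y : C), Cg g X -> left_dual X Y -> Cg (g^-1)%g Y
    & forall (g h : G) (X Y : C), Cg g X -> Cg h Y -> Cg (g * h)%g (X ⊗ Y)].

Definition faithful_grading (k : fieldType) (C : fusionCat k)
    (G : finGroupType) (Cg : G -> C -> Prop) : Prop :=
  forall g, exists X : C, Cg g X /\ ~ is_zero X.

(* "C_1 = D" is expressed by a fully faithful tensor functor D -> C with
   essential image C_1. *)
Definition is_extension (k : fieldType) (G : finGroupType)
    (C D : fusionCat k) : Prop :=
  exists Cg : G -> C -> Prop,
    [/\ is_grading Cg,
        faithful_grading Cg
      & exists F : monfunctor D C,
          (forall X Y : D, bijective (fmor F : hom X Y -> hom (F X) (F Y))) /\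
          (forall Z : C, Cg 1%g Z <-> exists X : D, isomorphic (F X) Z)].

Section Simples.
Variables (k : fieldType) (C : fusionCat k).

Lemma simple_reps_ex : exists r : {n : nat & 'I_n -> C},
  simple_reps (projT2 r).
Proof. by case: (fusionP C). Qed.

Definition nsimple : nat := projT1 (sval (cid simple_reps_ex)).
Definition simple_obj : 'I_nsimple -> C := projT2 (sval (cid simple_reps_ex)).

End Simples.

Section FPdim.
Variables (R : realType) (k : fieldType) (C : fusionCat k).

(* Left multiplication by X on the Grothendieck ring; row j holds the
   multiplicities of the simple objects in X ⊗ X_j, as mathcomp's eigenvalues
   refer to the action on row vectors. *)
Definition fusion_mx (X : C) : 'M[R]_(nsimple C) :=
  \matrix_(j, i) (ldim (hom (simple_obj i) (X ⊗ simple_obj j)))%:R.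

(* The supremum is over a finite set, nonempty by the Frobenius-Perron theorem. *)
Definition FPdim (X : C) : R :=
  sup [set d : R | 0 <= d /\ eigenvalue (fusion_mx X) d].

Definition FPdim_cat : R := \sum_(i < nsimple C) FPdim (simple_obj i) ^+ 2.

(* [:: (d_0, n_0); ...; (d_s, n_s)] *)
Definition of_type (t : seq (R * nat)) : Prop :=
  [/\ ohead (unzip1 t) = Some 1,
      sorted <%R (unzip1 t),
      all (leq 1) (unzip2 t),
      forall i : 'I_(nsimple C), FPdim (simple_obj i) \in unzip1 t
    & forall dn, dn \in t ->
        #|[set i : 'I_(nsimple C) | FPdim (simple_obj i) == dn.1]| = dn.2].

End FPdim.

(* Main.v *)
(** Simple objects of degree 0 are invertible, and the simple objects of a given
degree form one orbit under tensoring with them. If [S] is invertible and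
[S ⊗ X ≅ X], such an isomorphism, applied to all factors of [X^n] at once, gives
an isomorphism [S^n ⊗ X^n ≅ X^n] which commutes with every endomorphism of
[X^n]; hence [S^n] fixes every constituent of [X^n]. For [n = q] the
constituents are invertible, so [S^q ≅ 𝟙]; for [n] prime to [q] it follows that
all simple objects of nonzero degree have the same stabiliser, a q-group.

Let [B] be spanned by the invertible objects of order prime to [q], and [E] by
the simple objects [X] such that the constituents of [X^q] have q-power order.
Since the constituents of [X^q] form one orbit under the stabiliser of [X], every
simple object is [b ⊗ e] for unique simple [b] in [B] and [e] in [E]. The tensor
product [B × E -> C], monoidal through the braiding, is then a Deligne product,
because linear functors out of a semisimple category are determined freely by
their values on simple objects. As [X^∨ ⊗ X] is the sum of the stabiliser of [X],
the dimension of [X] is the square root of the order of its stabiliser. *)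

Require Import Defs.
From Stdlib Require Import Setoid Morphisms.
From HB Require Import structures.
From mathcomp Require Import all_boot all_order all_algebra all_fingroup.
From mathcomp Require Import cyclic pgroup.
From mathcomp Require Import boolp classical_sets reals.
Import Defs.
Set Implicit Arguments.
Unset Strict Implicit.
Unset Printing Implicit Defensive.
Import Order.TTheory GRing.Theory Num.Theory.
Local Open Scope ring_scope.
Local Open Scope cat_scope.

(** The delicate point is why the isomorphism built from [S ⊗ X ≅ X] commutes with endomorphisms of
    [X^n]. By duality every morphism [X ⊗ U -> X ⊗ V] is a sum of terms that first act on the tail
    [U] and then let a constituent [T] of [X^∨ ⊗ X] act on [X] from the right. Degrees force
    [X ⊗ T ≅ X], which is simple, so the left action of [S] and the right action of [T] commute up
    to a scalar. Each such scalar may differ from 1, but they multiply along tensor products. The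
    induction on [n] therefore carries the scalar of the tail, the [twist]; an endomorphism of [X^n]
    begins and ends with tail [𝟙], whose scalar is 1, so nothing is left over. The exponent [q] in
    the description of [E] comes from degrees as well: all constituents of [X^q] have degree 0 and
    are invertible, so the primary decomposition of a finite abelian group applies to them, and any
    two of them differ by an element of the stabiliser, whose order divides [q]. *)

Local Notation "X ◁ f" := (bmor tens \id_X f)
  (at level 35, right associativity) : cat_scope.
Local Notation "f ▷ X" := (bmor tens f \id_X)
  (at level 33, left associativity) : cat_scope.
Local Notation "X ≅ Y" := (isomorphic X Y) (at level 70) : cat_scope.

(** * Semisimple linear categories *)

Section LinearMaps.
Variables (k : fieldType) (U V : lmodType k) (f : U -> V).
Hypothesis f_lin : linear f.

Lemma linD u v : f (u + v) = f u + f v.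
Proof. by have := f_lin 1 u v; rewrite !scale1r. Qed.

Lemma lin0 : f 0 = 0.
Proof. by apply: (addrI (f 0)); rewrite -linD !addr0. Qed.

Lemma linZ a u : f (a *: u) = a *: f u.
Proof. by rewrite -[a *: u]addr0 f_lin lin0 addr0. Qed.

Lemma linN u : f (- u) = - f u.
Proof. by rewrite -scaleN1r linZ scaleN1r. Qed.

Lemma linB u v : f (u - v) = f u - f v.
Proof. by rewrite linD linN. Qed.

Lemma lin_sum (I : Type) (r : seq I) (P : pred I) (F : I -> U) :
  f (\sum_(i <- r | P i) F i) = \sum_(i <- r | P i) f (F i).
Proof. by apply: (big_morph f linD lin0). Qed.

End LinearMaps.

Section KCat.
Variables (k : fieldType) (C : kcat k).
Implicit Types (X Y Z W : C).

Lemma comp0m X Y Z (f : hom X Y) : (0 : hom Y Z) ∘ f = 0.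
Proof. exact: (lin0 (kcomp_linearl f)). Qed.
Lemma compm0 X Y Z (g : hom Y Z) : g ∘ (0 : hom X Y) = 0.
Proof. exact: (lin0 (kcomp_linearr g)). Qed.
Lemma compDl X Y Z (g g' : hom Y Z) (f : hom X Y) :
  (g + g') ∘ f = g ∘ f + g' ∘ f.
Proof. exact: (linD (kcomp_linearl f)). Qed.
Lemma compDr X Y Z (g : hom Y Z) (f f' : hom X Y) :
  g ∘ (f + f') = g ∘ f + g ∘ f'.
Proof. exact: (linD (kcomp_linearr g)). Qed.
Lemma compBl X Y Z (g g' : hom Y Z) (f : hom X Y) :
  (g - g') ∘ f = g ∘ f - g' ∘ f.
Proof. exact: (linB (kcomp_linearl f)). Qed.
Lemma compBr X Y Z (g : hom Y Z) (f f' : hom X Y) :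
  g ∘ (f - f') = g ∘ f - g ∘ f'.
Proof. exact: (linB (kcomp_linearr g)). Qed.
Lemma compZl X Y Z a (g : hom Y Z) (f : hom X Y) : (a *: g) ∘ f = a *: (g ∘ f).
Proof. exact: (linZ (kcomp_linearl f)). Qed.
Lemma compZr X Y Z a (g : hom Y Z) (f : hom X Y) : g ∘ (a *: f) = a *: (g ∘ f).
Proof. exact: (linZ (kcomp_linearr g)). Qed.
Lemma comp_suml X Y Z (I : Type) (r : seq I) (P : pred I)
    (F : I -> hom Y Z) (f : hom X Y) :
  (\sum_(i <- r | P i) F i) ∘ f = \sum_(i <- r | P i) (F i ∘ f).
Proof. exact: (lin_sum (kcomp_linearl f)). Qed.
Lemma comp_sumr X Y Z (I : Type) (r : seq I) (P : pred I)
    (F : I -> hom X Y) (g : hom Y Z) :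
  g ∘ (\sum_(i <- r | P i) F i) = \sum_(i <- r | P i) (g ∘ F i).
Proof. exact: (lin_sum (kcomp_linearr g)). Qed.

Definition iso_id X : iso X X := Iso (kcomp1m \id_X) (kcomp1m \id_X).
Definition iso_inv X Y (i : iso X Y) : iso Y X := Iso (fwdK i) (bwdK i).

Lemma iso_compK X Y Z (i : iso X Y) (j : iso Y Z) :
  (bwd i ∘ bwd j) ∘ (fwd j ∘ fwd i) = \id_X.
Proof.
by rewrite -kcompA [bwd j ∘ _]kcompA bwdK kcomp1m bwdK.
Qed.
Definition iso_comp X Y Z (i : iso X Y) (j : iso Y Z) : iso X Z :=
  Iso (iso_compK i j) (iso_compK (iso_inv j) (iso_inv i)).

Lemma isomorphic_refl X : isomorphic X X.
Proof. exact: inhabits (iso_id X). Qed.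
Lemma isomorphic_sym X Y : isomorphic X Y -> isomorphic Y X.
Proof. by case=> i; exact: inhabits (iso_inv i). Qed.
Lemma isomorphic_trans Y X Z :
  isomorphic X Y -> isomorphic Y Z -> isomorphic X Z.
Proof. by case=> i [j]; exact: inhabits (iso_comp i j). Qed.

Lemma fwd_inj X Y (i : iso X Y) Z (f g : hom Z X) :
  fwd i ∘ f = fwd i ∘ g -> f = g.
Proof.
by move=> e; rewrite -[f]kcomp1m -[g]kcomp1m -(bwdK i) -!kcompA e.
Qed.
Lemma bwd_inj X Y (i : iso X Y) Z (f g : hom Z Y) :
  bwd i ∘ f = bwd i ∘ g -> f = g.
Proof. exact: (@fwd_inj _ _ (iso_inv i)). Qed.
Lemma fwd_injr X Y (i : iso X Y) Z (f g : hom Y Z) :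
  f ∘ fwd i = g ∘ fwd i -> f = g.
Proof.
by move=> e; rewrite -[f]kcompm1 -[g]kcompm1 -(fwdK i) !kcompA e.
Qed.
Lemma bwd_injr X Y (i : iso X Y) Z (f g : hom X Z) :
  f ∘ bwd i = g ∘ bwd i -> f = g.
Proof. exact: (@fwd_injr _ _ (iso_inv i)). Qed.

Lemma is_isoP X Y (f : hom X Y) (g : hom Y X) :
  g ∘ f = \id_X -> f ∘ g = \id_Y -> is_iso f.
Proof. by move=> a b; exists (Iso a b). Qed.

Lemma is_iso_comp X Y Z (f : hom X Y) (g : hom Y Z) :
  is_iso f -> is_iso g -> is_iso (g ∘ f).
Proof. by case=> i <- [j <-]; exists (iso_comp i j). Qed.

Lemma is_iso_isomorphic X Y (f : hom X Y) : is_iso f -> isomorphic X Y.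
Proof. by case=> i _; exists. Qed.

Lemma is_zero_from X Y (f : hom X Y) : is_zero X -> f = 0.
Proof. by move=> z; rewrite -[f]kcompm1 z compm0. Qed.
Lemma is_zero_to X Y (f : hom X Y) : is_zero Y -> f = 0.
Proof. by move=> z; rewrite -[f]kcomp1m z comp0m. Qed.

Lemma is_zero_isomorphic X Y : isomorphic X Y -> is_zero X -> is_zero Y.
Proof.
by case=> i z; rewrite /is_zero -(fwdK i) (is_zero_from (fwd i) z) comp0m.
Qed.

Lemma simple_id_neq0 X : simple X -> \id_X != 0.
Proof. by case=> nz _; apply/eqP. Qed.

Lemma split_mono X Y (f : hom X Y) g : g ∘ f = \id_X -> mono f.
Proof.
by move=> gf Z u v e; rewrite -[u]kcomp1m -[v]kcomp1m -gf -!kcompA e.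
Qed.

Lemma simple_isomorphic X Y : isomorphic X Y -> simple X -> simple Y.
Proof.
case=> i [nz sX]; split.
  by move=> zY; apply: nz; apply: is_zero_isomorphic zY; exists; apply: iso_inv.
move=> Z f mf; case: (sX Z (bwd i ∘ f)) => [W u v|zZ|iZ].
- by rewrite -!kcompA => /bwd_inj/mf.
- by left.
right; have -> : f = fwd i ∘ (bwd i ∘ f) by rewrite kcompA fwdK kcomp1m.
by apply: is_iso_comp => //; exists i.
Qed.

Lemma iso_comp_neq0 X Y Z (f : hom X Y) (g : hom Y Z) :
  is_iso f -> (g ∘ f == 0) = (g == 0).
Proof.
case=> i <-; apply/eqP/eqP => [e|->]; last exact: comp0m.
by apply: (fwd_injr (i := i)); rewrite e comp0m.
Qed.
Lemma comp_iso_neq0 X Y Z (f : hom X Y) (g : hom Y Z) :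
  is_iso g -> (g ∘ f == 0) = (f == 0).
Proof.
case=> i <-; apply/eqP/eqP => [e|->]; last exact: compm0.
by apply: (fwd_inj (i := i)); rewrite e compm0.
Qed.

Lemma mono_kernel0 X Y K (f : hom X Y) (i : hom K X) :
  is_kernel f i -> is_zero K -> mono f.
Proof.
move=> [fi ker] zK Z u v e.
have /ker [w [iw _]] : f ∘ (u - v) = 0 by rewrite compBr e subrr.
by apply/eqP; rewrite -subr_eq0 -iw (is_zero_to w zK) compm0.
Qed.

Lemma kernel_mono X Y K (f : hom X Y) (i : hom K X) : is_kernel f i -> mono i.
Proof.
move=> [fi ker] Z u v e.
have /ker [w [_ uw]] : f ∘ (i ∘ u) = 0 by rewrite kcompA fi comp0m.
by rewrite -(uw u erefl) -(uw v).
Qed.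

Lemma cokernel_epi X Y Q (f : hom X Y) (p : hom Y Q) : is_cokernel f p -> epi p.
Proof.
move=> [pf coker] Z u v e.
have /coker [w [_ uw]] : (u ∘ p) ∘ f = 0 by rewrite -kcompA pf compm0.
by rewrite -(uw u erefl) -(uw v).
Qed.

(** For a simple [Z] this is being a direct summand of [X], since nonzero morphisms out of a simple
    object split. Degrees and orbits can thus be treated without multiplicities. *)
Definition occurs Z X : Prop := exists f : hom Z X, f != 0.

Lemma occurs_isomorphic Z Z' X X' :
  isomorphic Z Z' -> isomorphic X X' -> occurs Z X -> occurs Z' X'.
Proof.
case=> i [j] [f f0]; exists (fwd j ∘ f ∘ bwd i).
rewrite iso_comp_neq0; last by exists (iso_inv i).
by rewrite comp_iso_neq0 //; exists j.
Qed.

End KCat.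

Section Abelian.
Variables (k : fieldType) (C : kcat k).
Hypothesis C_ss : semisimple_cat C.
Implicit Types (X Y Z W : C).

Let C_ab : abelian_cat C := proj1 C_ss.

Lemma ss_kernel X Y (f : hom X Y) : exists K (i : hom K X), is_kernel f i.
Proof. by case: C_ab => _ h _ _ _; apply: h. Qed.
Lemma ss_cokernel X Y (f : hom X Y) : exists K (i : hom Y K), is_cokernel f i.
Proof. by case: C_ab => _ _ h _ _; apply: h. Qed.
Lemma ss_dsum n (s : 'I_n -> C) : exists X, is_dsum s X.
Proof. by case: C_ab => h _ _ _ _; apply: h. Qed.
Lemma ss_decomp X :
  exists n (s : 'I_n -> C), (forall a, simple (s a)) /\ is_dsum s X.
Proof. exact: (proj2 C_ss). Qed.

Lemma schur X Y (f : hom X Y) : simple X -> simple Y -> f != 0 -> is_iso f.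
Proof.
move=> sX sY f0; have [K [i ki]] := ss_kernel f.
case: (proj2 sX K i (kernel_mono ki)) => [zK|[j ij]].
  case: (proj2 sY X f (mono_kernel0 ki zK)) => // zX.
  by case: (proj1 sX).
case: ki => fi _; case/eqP: f0.
by apply: (fwd_injr (i := j)); rewrite ij fi comp0m.
Qed.

Lemma simple_occurs X Y : simple X -> simple Y -> occurs X Y -> isomorphic X Y.
Proof. by move=> sX sY [f f0]; apply: is_iso_isomorphic (schur sX sY f0). Qed.

Lemma occurs_simple X Y : simple X -> isomorphic X Y -> occurs X Y.
Proof.
move=> sX [i]; exists (fwd i).
rewrite -[fwd i]kcompm1 comp_iso_neq0 ?simple_id_neq0 //; by exists i.
Qed.

Lemma from_simple_split Z X (f : hom Z X) :
  simple Z -> f != 0 -> exists g, g ∘ f = \id_Z.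
Proof.
move=> sZ f0; have [n [s [ss [i [p [pi1 pi0 ip]]]]]] := ss_decomp X.
have [a pf0] : exists a, p a ∘ f != 0.
  apply: contrapT => no; case/eqP: f0.
  rewrite -[f]kcomp1m -ip comp_suml big1 // => a _.
  rewrite -kcompA; case: (eqVneq (p a ∘ f) 0) => [->|nz]; first exact: compm0.
  by case: no; exists a.
have [j ej] := schur sZ (ss a) pf0.
by exists (bwd j ∘ p a); rewrite -kcompA -ej bwdK.
Qed.

Lemma to_simple_split X Z (f : hom X Z) :
  simple Z -> f != 0 -> exists g, f ∘ g = \id_Z.
Proof.
move=> sZ f0; have [n [s [ss [i [p [pi1 pi0 ip]]]]]] := ss_decomp X.
have [a pf0] : exists a, f ∘ i a != 0.
  apply: contrapT => no; case/eqP: f0.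
  rewrite -[f]kcompm1 -ip comp_sumr big1 // => a _.
  rewrite kcompA; case: (eqVneq (f ∘ i a) 0) => [->|nz]; first exact: comp0m.
  by case: no; exists a.
have [j ej] := schur (ss a) sZ pf0.
by exists (i a ∘ bwd j); rewrite kcompA -ej fwdK.
Qed.

Lemma occurs_to Z X : simple Z -> (occurs Z X <-> exists f : hom X Z, f != 0).
Proof.
move=> sZ; split=> -[f f0].
  have [g gf] := from_simple_split sZ f0; exists g.
  by apply: contraNneq (simple_id_neq0 sZ) => g0; rewrite -gf g0 comp0m.
have [g gf] := to_simple_split sZ f0; exists g.
by apply: contraNneq (simple_id_neq0 sZ) => g0; rewrite -gf g0 compm0.
Qed.

Lemma exists_constituent X : ~ is_zero X -> exists Z, simple Z /\ occurs Z X.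
Proof.
move=> nz; have [n [s [ss [i [p [pi1 pi0 ip]]]]]] := ss_decomp X.
case: (posnP n) => [n0|n_gt0].
  case: nz; rewrite /is_zero -ip; move: s ss i p pi1 pi0 ip; rewrite n0.
  by move=> s ss i p _ _ _; rewrite big_ord0.
pose a := Ordinal n_gt0; exists (s a); split=> //; exists (i a).
apply: contraNneq (simple_id_neq0 (ss a)) => i0.
by rewrite -(pi1 a) i0 compm0.
Qed.

(* McCoy's lemma: if [f - f u f] is von Neumann regular, so is [f]. It lowers
   the number of simple summands on which [f] does not vanish. *)
Lemma ss_regular X Y (f : hom X Y) : exists g, f ∘ g ∘ f = f.
Proof.
have [n [s [ss [i [p [pi1 pi0 ip]]]]]] := ss_decomp X.
have [m] := ubnP #|[set a | f ∘ i a != 0]|.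
elim: m f => // m IH f lt_m.
case: (eqVneq f 0) => [->|f0]; first by exists 0; rewrite !comp0m.
have [a fa0] : exists a, f ∘ i a != 0.
  apply: contrapT => no; case/eqP: f0.
  rewrite -[f]kcompm1 -ip comp_sumr big1 // => a _.
  rewrite kcompA; case: (eqVneq (f ∘ i a) 0) => [->|nz]; first exact: comp0m.
  by case: no; exists a.
have [r rfi] := from_simple_split (ss a) fa0.
(* [f ∘ u ∘ f] agrees with [f] on the summand [a], and vanishes on every summand where [f] does. *)
pose u := i a ∘ r; pose f' := f - f ∘ u ∘ f.
have f'a : f' ∘ i a = 0.
  by rewrite /f' /u compBl -!kcompA rfi kcompm1 subrr.
have f'b b : f ∘ i b = 0 -> f' ∘ i b = 0.
  by move=> fb; rewrite /f' compBl -!kcompA fb !compm0 subr0.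
have [|g' fg'f] := IH f'.
  rewrite -ltnS; apply: leq_trans lt_m; rewrite ltnS; apply: proper_card.
  apply/properP; split; last by exists a; rewrite !inE ?f'a ?eqxx.
  by apply/fintype.subsetP => b; rewrite !inE; apply: contraNneq => /f'b->.
have ef : f' = f - f ∘ u ∘ f by [].
clearbody f'; clearbody u.
exists (u + (\id_X - u ∘ f) ∘ g' ∘ (\id_Y - f ∘ u)).
rewrite compDr compDl !kcompA.
have -> : f ∘ (\id_X - u ∘ f) = f' by rewrite compBr kcompm1 kcompA ef.
rewrite -[X in _ + X]kcompA.
have -> : (\id_Y - f ∘ u) ∘ f = f' by rewrite compBl kcomp1m ef.
by rewrite fg'f ef addrC subrK.
Qed.

Lemma mono_split X Y (f : hom X Y) : mono f -> exists g, g ∘ f = \id_X.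
Proof.
have [g fgf] := ss_regular f => mf; exists g; apply: mf.
by rewrite kcompA fgf kcompm1.
Qed.
(** The right-hand side consists of equations between morphisms, which every linear functor
    preserves. This is the source of right exactness for all functors out of a semisimple
    category. *)
Lemma cokernel_splitP X Y Q (f : hom X Y) (p : hom Y Q) :
  is_cokernel f p <->
  p ∘ f = 0 /\ exists r g, p ∘ r = \id_Q /\ r ∘ p = \id_Y - f ∘ g.
Proof.
split.
  move=> cp; have [pf univ] := cp; split=> //.
  have [g fgf] := ss_regular f.
  have /univ [r [rp _]] : (\id_Y - f ∘ g) ∘ f = 0.
    by rewrite compBl kcomp1m fgf subrr.
  exists r, g; split=> //; apply: (cokernel_epi cp).
  by rewrite -kcompA rp kcomp1m compBr kcompm1 kcompA pf comp0m subr0.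
move=> [pf [r [g [pr rp]]]]; split=> // Z h hf; exists (h ∘ r); split.
  by rewrite -kcompA rp compBr kcompm1 kcompA hf comp0m subr0.
by move=> u <-; rewrite -kcompA pr kcompm1.
Qed.

Lemma kernel_splitP X Y K (f : hom X Y) (i : hom K X) :
  is_kernel f i <->
  f ∘ i = 0 /\ exists r g, r ∘ i = \id_K /\ i ∘ r = \id_X - g ∘ f.
Proof.
split.
  move=> cp; have [pf univ] := cp; split=> //.
  have [g fgf] := ss_regular f.
  have /univ [r [rp _]] : f ∘ (\id_X - g ∘ f) = 0.
    by rewrite compBr kcompm1 kcompA fgf subrr.
  exists r, g; split=> //; apply: (kernel_mono cp).
  by rewrite kcompA rp kcompm1 compBl kcomp1m -kcompA pf compm0 subr0.
move=> [pf [r [g [pr rp]]]]; split=> // Z h hf; exists (r ∘ h); split.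
  by rewrite kcompA rp compBl kcomp1m -kcompA hf compm0 subr0.
by move=> u <-; rewrite kcompA pr kcomp1m.
Qed.

(** Converse of Schur's lemma: a subobject [i] has a retraction [g], and the idempotent [i ∘ g] is a
    scalar, hence 0 or 1. *)
Lemma scalar_end_simple X :
  ~ is_zero X -> (forall f : hom X X, exists a, f = a *: \id_X) -> simple X.
Proof.
move=> nz sc; split=> // Y i mi; have [g gi] := mono_split mi.
have [a ig] := sc (i ∘ g).
have e : a *: i = i by rewrite -[i in LHS]kcomp1m -compZl -ig -kcompA gi kcompm1.
case: (eqVneq a 0) => [a0|a0].
  by left; rewrite /is_zero -gi -e a0 scale0r compm0.
right; apply: (@is_isoP _ _ _ _ _ g) => //.
rewrite ig; have: (a - 1) *: (i ∘ g) = 0.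
  by rewrite scalerBl scale1r -compZl e subrr.
rewrite ig scalerA => /eqP; rewrite scaler_eq0 mulf_eq0 (negPf a0) orbF.
by rewrite subr_eq0 => /orP[/eqP->|/eqP]; [rewrite scale1r | case/nz].
Qed.

End Abelian.

(** * Schur's lemma over an algebraically closed field *)

Section ClosedField.
Variables (k : closedFieldType) (C : kcat k).
Hypothesis C_ss : semisimple_cat C.
Hypothesis C_fin : forall X Y : C, exists n, has_dim (hom X Y) n.
Implicit Types (X Y Z W : C).

(** Composition with [f] on the finite-dimensional space [hom X X] has an eigenvector. It is a
    nonzero endomorphism of a simple object, hence invertible, and cancelling it turns [f] into the
    eigenvalue. *)
Lemma schur_scalar X (f : hom X X) : simple X -> exists a, f = a *: \id_X.
Proof.
move=> sX; have [n [[v vl [w vK wK]]]] := C_fin X X.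
have wl : linear w.
  by move=> a x y; apply: (can_inj vK); rewrite wK vl !wK.
pose L := lin1_mx (fun x : 'rV_n => v (f ∘ w x)).
have LE x : x *m L = v (f ∘ w x).
  pose g := fun x : 'rV_n => v (f ∘ w x).
  have gl : linear g.
    by move=> a y z; rewrite /g wl kcomp_linearr vl.
  pose g' : {linear 'rV_n -> 'rV_n} :=
    HB.pack g (GRing.isLinear.Build _ _ _ _ g gl).
  exact: (mul_rV_lin1 g' x).
have n_gt0 : (0 < n)%N.
  rewrite lt0n; apply/negP => /eqP n0; case/eqP: (simple_id_neq0 sX).
  apply: (can_inj vK); apply/rowP => i.
  by have := ltn_ord i; rewrite {2}n0.
have [a] : exists a, root (char_poly L) a.
  apply: closed_rootP; by rewrite size_char_poly eqSS -lt0n.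
rewrite -eigenvalue_root_char => /eigenvalueP[x xL x0]; exists a.
have fx : (f - a *: \id_X) ∘ w x = 0.
  apply: (can_inj vK); rewrite compBl (linB vl) -LE xL compZl kcomp1m.
  by rewrite (linZ vl) wK subrr (lin0 vl).
have wx0 : w x != 0.
  by apply: contraNneq x0 => e; rewrite -[x]wK e (lin0 vl).
have [j ej] := schur C_ss sX sX wx0.
apply/eqP; rewrite -subr_eq0; apply/eqP.
by apply: (fwd_injr (i := j)); rewrite ej fx comp0m.
Qed.

Lemma simple_hom_scalar X Y (f g : hom X Y) :
  simple X -> simple Y -> f != 0 -> exists a, g = a *: f.
Proof.
move=> sX sY /(schur C_ss sX sY) [i <-].
have [a e] := schur_scalar (bwd i ∘ g) sX; exists a.
by apply: (bwd_inj (i := i)); rewrite e compZr bwdK.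
Qed.

End ClosedField.

(** * Monoidal and braided categories *)

Section Rewriting.
Variables (k : fieldType) (C : kcat k).

Lemma comp2 (X Y Z W : C) (g : hom Y Z) (f : hom X Y) (e : hom X Z)
    (h : hom Z W) :
  g ∘ f = e -> h ∘ g ∘ f = h ∘ e.
Proof. by move=> <-; rewrite kcompA. Qed.

Lemma comp3 (X Y Z V W : C) (g1 : hom Z V) (g : hom Y Z) (f : hom X Y)
    (e : hom X V) (h : hom V W) :
  g1 ∘ g ∘ f = e -> h ∘ g1 ∘ g ∘ f = h ∘ e.
Proof. by move=> <-; rewrite !kcompA. Qed.

Lemma fwdKr (X Y Z : C) (i : iso X Y) (f : hom Y Z) : f ∘ fwd i ∘ bwd i = f.
Proof. by rewrite -kcompA fwdK kcompm1. Qed.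
Lemma bwdKr (X Y Z : C) (i : iso X Y) (f : hom X Z) : f ∘ bwd i ∘ fwd i = f.
Proof. by rewrite -kcompA bwdK kcompm1. Qed.

End Rewriting.

(* [hat f U] lets [f : X ⊗ Y -> Z] act on right-nested tensor words with an
   arbitrary tail [U]; all string diagrams below are written with such words,
   so that associators never show up. *)
HB.lock Definition hat (k : fieldType) (C : moncat k) (X Y Z : C)
    (f : hom (X ⊗ Y) Z) (U : C) : hom (X ⊗ (Y ⊗ U)) (Z ⊗ U) :=
  (f ▷ U) ∘ bwd (asc X Y U).

(* The braiding of the first two letters of a word. *)
HB.lock Definition ch (k : fieldType) (C : moncat k) (bc : braiding C)
    (X Y U : C) : hom (X ⊗ (Y ⊗ U)) (Y ⊗ (X ⊗ U)) :=
  fwd (asc Y X U) ∘ hat (fwd (braid bc X Y)) U.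

(** [evh] and [coevh] below are the counit and unit of the adjunction between [X ⊗ -] and [Y ⊗ -],
    in the language of words. *)
HB.lock Definition evh (k : fieldType) (C : moncat k) (X Y : C)
    (ev : hom (X ⊗ Y) 𝟙) (U : C) : hom (X ⊗ (Y ⊗ U)) U :=
  fwd (lun U) ∘ hat ev U.

HB.lock Definition coevh (k : fieldType) (C : moncat k) (X Y : C)
    (coev : hom 𝟙 (Y ⊗ X)) (U : C) : hom U (Y ⊗ (X ⊗ U)) :=
  fwd (asc Y X U) ∘ (coev ▷ U) ∘ bwd (lun U).

Section Tensor.
Variables (k : fieldType) (C : moncat k).
Implicit Types (X Y Z W U V : C).

Lemma lw1 X Y : X ◁ \id_Y = \id_(X ⊗ Y).
Proof. exact: bmor1. Qed.
Lemma rw1 X Y : \id_X ▷ Y = \id_(X ⊗ Y).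
Proof. exact: bmor1. Qed.
Lemma lwM X Y Z W (g : hom Z W) (f : hom Y Z) : X ◁ (g ∘ f) = (X ◁ g) ∘ (X ◁ f).
Proof. by rewrite -bmorM kcomp1m. Qed.
Lemma rwM X Y Z W (g : hom Z W) (f : hom Y Z) : (g ∘ f) ▷ X = (g ▷ X) ∘ (f ▷ X).
Proof. by rewrite -bmorM kcomp1m. Qed.
Lemma lrw X X' Y Y' (f : hom X X') (g : hom Y Y') :
  (f ▷ Y') ∘ (X ◁ g) = f ⊗₁ g.
Proof. by rewrite -bmorM kcomp1m kcompm1. Qed.
Lemma rlw X X' Y Y' (f : hom X X') (g : hom Y Y') :
  (X' ◁ g) ∘ (f ▷ Y) = f ⊗₁ g.
Proof. by rewrite -bmorM kcomp1m kcompm1. Qed.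
Lemma exch X X' Y Y' (f : hom X X') (g : hom Y Y') :
  (f ▷ Y') ∘ (X ◁ g) = (X' ◁ g) ∘ (f ▷ Y).
Proof. by rewrite lrw rlw. Qed.

Lemma lwZ X Y Z a (f : hom Y Z) : X ◁ (a *: f) = a *: (X ◁ f).
Proof. exact: (linZ (bmor_linearr tens \id_X)). Qed.
Lemma rwZ X Y Z a (f : hom Y Z) : (a *: f) ▷ X = a *: (f ▷ X).
Proof. exact: (linZ (bmor_linearl tens \id_X)). Qed.
Lemma lw_sum X Y Z (I : Type) (r : seq I) (P : pred I) (F : I -> hom Y Z) :
  X ◁ (\sum_(i <- r | P i) F i) = \sum_(i <- r | P i) (X ◁ F i).
Proof. exact: (lin_sum (bmor_linearr tens \id_X)). Qed.
Lemma rw_sum X Y Z (I : Type) (r : seq I) (P : pred I) (F : I -> hom Y Z) :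
  (\sum_(i <- r | P i) F i) ▷ X = \sum_(i <- r | P i) (F i ▷ X).
Proof. exact: (lin_sum (bmor_linearl tens \id_X)). Qed.
Lemma lw0 X Y Z : X ◁ (0 : hom Y Z) = 0.
Proof. exact: (lin0 (bmor_linearr tens \id_X)). Qed.
Lemma rw0 X Y Z : (0 : hom Y Z) ▷ X = 0.
Proof. exact: (lin0 (bmor_linearl tens \id_X)). Qed.

Lemma tens_isoK X X' Y Y' (i : iso X X') (j : iso Y Y') :
  (bwd i ⊗₁ bwd j) ∘ (fwd i ⊗₁ fwd j) = \id_(X ⊗ Y).
Proof. by rewrite -bmorM !bwdK bmor1. Qed.
Definition tens_iso X X' Y Y' (i : iso X X') (j : iso Y Y') :
    iso (X ⊗ Y) (X' ⊗ Y') :=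
  Iso (tens_isoK i j) (tens_isoK (iso_inv i) (iso_inv j)).

Lemma tens_isomorphic X X' Y Y' :
  isomorphic X X' -> isomorphic Y Y' -> isomorphic (X ⊗ Y) (X' ⊗ Y').
Proof. by case=> i [j]; exact: inhabits (tens_iso i j). Qed.

Lemma ascN1 X X' Y Z (f : hom X X') :
  fwd (asc X' Y Z) ∘ (f ▷ Y ▷ Z) = (f ▷ (Y ⊗ Z)) ∘ fwd (asc X Y Z).
Proof. by rewrite asc_natural lw1. Qed.
Lemma ascN2 X Y Y' Z (f : hom Y Y') :
  fwd (asc X Y' Z) ∘ ((X ◁ f) ▷ Z) = (X ◁ (f ▷ Z)) ∘ fwd (asc X Y Z).
Proof. exact: asc_natural. Qed.
Lemma ascN3 X Y Z Z' (f : hom Z Z') :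
  fwd (asc X Y Z') ∘ ((X ⊗ Y) ◁ f) = (X ◁ (Y ◁ f)) ∘ fwd (asc X Y Z).
Proof. by rewrite -asc_natural lw1. Qed.

Lemma iso_conj (A B A' B' : C) (i : iso A A') (j : iso B B')
    (f : hom A B) (g : hom A' B') :
  fwd j ∘ f = g ∘ fwd i -> bwd j ∘ g = f ∘ bwd i.
Proof.
move=> e; apply: (fwd_inj (i := j)); apply: (fwd_injr (i := i)).
by rewrite !kcompA fwdK kcomp1m e -[_ ∘ _ ∘ fwd i]kcompA bwdK kcompm1.
Qed.

Lemma ascN1' X X' Y Z (f : hom X X') :
  bwd (asc X' Y Z) ∘ (f ▷ (Y ⊗ Z)) = (f ▷ Y ▷ Z) ∘ bwd (asc X Y Z).
Proof. exact/iso_conj/ascN1. Qed.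
Lemma ascN2' X Y Y' Z (f : hom Y Y') :
  bwd (asc X Y' Z) ∘ (X ◁ (f ▷ Z)) = ((X ◁ f) ▷ Z) ∘ bwd (asc X Y Z).
Proof. exact/iso_conj/ascN2. Qed.
Lemma ascN3' X Y Z Z' (f : hom Z Z') :
  bwd (asc X Y Z') ∘ (X ◁ (Y ◁ f)) = ((X ⊗ Y) ◁ f) ∘ bwd (asc X Y Z).
Proof. exact/iso_conj/ascN3. Qed.

Definition lw_iso X Y Z (i : iso Y Z) : iso (X ⊗ Y) (X ⊗ Z) :=
  tens_iso (iso_id X) i.
Definition rw_iso X Y Z (i : iso Y Z) : iso (Y ⊗ X) (Z ⊗ X) :=
  tens_iso i (iso_id X).

Lemma pent2 X Y Z W :
  bwd (asc (X ⊗ Y) Z W) ∘ bwd (asc X Y (Z ⊗ W)) =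
  (bwd (asc X Y Z) ▷ W) ∘ bwd (asc X (Y ⊗ Z) W) ∘ (X ◁ bwd (asc Y Z W)).
Proof.
pose i := iso_comp (asc (X ⊗ Y) Z W) (asc X Y (Z ⊗ W)).
pose j := iso_comp (iso_comp (rw_iso W (asc X Y Z)) (asc X (Y ⊗ Z) W))
                   (lw_iso X (asc Y Z W)).
have e : fwd i = fwd j by rewrite /= pentagon !kcompA.
transitivity (bwd i); first by [].
transitivity (bwd j); last by [].
by apply: (fwd_inj (i := i)); rewrite fwdK e fwdK.
Qed.

Lemma pent3 X Y Z W :
  bwd (asc X Y (Z ⊗ W)) ∘ (X ◁ fwd (asc Y Z W)) =
  fwd (asc (X ⊗ Y) Z W) ∘ (bwd (asc X Y Z) ▷ W) ∘ bwd (asc X (Y ⊗ Z) W).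
Proof.
apply: (bwd_inj (i := asc (X ⊗ Y) Z W)).
by rewrite !kcompA pent2 bwdK kcomp1m (comp2 _ (esym (lwM _ _ _))) bwdK lw1 kcompm1.
Qed.

Lemma lun_inj X Y (f g : hom X Y) : 𝟙 ◁ f = 𝟙 ◁ g -> f = g.
Proof.
by move=> e; apply: (fwd_injr (i := lun X)); rewrite -!lun_natural e.
Qed.
Lemma run_inj X Y (f g : hom X Y) : f ▷ 𝟙 = g ▷ 𝟙 -> f = g.
Proof.
by move=> e; apply: (fwd_injr (i := run X)); rewrite -!run_natural e.
Qed.

(** Kelly's argument: [𝟙 ⊗ -] is faithful by naturality of [lun], and after applying it the claim
    follows from pentagon and triangle. *)
Lemma lun_tens X Y :
  fwd (lun (X ⊗ Y)) ∘ fwd (asc 𝟙 X Y) = fwd (lun X) ▷ Y.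
Proof.
apply: lun_inj; apply: (fwd_injr (i := asc 𝟙 (𝟙 ⊗ X) Y)).
apply: (fwd_injr (i := rw_iso Y (asc 𝟙 𝟙 X))).
rewrite lwM /= (comp3 _ (esym (pentagon _ _ _ _))) kcompA triangle -ascN1.
by rewrite -ascN2 -kcompA -rwM triangle.
Qed.

Lemma run_tens X Y :
  (X ◁ fwd (run Y)) ∘ fwd (asc X Y 𝟙) = fwd (run (X ⊗ Y)).
Proof.
apply: run_inj; apply: (fwd_inj (i := asc X Y 𝟙)).
rewrite rwM kcompA ascN2 -triangle lwM.
rewrite (comp3 _ (esym (pentagon _ _ _ _))).
by rewrite kcompA -ascN3 -kcompA triangle.
Qed.

Lemma lun_run_one : fwd (lun (𝟙 : C)) = fwd (run 𝟙).
Proof.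
apply: run_inj; rewrite -lun_tens -triangle; congr (_ ∘ _).
apply: (fwd_inj (i := lun 𝟙)); exact: esym (lun_natural _).
Qed.

Lemma hat_nat X Y Z (f : hom (X ⊗ Y) Z) U V (g : hom U V) :
  hat f V ∘ (X ◁ (Y ◁ g)) = (Z ◁ g) ∘ hat f U.
Proof. by rewrite hat.unlock -kcompA ascN3' !kcompA exch. Qed.

Lemma hatZ X Y Z a (f : hom (X ⊗ Y) Z) U : hat (a *: f) U = a *: hat f U.
Proof. by rewrite hat.unlock rwZ compZl. Qed.

Lemma hat_lw X Y Y' Z (f : hom (X ⊗ Y') Z) (g : hom Y Y') U :
  hat (f ∘ (X ◁ g)) U = hat f U ∘ (X ◁ (g ▷ U)).
Proof. by rewrite hat.unlock rwM -!kcompA ascN2'. Qed.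
Lemma hat_rw X X' Y Z (f : hom (X' ⊗ Y) Z) (g : hom X X') U :
  hat (f ∘ (g ▷ Y)) U = hat f U ∘ (g ▷ (Y ⊗ U)).
Proof. by rewrite hat.unlock rwM -!kcompA ascN1'. Qed.
Lemma hat_comp X Y Z Z' (f : hom (X ⊗ Y) Z) (g : hom Z Z') U :
  hat (g ∘ f) U = (g ▷ U) ∘ hat f U.
Proof. by rewrite hat.unlock rwM kcompA. Qed.

Lemma hat_hat X Y Z W V (f : hom (X ⊗ Y) Z) (g : hom (Z ⊗ W) V) U :
  hat (g ∘ hat f W) U ∘ (X ◁ bwd (asc Y W U)) = hat g U ∘ hat f (W ⊗ U).
Proof.
rewrite hat.unlock !rwM !kcompA (comp3 _ (esym (pent2 _ _ _ _))) !kcompA.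
by rewrite (comp2 _ (ascN1' _ _ _)) !kcompA.
Qed.

(** A relation between two reductions of a three-letter word, up to a scalar, persists in front of
    any tail. Only the case without tail then has to be checked. *)
Lemma hat_relation X Y Z Z' W V a (f : hom (X ⊗ Y) Z) (g : hom (Z ⊗ W) V)
    (f' : hom (X ⊗ Z') V) (g' : hom (Y ⊗ W) Z') U :
  f' ∘ (X ◁ g') = a *: (g ∘ hat f W) ->
  hat f' U ∘ (X ◁ hat g' U) = a *: (hat g U ∘ hat f (W ⊗ U)).
Proof.
move=> e; rewrite -hat_hat -compZl -hatZ -e hat_lw -kcompA.
by rewrite -lwM hat.unlock.
Qed.

Section Duality.
Variables (X Y : C) (ev : hom (X ⊗ Y) 𝟙) (coev : hom 𝟙 (Y ⊗ X)).
Hypothesis snake1 : fwd (run Y) ∘ (Y ◁ ev) ∘ fwd (asc Y X Y) ∘ (coev ▷ Y) =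
  fwd (lun Y).
Hypothesis snake2 : fwd (lun X) ∘ (ev ▷ X) ∘ bwd (asc X Y X) ∘ (X ◁ coev) =
  fwd (run X).

Notation evh := (evh ev).
Notation coevh := (coevh coev).

Lemma evh_nat U V (g : hom U V) : evh V ∘ (X ◁ (Y ◁ g)) = g ∘ evh U.
Proof. by rewrite evh.unlock -kcompA hat_nat !kcompA lun_natural. Qed.

Lemma lun_natural' U V (g : hom U V) :
  bwd (lun V) ∘ g = (𝟙 ◁ g) ∘ bwd (lun U).
Proof. by apply: iso_conj; rewrite lun_natural. Qed.

Lemma coevh_nat U V (g : hom U V) : coevh V ∘ g = (Y ◁ (X ◁ g)) ∘ coevh U.
Proof.
rewrite coevh.unlock -kcompA lun_natural' !kcompA (comp2 _ (exch _ _)) kcompA.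
by rewrite ascN3.
Qed.

Lemma triangle' Z U :
  (fwd (run Z) ▷ U) ∘ bwd (asc Z 𝟙 U) = Z ◁ fwd (lun U).
Proof. by rewrite -triangle -kcompA fwdK kcompm1. Qed.

(** The snake identities in front of a tail: [Y ⊗ -] is right adjoint to [X ⊗ -]. *)
Lemma evhK U : evh (X ⊗ U) ∘ (X ◁ coevh U) = \id_(X ⊗ U).
Proof.
rewrite evh.unlock coevh.unlock hat.unlock !lwM !kcompA (comp2 _ (pent3 _ _ _ _)) !kcompA.
rewrite (comp2 _ (esym (ascN1 _ _ _))) !kcompA lun_tens.
rewrite (comp2 _ (ascN2' _ _ _)) !kcompA -!rwM snake2.
by rewrite triangle' -lwM fwdK lw1.
Qed.

Lemma coevhK U : (Y ◁ evh U) ∘ coevh (Y ⊗ U) = \id_(Y ⊗ U).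
Proof.
rewrite evh.unlock coevh.unlock hat.unlock !lwM !kcompA.
have P : (Y ◁ bwd (asc X Y U)) ∘ fwd (asc Y X (Y ⊗ U)) =
    fwd (asc Y (X ⊗ Y) U) ∘ (fwd (asc Y X Y) ▷ U) ∘ bwd (asc (Y ⊗ X) Y U).
  apply: (fwd_injr (i := asc (Y ⊗ X) Y U)).
  by rewrite -kcompA pentagon !kcompA -lwM bwdK lw1 kcomp1m bwdKr.
rewrite (comp2 _ P) !kcompA (comp2 _ (ascN1' _ _ _)) !kcompA.
rewrite (comp2 _ (esym (ascN2 _ _ _))) !kcompA triangle -!rwM snake1.
have -> : fwd (lun Y) ▷ U = fwd (lun (Y ⊗ U)) ∘ fwd (asc 𝟙 Y U).
  by rewrite lun_tens.
by rewrite fwdKr fwdK.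
Qed.

Lemma adjK U V (f : hom (X ⊗ U) V) :
  evh V ∘ (X ◁ ((Y ◁ f) ∘ coevh U)) = f.
Proof. by rewrite lwM kcompA evh_nat -kcompA evhK kcompm1. Qed.

Lemma adjK' U V (g : hom U (Y ⊗ V)) :
  (Y ◁ (evh V ∘ (X ◁ g))) ∘ coevh U = g.
Proof. by rewrite lwM -kcompA -coevh_nat kcompA coevhK kcomp1m. Qed.

(** The internal endomorphism object [Y ⊗ X] acts on [X] from the right by evaluation, and [T] acts
    through [i]. This is the form in which that action appears in [hom_generation]. *)
Lemma evh_hat T (i : hom T (Y ⊗ X)) U :
  hat (evh X ∘ (X ◁ i)) U = evh (X ⊗ U) ∘ (X ◁ (fwd (asc Y X U) ∘ (i ▷ U))).
Proof.
rewrite hat_lw lwM !kcompA; congr (_ ∘ _).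
apply: (fwd_injr (i := lw_iso X (iso_inv (asc Y X U)))) => /=.
rewrite evh.unlock hat_hat -[in RHS]kcompA -lwM fwdK lw1 kcompm1 hat.unlock !kcompA.
by rewrite -lun_tens fwdKr.
Qed.

End Duality.

End Tensor.

Section Braided.
Variables (k : fieldType) (C : moncat k) (bc : braiding C).
Implicit Types (X Y Z W U V : C).
Notation "'β' X Y" := (fwd (braid bc X Y)) (at level 10, X, Y at level 8).

Notation ch := (ch bc).

Lemma ch_tail X Y U V (g : hom U V) :
  ch X Y V ∘ (X ◁ (Y ◁ g)) = (Y ◁ (X ◁ g)) ∘ ch X Y U.
Proof. by rewrite ch.unlock -kcompA hat_nat !kcompA ascN3. Qed.

Lemma ch_left X X' Y U (f : hom X X') :
  ch X' Y U ∘ (f ▷ (Y ⊗ U)) = (Y ◁ (f ▷ U)) ∘ ch X Y U.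
Proof.
by rewrite ch.unlock -kcompA -hat_rw braid_natural hat_comp !kcompA ascN2.
Qed.

Lemma ch_mid X Y Y' U (f : hom Y Y') :
  ch X Y' U ∘ (X ◁ (f ▷ U)) = (f ▷ (X ⊗ U)) ∘ ch X Y U.
Proof.
by rewrite ch.unlock -kcompA -hat_lw braid_natural hat_comp !kcompA ascN1.
Qed.

Lemma hexa1 X Y Z : β X (Y ⊗ Z) =
  bwd (asc Y Z X) ∘ (Y ◁ β X Z) ∘ fwd (asc Y X Z) ∘ (β X Y ▷ Z)
    ∘ bwd (asc X Y Z).
Proof.
apply: (fwd_inj (i := asc Y Z X)); apply: (fwd_injr (i := asc X Y Z)).
by rewrite hexagon1 !kcompA fwdK kcomp1m bwdKr.
Qed.

Lemma hexa2 X Y Z : β (X ⊗ Y) Z =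
  fwd (asc Z X Y) ∘ (β X Z ▷ Y) ∘ bwd (asc X Z Y) ∘ (X ◁ β Y Z)
    ∘ fwd (asc X Y Z).
Proof.
apply: (bwd_inj (i := asc Z X Y)); apply: (bwd_injr (i := asc X Y Z)).
by rewrite hexagon2 !kcompA bwdK kcomp1m fwdKr.
Qed.

Lemma ch_tens_mid X Y Z U :
  ch X (Y ⊗ Z) U ∘ (X ◁ bwd (asc Y Z U)) =
  bwd (asc Y Z (X ⊗ U)) ∘ (Y ◁ ch X Z U) ∘ ch X Y (Z ⊗ U).
Proof.
rewrite ch.unlock hat.unlock !lwM !kcompA hexa1 !rwM !kcompA.
rewrite pent3 (comp2 _ (ascN2' _ _ _)) !kcompA.
have P : bwd (asc Y (X ⊗ Z) U) ∘ (Y ◁ bwd (asc X Z U)) ∘ fwd (asc Y X (Z ⊗ U))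
    = (fwd (asc Y X Z) ▷ U) ∘ bwd (asc (Y ⊗ X) Z U).
  apply: (bwd_injr (i := asc Y X (Z ⊗ U))); rewrite fwdKr -kcompA pent2 !kcompA.
  by rewrite -rwM fwdK rw1 kcomp1m.
rewrite (comp3 _ P) !kcompA (comp2 _ (ascN1' _ _ _)) !kcompA.
by rewrite (comp2 _ (pent2 _ _ _ _)) !kcompA.
Qed.

Lemma ch_tens_left X Y Z U :
  ch (X ⊗ Y) Z U ∘ bwd (asc X Y (Z ⊗ U)) =
  (Z ◁ bwd (asc X Y U)) ∘ ch X Z (Y ⊗ U) ∘ (X ◁ ch Y Z U).
Proof.
rewrite ch.unlock hat.unlock !lwM !kcompA hexa2 !rwM !kcompA.
have P1 : (Z ◁ bwd (asc X Y U)) ∘ fwd (asc Z X (Y ⊗ U)) =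
    fwd (asc Z (X ⊗ Y) U) ∘ (fwd (asc Z X Y) ▷ U) ∘ bwd (asc (Z ⊗ X) Y U).
  apply: (fwd_injr (i := asc (Z ⊗ X) Y U)).
  by rewrite -kcompA pentagon !kcompA -lwM bwdK lw1 kcomp1m bwdKr.
rewrite P1 (comp2 _ (ascN1' _ _ _)) !kcompA.
have P2 : bwd (asc (X ⊗ Z) Y U) ∘ bwd (asc X Z (Y ⊗ U)) ∘ (X ◁ fwd (asc Z Y U))
   = (bwd (asc X Z Y) ▷ U) ∘ bwd (asc X (Z ⊗ Y) U).
  apply: (bwd_injr (i := lw_iso X (asc Z Y U))) => /=.
  by rewrite pent2 -[LHS]kcompA -lwM fwdK lw1 kcompm1.
rewrite (comp3 _ P2) !kcompA (comp2 _ (ascN2' _ _ _)) !kcompA.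
rewrite (comp2 _ (pent2 _ _ _ _)) !kcompA.
have P3 : (fwd (asc X Y Z) ▷ U) ∘ (bwd (asc X Y Z) ▷ U) = \id_(_).
  by rewrite -rwM fwdK rw1.
by rewrite (comp2 _ P3) kcompm1.
Qed.

Lemma ch_hat_mid X Y Z T U (f : hom (Y ⊗ T) Z) :
  ch X Z U ∘ (X ◁ hat f U) = hat f (X ⊗ U) ∘ (Y ◁ ch X T U) ∘ ch X Y (T ⊗ U).
Proof.
rewrite {1}hat.unlock lwM kcompA ch_mid -kcompA ch_tens_mid hat.unlock.
by rewrite !kcompA.
Qed.

Lemma ch_hat_left X Y Z T U (f : hom (X ⊗ Y) T) :
  (Z ◁ hat f U) ∘ ch X Z (Y ⊗ U) ∘ (X ◁ ch Y Z U) = ch T Z U ∘ hat f (Z ⊗ U).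
Proof.
by rewrite hat.unlock [RHS]kcompA ch_left -[RHS]kcompA ch_tens_left lwM !kcompA.
Qed.

(** The Yang-Baxter equation: naturality lets the strand [X] slide past the crossing of [Y] and [Z],
    and the hexagon splits its crossing with a product into two. *)
Lemma ch_YB X Y Z U :
  (Z ◁ ch X Y U) ∘ ch X Z (Y ⊗ U) ∘ (X ◁ ch Y Z U) =
  ch Y Z (X ⊗ U) ∘ (Y ◁ ch X Z U) ∘ ch X Y (Z ⊗ U).
Proof.
have := ch_hat_mid X U (β Y Z).
have -> : hat (β Y Z) U = bwd (asc Z Y U) ∘ ch Y Z U.
  by rewrite ch.unlock kcompA bwdK kcomp1m.
rewrite lwM kcompA ch_tens_mid => e.
have -> : ch Y Z (X ⊗ U) = fwd (asc Z Y (X ⊗ U)) ∘ hat (β Y Z) (X ⊗ U).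
  by rewrite ch.unlock.
apply: (bwd_inj (i := asc Z Y (X ⊗ U))).
by rewrite !kcompA bwdK kcomp1m e.
Qed.

Lemma run_tens_one X : fwd (run (X ⊗ 𝟙)) = fwd (run X) ▷ 𝟙.
Proof.
by apply: (fwd_inj (i := run X)); rewrite -run_natural.
Qed.
Lemma lun_tens_one X : fwd (lun (𝟙 ⊗ X)) = 𝟙 ◁ fwd (lun X).
Proof.
by apply: (fwd_inj (i := lun X)); rewrite -lun_natural.
Qed.

(** Compatibility with the unit follows from the hexagon for [𝟙], [𝟙], [X]: one crossing of [𝟙] with
    [X] appears on both sides and cancels, being invertible. *)
Lemma braid_unitl X : fwd (run X) ∘ β 𝟙 X = fwd (lun X).
Proof.
apply: lun_inj; rewrite lwM; apply: (fwd_injr (i := asc 𝟙 𝟙 X)).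
apply: (fwd_inj (i := braid bc 𝟙 X)).
rewrite triangle -lun_run_one braid_natural hexa2 !kcompA triangle.
have -> : β 𝟙 X ∘ (𝟙 ◁ fwd (run X)) =
    (fwd (run X) ▷ 𝟙) ∘ (β 𝟙 X ▷ 𝟙) ∘ bwd (asc 𝟙 X 𝟙).
  apply: (fwd_injr (i := asc 𝟙 X 𝟙)).
  by rewrite bwdKr -kcompA run_tens -run_natural run_tens_one.
by [].
Qed.

Lemma braid_unitr X : fwd (lun X) ∘ β X 𝟙 = fwd (run X).
Proof.
apply: run_inj; rewrite rwM; apply: (fwd_inj (i := braid bc X 𝟙)).
rewrite -triangle [in RHS]kcompA [in RHS]braid_natural hexa1 lun_run_one !kcompA.
rewrite triangle' bwdKr.
have -> : β X 𝟙 ∘ (fwd (lun X) ▷ 𝟙) =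
    (𝟙 ◁ fwd (lun X)) ∘ (𝟙 ◁ β X 𝟙) ∘ fwd (asc 𝟙 X 𝟙).
  by rewrite -lun_tens kcompA -lun_natural lun_tens_one.
by [].
Qed.

End Braided.

(** * Stabilisers act on the constituents of tensor powers *)

Section IsoTensor.
Variables (k : fieldType) (C : moncat k) (bc : braiding C).
Implicit Types (X Y Z W U V : C).

Lemma is_iso_id X : is_iso \id_X.
Proof. by exists (iso_id X). Qed.
Lemma is_iso_lw X Y Z (f : hom Y Z) : is_iso f -> is_iso (X ◁ f).
Proof. by case=> i <-; exists (lw_iso X i). Qed.
Lemma is_iso_rw X Y Z (f : hom Y Z) : is_iso f -> is_iso (f ▷ X).
Proof. by case=> i <-; exists (rw_iso X i). Qed.
Lemma is_iso_hat X Y Z (f : hom (X ⊗ Y) Z) U : is_iso f -> is_iso (hat f U).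
Proof.
move=> fi; rewrite hat.unlock; apply: is_iso_comp; last exact: is_iso_rw.
by exists (iso_inv (asc X Y U)).
Qed.
Lemma is_iso_ch X Y U : is_iso (ch bc X Y U).
Proof.
rewrite ch.unlock; apply: is_iso_comp; last by exists (asc Y X U).
by apply: is_iso_hat; exists (braid bc X Y).
Qed.

(** The variable tail [U] makes inductions on words possible; [U = 𝟙] gives the tensor power
    [X^n]. *)
Fixpoint itens X n U : C := if n is n'.+1 then X ⊗ itens X n' U else U.

Fixpoint imap X n U V (g : hom U V) : hom (itens X n U) (itens X n V) :=
  if n is n'.+1 then X ◁ imap X n' g else g.

(** The strand [Y] crosses [n] strands [X], one at a time, from the head of the tail to the
    front. *)
Fixpoint bmv X Y n U : hom (itens X n (Y ⊗ U)) (Y ⊗ itens X n U) :=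
  if n is n'.+1 then ch bc X Y (itens X n' U) ∘ (X ◁ bmv X Y n' U)
  else \id_(Y ⊗ U).

Lemma imapM X n U V W (g : hom V W) (f : hom U V) :
  imap X n (g ∘ f) = imap X n g ∘ imap X n f.
Proof. by elim: n => //= n ->; rewrite lwM. Qed.
Lemma imap1 X n U : imap X n \id_U = \id_(itens X n U).
Proof. by elim: n => //= n ->; rewrite lw1. Qed.
Lemma imap_sum X n U V (I : Type) (r : seq I) (P : pred I) (F : I -> hom U V) :
  imap X n (\sum_(i <- r | P i) F i) = \sum_(i <- r | P i) imap X n (F i).
Proof. by elim: n => //= n ->; rewrite lw_sum. Qed.

Lemma is_iso_bmv X Y n U : is_iso (bmv X Y n U).
Proof.
elim: n => [|n IH] /=; first exact: is_iso_id.
by apply: is_iso_comp; [exact: is_iso_lw | exact: is_iso_ch].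
Qed.

Lemma bmv_nat X Y n U V (g : hom U V) :
  bmv X Y n V ∘ imap X n (Y ◁ g) = (Y ◁ imap X n g) ∘ bmv X Y n U.
Proof.
elim: n => [|n IH] /=; first by rewrite kcomp1m kcompm1.
by rewrite -kcompA -lwM IH lwM !kcompA ch_tail.
Qed.

Lemma bmv_hat S X T Z (r : hom (X ⊗ T) Z) n U :
  bmv S Z n U ∘ imap S n (hat r U) =
  hat r (itens S n U) ∘ (X ◁ bmv S T n U) ∘ bmv S X n (T ⊗ U).
Proof.
elim: n => [|n IH] /=; first by rewrite kcomp1m lw1 !kcompm1.
rewrite -kcompA -lwM IH !lwM !kcompA ch_hat_mid.
by rewrite (comp2 _ (ch_tail _ _ _ _)) !kcompA.
Qed.

Lemma bmv_YB S X T n U :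
  (T ◁ bmv S X n U) ∘ bmv S T n (X ⊗ U) ∘ imap S n (ch bc X T U) =
  ch bc X T (itens S n U) ∘ (X ◁ bmv S T n U) ∘ bmv S X n (T ⊗ U).
Proof.
elim: n => [|n IH] /=; first by rewrite !lw1 !kcomp1m !kcompm1.
rewrite lwM !kcompA (comp2 _ (esym (ch_tail _ _ _ _))).
rewrite !kcompA -[LHS]kcompA -lwM -[LHS]kcompA -lwM kcompA IH !lwM !kcompA.
rewrite ch_YB (comp2 _ (ch_tail _ _ _ _)) !kcompA.
by [].
Qed.

End IsoTensor.

Section Commutation.
Variables (k : fieldType) (C : moncat k) (bc : braiding C).
Variables (S X : C) (f : hom (S ⊗ X) X).
Implicit Types (Y Z W U V T : C).
Notation bmv := (bmv bc).
Notation ch := (ch bc).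

(* [f] acting simultaneously on the [n] copies of [X], each copy of [S] being
   braided to the copy of [X] it acts on. *)
Fixpoint pact n Y : hom (itens S n (itens X n Y)) (itens X n Y) :=
  if n is n'.+1 then
    hat f (itens X n' Y) ∘ (S ◁ (X ◁ pact n' Y))
      ∘ (S ◁ bmv S X n' (itens X n' Y))
  else \id_Y.

Lemma is_iso_pact n Y : is_iso f -> is_iso (pact n Y).
Proof.
move=> fi; elim: n => [|n IH] /=; first exact: is_iso_id.
apply: is_iso_comp; first by apply: is_iso_lw; apply: is_iso_bmv.
apply: is_iso_comp; last exact: is_iso_hat.
by do 2!apply: is_iso_lw.
Qed.

(** The strand [T] may be drawn from the tail to the front before or after the action: naturality
    slides it across each [f], and Yang-Baxter reorders the crossings. In [pact_comm] this turns a
    letter created in the middle of a word into part of the tail. *)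
Lemma pact_bmv T n Y :
  (T ◁ pact n Y) ∘ bmv S T n (itens X n Y) ∘ imap S n (bmv X T n Y) =
  bmv X T n Y ∘ pact n (T ⊗ Y).
Proof.
elim: n => [|n IH] /=; first by rewrite lw1 !kcompm1.
rewrite !lwM !kcompA.
rewrite imapM [in LHS]lwM !kcompA.
rewrite (comp2 _ (esym (ch_tail _ _ _ _))) !kcompA.
rewrite (comp2 _ (esym (ch_tail _ _ _ _))) !kcompA.
set a := (T ◁ hat f _) ∘ _.
pose b := (T ◁ (X ◁ pact n Y)) ∘ (T ◁ bmv S X n (itens X n Y))
  ∘ bmv S T n (itens X n.+1 Y) ∘ imap S n (ch X T (itens X n Y))
  ∘ imap S n (X ◁ bmv X T n Y).
have -> : a ∘ S ◁ (T ◁ (X ◁ pact n Y)) ∘ S ◁ (T ◁ bmv S X n (itens X n Y))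
  ∘ S ◁ bmv S T n (X ⊗ itens X n Y) ∘ S ◁ imap S n (ch X T (itens X n Y))
  ∘ S ◁ imap S n (X ◁ bmv X T n Y) = a ∘ (S ◁ b).
  by rewrite /b !lwM !kcompA.
have -> : b = ch X T (itens X n Y) ∘ (X ◁ bmv X T n Y)
   ∘ (X ◁ pact n (T ⊗ Y)) ∘ bmv S X n (itens X n (T ⊗ Y)).
  rewrite /b (comp3 _ (bmv_YB bc S X T n (itens X n Y))) !kcompA -ch_tail.
  rewrite (comp2 _ (bmv_nat _ _ _ _ _)) !kcompA.
  have IH' := congr1 (fun u => X ◁ u) IH; rewrite !lwM in IH'.
  by rewrite (comp2 _ (esym IH')) !kcompA.
rewrite /a !lwM !kcompA ch_hat_left -[_ ∘ hat f _ ∘ _]kcompA hat_nat.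
by rewrite !kcompA.
Qed.

(* [Y] acts on [X] on the right, and this action commutes with the left action
   [f] of [S] up to the scalar [c]. *)
Definition twist Y c : Prop := exists r : hom (X ⊗ Y) X,
  is_iso r /\ f ∘ (S ◁ r) = c *: (r ∘ hat f Y).

Lemma twist_one : twist 𝟙 1.
Proof.
exists (fwd (run X)); split; first by exists (run X).
rewrite scale1r hat.unlock kcompA run_natural -run_tens -kcompA.
by rewrite -[X in _ = _ ∘ X]kcompA fwdK kcompm1.
Qed.

Lemma twist_tens T Y c c' : twist T c -> twist Y c' -> twist (T ⊗ Y) (c * c').
Proof.
move=> [r [ri re]] [r' [ri' re']]; exists (r' ∘ hat r Y); split.
  by apply: is_iso_comp => //; apply: is_iso_hat.
rewrite lwM kcompA re' compZl -kcompA (hat_relation Y re).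
by rewrite compZr scalerA mulrC kcompA.
Qed.

End Commutation.

Section Core.
Variables (k : closedFieldType) (C : moncat k) (bc : braiding C).
Hypothesis C_fus : is_fusion C.
Implicit Types (X Y Z W U V T : C).

Let C_ss : semisimple_cat C. Proof. by case: C_fus. Qed.
Let C_fin X Y : exists n, has_dim (hom X Y) n. Proof. by case: C_fus. Qed.
Let one_simple : simple (𝟙 : C). Proof. by case: C_fus. Qed.

Lemma iso_neq0 X Y (f : hom X Y) : ~ is_zero X -> is_iso f -> f != 0.
Proof.
move=> nz [i e]; apply/eqP => f0; apply: nz.
by rewrite /is_zero -(bwdK i) e f0 compm0.
Qed.

Lemma is_zero_tens0 X Y : is_zero Y -> is_zero (X ⊗ Y).
Proof. by move=> z; rewrite /is_zero -lw1 z lw0. Qed.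
Lemma is_zero_0tens X Y : is_zero X -> is_zero (X ⊗ Y).
Proof. by move=> z; rewrite /is_zero -rw1 z rw0. Qed.

(* [X^∨ ⊗ -] is right adjoint to [X ⊗ -]; its unit is split mono when
   [X] is nonzero. *)
Lemma lw_faithful X U V (g : hom U V) : ~ is_zero X -> X ◁ g = 0 -> g = 0.
Proof.
move=> nzX Xg0; have [_ R _ _ _] := C_fus.
have [_ [Y [ev [coev [s1 s2]]]]] := R X.
have coev0 : coev != 0.
  apply/eqP => c0; apply: nzX.
  have := s2; rewrite c0 lw0 compm0 => r0.
  by rewrite /is_zero -(fwdK (run X)) -r0 comp0m.
have [r rc] := from_simple_split C_ss one_simple coev0.
have inv Z : fwd (lun Z) ∘ (r ▷ Z) ∘ bwd (asc Y X Z) ∘ coevh coev Z = \id_Z.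
  rewrite coevh.unlock !kcompA bwdKr -[_ ∘ (r ▷ Z) ∘ _]kcompA -rwM rc rw1.
  by rewrite kcompm1 fwdK.
rewrite -[g]kcomp1m -(inv V) -kcompA coevh_nat Xg0 lw0 comp0m compm0.
by [].
Qed.

Section Generation.
Variables (X Y : C) (ev : hom (X ⊗ Y) 𝟙) (coev : hom 𝟙 (Y ⊗ X)).
Hypothesis snake1 : fwd (run Y) ∘ (Y ◁ ev) ∘ fwd (asc Y X Y) ∘ (coev ▷ Y) =
  fwd (lun Y).
Hypothesis snake2 : fwd (lun X) ∘ (ev ▷ X) ∘ bwd (asc X Y X) ∘ (X ◁ coev) =
  fwd (run X).
Variables (I : finType) (t : I -> C).
Variables (i : forall a, hom (t a) (Y ⊗ X)) (p : forall a, hom (Y ⊗ X) (t a)).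
Hypothesis ip : \sum_a (i a ∘ p a) = \id_(Y ⊗ X).

(** Under the adjunction [g] becomes a morphism from [U] to [(Y ⊗ X) ⊗ V]; splitting [Y ⊗ X] into
    the [t a] and going back gives the sum. *)
Lemma hom_generation U V (g : hom (X ⊗ U) (X ⊗ V)) :
  exists psi : forall a, hom U (t a ⊗ V),
    g = \sum_a hat (evh ev X ∘ (X ◁ i a)) V ∘ (X ◁ psi a).
Proof.
pose h := bwd (asc Y X V) ∘ ((Y ◁ g) ∘ coevh coev U).
exists (fun a => (p a ▷ V) ∘ h).
rewrite -[LHS](adjK snake2) -[_ ∘ coevh _ _]kcomp1m.
rewrite -(fwdK (asc Y X V)) -kcompA -/h.
rewrite -[h in LHS]kcomp1m -rw1 -ip rw_sum comp_suml comp_sumr lw_sum comp_sumr.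
apply: eq_bigr => a _; rewrite evh_hat.
by rewrite rwM !lwM !kcompA.
Qed.
End Generation.

Section Commute.
Variables (S X : C) (f : hom (S ⊗ X) X).
Hypotheses (sX : simple X) (fi : is_iso f).

(** Both composites are isomorphisms from [S ⊗ (X ⊗ T)] to the simple object [X], hence
    proportional. *)
Lemma twist_exists T (r : hom (X ⊗ T) X) :
  is_iso r -> exists c, f ∘ (S ◁ r) = c *: (r ∘ hat f T).
Proof.
move=> ri; have sSXT : simple (S ⊗ (X ⊗ T)).
  apply: simple_isomorphic (sX); apply: isomorphic_sym.
  by apply: is_iso_isomorphic (is_iso_comp (is_iso_lw S ri) fi).
have i1 : is_iso (r ∘ hat f T).
  by apply: is_iso_comp => //; apply: is_iso_hat.
have [c e] := simple_hom_scalar C_ss C_fin (f ∘ (S ◁ r)) sSXT sX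
  (iso_neq0 (proj1 sSXT) i1).
by exists c.
Qed.

(** Either [g = 0] or the two scalars agree: [r' ∘ (X ◁ g)] is a multiple of [r]. If the multiple is
    zero then so is [g], as [X ⊗ -] is faithful; otherwise the commutation relation for [r']
    restricts to the one for [r]. *)
Lemma twist_comm Y Y' c c' (g : hom Y Y') :
  twist f Y c -> twist f Y' c' -> c' *: g = c *: g.
Proof.
move=> [r [ri re]] [r' [ri' re']].
have sXY : simple (X ⊗ Y).
  by apply: simple_isomorphic (sX); apply/isomorphic_sym/is_iso_isomorphic/ri.
have [a e] := simple_hom_scalar C_ss C_fin (r' ∘ (X ◁ g)) sXY sX
  (iso_neq0 (proj1 sXY) ri).
case: (eqVneq a 0) => [a0|a0].
  suff -> : g = 0 by rewrite !scaler0.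
  apply: (lw_faithful (proj1 sX)); case: ri' => j jr.
  by apply: (fwd_inj (i := j)); rewrite jr e a0 scale0r compm0.
have E : f ∘ (S ◁ (r' ∘ (X ◁ g))) = c' *: (r' ∘ (X ◁ g) ∘ hat f Y).
  by rewrite lwM kcompA re' compZl -!kcompA -hat_nat.
move: E; rewrite e lwZ !compZl !compZr re !scalerA => E.
have nz : r ∘ hat f Y != 0.
  apply: iso_neq0; last by apply: is_iso_comp => //; apply: is_iso_hat.
  move=> z; case: (proj1 sX); apply: is_zero_isomorphic z.
  apply: is_iso_isomorphic (is_iso_comp (is_iso_hat Y fi) ri).
have /eqP := E; rewrite -subr_eq0 -scalerBl scaler_eq0 (negPf nz) orbF subr_eq0.
by move=> /eqP e1; rewrite (mulfI a0 (etrans e1 (mulrC _ _))).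
Qed.

Section Step.
Variables (I : finType) (t : I -> C) (r : forall a, hom (X ⊗ t a) X).
Hypothesis ri : forall a, is_iso (r a).
Hypothesis gen : forall U V (g : hom (X ⊗ U) (X ⊗ V)),
  exists psi : forall a, hom U (t a ⊗ V),
    g = \sum_a hat (r a) V ∘ (X ◁ psi a).

(* Every morphism between words [X⋯XY] and [X⋯XY'] is a sum of right actions on
   the first letter preceded by morphisms that do not touch it. *)
Lemma pact_comm n Y Y' c c' (g : hom (itens X n Y) (itens X n Y')) :
  twist f Y c -> twist f Y' c' ->
  c' *: (pact bc f n Y' ∘ imap S n g) = c *: (g ∘ pact bc f n Y).
Proof.
elim: n Y Y' c c' g => [|n IH] Y Y' c c' g R R' /=.
  by rewrite kcomp1m kcompm1; apply: twist_comm.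
have [psi ->] := gen g.
rewrite imap_sum lw_sum comp_sumr comp_suml !scaler_sumr.
apply: eq_bigr => a _; have [ca ea] := twist_exists (ri a).
have Ra : twist f (t a) ca by exists (r a).
(* Moving the new letter [t a] back behind the word [X^n] makes it part of the tail, so the
   induction hypothesis applies with tail [t a ⊗ Y'] and scalar [ca * c']. *)
have [ga [ga1 ga2]] : exists ga, bmv bc X (t a) n Y' ∘ ga = psi a /\ True.
  have [j ej] := is_iso_bmv bc X (t a) n Y'.
  by exists (bwd j ∘ psi a); rewrite -ej kcompA fwdK kcomp1m.
have E := IH _ _ _ _ ga R (twist_tens Ra R').
set P := pact bc f n Y'; set P' := pact bc f n Y.
rewrite imapM lwM !kcompA.
have e1 : (S ◁ bmv bc S X n (itens X n Y')) ∘
    (S ◁ imap S n (hat (r a) (itens X n Y'))) =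
  (S ◁ hat (r a) (itens S n (itens X n Y'))) ∘
  (S ◁ (X ◁ bmv bc S (t a) n (itens X n Y'))) ∘
  (S ◁ bmv bc S X n (t a ⊗ itens X n Y')).
  by rewrite -!lwM bmv_hat.
rewrite (comp2 _ e1) !kcompA.
have e2 : (S ◁ (X ◁ P)) ∘ (S ◁ hat (r a) (itens S n (itens X n Y'))) =
  (S ◁ hat (r a) (itens X n Y')) ∘ (S ◁ (X ◁ (t a ◁ P))).
  by rewrite -!lwM hat_nat.
rewrite (comp2 _ e2) !kcompA (hat_relation _ ea) !compZl scalerA.
have e3 : (S ◁ bmv bc S X n (t a ⊗ itens X n Y')) ∘ (S ◁ imap S n (X ◁ psi a))
  = (S ◁ (X ◁ imap S n (psi a))) ∘ (S ◁ bmv bc S X n (itens X n Y)).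
  by rewrite -!lwM bmv_nat.
rewrite (comp2 _ e3) !kcompA.
have e4 : (t a ◁ P) ∘ bmv bc S (t a) n (itens X n Y') ∘ imap S n (psi a) =
   bmv bc X (t a) n Y' ∘ (pact bc f n (t a ⊗ Y') ∘ imap S n ga).
  by rewrite -ga1 imapM /P !kcompA pact_bmv.
have e5 : (S ◁ (X ◁ (t a ◁ P))) ∘ (S ◁ (X ◁ bmv bc S (t a) n (itens X n Y')))
   ∘ (S ◁ (X ◁ imap S n (psi a))) =
   (S ◁ (X ◁ (bmv bc X (t a) n Y' ∘ (pact bc f n (t a ⊗ Y') ∘ imap S n ga)))).
  by rewrite -!lwM e4.
rewrite (comp3 _ e5) mulrC.
set A := hat _ _ ∘ hat _ _; set B := bmv _ _ _ _ _; set G := _ ∘ imap _ _ ga.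
set D := S ◁ bmv _ _ _ _ _.
have e6 d K : d *: (A ∘ (S ◁ (X ◁ (B ∘ K))) ∘ D) =
    A ∘ (S ◁ (X ◁ (B ∘ (d *: K)))) ∘ D.
  by rewrite compZr !lwZ compZr compZl.
rewrite e6 -/G E -e6 kcompA ga1; congr (_ *: _).
rewrite !lwM !kcompA /A; congr (_ ∘ _).
rewrite -[_ ∘ hat f _ ∘ _]kcompA hat_nat !kcompA.
by [].
Qed.

(* A summand of [X^n] absorbs [S^n]: conjugating by [pact] fixes the
   corresponding idempotent of [X^n]. *)
Lemma summand_absorbs n Z (j : hom Z (itens X n 𝟙)) (q : hom (itens X n 𝟙) Z) :
  q ∘ j = \id_Z -> isomorphic (itens S n Z) Z.
Proof.
move=> qj; have [u eu] := is_iso_pact bc n 𝟙 fi.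
(* Source and target have tail [𝟙] with scalar 1, so the idempotent [j ∘ q] commutes with the action
   exactly. *)
have := pact_comm (j ∘ q) (twist_one f) (twist_one f); rewrite !scale1r -eu => E.
exists; apply: (@Iso _ _ _ _ (q ∘ fwd u ∘ imap S n j)
  (imap S n q ∘ bwd u ∘ j)).
  have -> : imap S n q ∘ bwd u ∘ j ∘ (q ∘ fwd u ∘ imap S n j) =
    imap S n q ∘ bwd u ∘ (j ∘ q ∘ fwd u) ∘ imap S n j by rewrite !kcompA.
  rewrite -E !kcompA bwdKr -!imapM.
  by rewrite kcompA qj kcomp1m qj imap1.
have -> : q ∘ fwd u ∘ imap S n j ∘ (imap S n q ∘ bwd u ∘ j) =
   q ∘ (fwd u ∘ imap S n (j ∘ q)) ∘ bwd u ∘ j by rewrite imapM !kcompA.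
by rewrite E !kcompA qj kcomp1m fwdKr qj.
Qed.

End Step.

End Commute.

(** The hypothesis on [X ⊗ T] is what makes the generators of [hom_generation] isomorphisms
    [X ⊗ T ≅ X], so that commutation up to a scalar makes sense for them. *)
Theorem constituent_absorbs S X n Z :
  simple X -> isomorphic (S ⊗ X) X ->
  (forall Y T, left_dual Y X -> simple T -> occurs T (Y ⊗ X) ->
     simple (X ⊗ T)) ->
  simple Z -> occurs Z (itens X n 𝟙) -> isomorphic (itens S n Z) Z.
Proof.
move=> sX [f] sXT sZ [j j0].
have [q qj] := from_simple_split C_ss sZ j0.
have [_ R _ _ _] := C_fus; have [_ [Y XY]] := R X.
have [ev [coev [s1 s2]]] := XY.
have [m [t [st [i [p [pi1 _ ip]]]]]] := ss_decomp C_ss (Y ⊗ X).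
have i0 a : i a != 0.
  by apply: contraNneq (simple_id_neq0 (st a)) => e; rewrite -pi1 e compm0.
(* The adjunction sends this morphism to [i a], which is nonzero; both ends are simple. *)
have ri a : is_iso (evh ev X ∘ (X ◁ i a)).
  apply: (schur C_ss) => //; first by apply: (sXT _ _ XY) => //; exists (i a).
  apply: contraNneq (i0 a) => e.
  by rewrite -(adjK' s1 (i a)) e lw0 comp0m.
apply: (summand_absorbs sX _ ri _ qj); first by exists f.
by move=> U V g; have [psi E] := hom_generation s2 ip g; exists psi.
Qed.

End Core.

(** * Dimensions of spaces of morphisms *)

Section Dim.
Variable k : fieldType.
Implicit Types V W : lmodType k.

Lemma mul_lin1_mx n m (g : 'rV[k]_n -> 'rV[k]_m) (u : 'rV[k]_n) :
  linear g -> u *m lin1_mx g = g u.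
Proof.
move=> gl; pose g' : {linear 'rV_n -> 'rV_m} :=
  HB.pack g (GRing.isLinear.Build _ _ _ _ g gl).
exact: (mul_rV_lin1 g' u).
Qed.

Lemma has_dim_le V n m : has_dim V n -> has_dim V m -> (n <= m)%N.
Proof.
move=> [[v vl [v' vK v'K]]] [[w wl [w' wK w'K]]].
have v'l : linear v' by move=> a x y; apply: (can_inj vK); rewrite v'K vl !v'K.
have w'l : linear w' by move=> a x y; apply: (can_inj wK); rewrite w'K wl !w'K.
pose M := lin1_mx (fun x => w (v' x)); pose N := lin1_mx (fun x => v (w' x)).
have MN : M *m N = 1%:M.
  apply/row_matrixP => i; rewrite row_mul [row i M]rowE.
  rewrite mul_lin1_mx; last by move=> a x y /=; rewrite w'l vl.
  rewrite mul_lin1_mx; last by move=> a x y /=; rewrite v'l wl.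
  by rewrite wK v'K row1.
rewrite -[n](mxrank1 k) -MN.
exact: leq_trans (mxrankM_maxl _ _) (rank_leq_col _).
Qed.

Lemma has_dim_inj V n m : has_dim V n -> has_dim V m -> n = m.
Proof. by move=> h h'; apply/eqP; rewrite eqn_leq !(@has_dim_le V). Qed.

Lemma ldimE V n : has_dim V n -> ldim V = n.
Proof. by move=> h; rewrite /ldim; case: xgetP => [m _ /has_dim_inj/(_ h)|/(_ n)]. Qed.

Lemma has_dim_bij V W (f : V -> W) (g : W -> V) n :
  linear f -> cancel f g -> cancel g f -> has_dim V n -> has_dim W n.
Proof.
move=> fl fK gK [[v vl [v' vK v'K]]].
have gl : linear g by move=> a x y; apply: (can_inj fK); rewrite gK fl !gK.
constructor; exists (v \o g) => /=; first by move=> a x y; rewrite /= gl vl.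
by exists (f \o v') => x /=; rewrite ?vK ?fK ?v'K ?gK // ?fK.
Qed.

Lemma ldim_bij V W (f : V -> W) (g : W -> V) :
  linear f -> cancel f g -> cancel g f -> ldim V = ldim W.
Proof.
move=> fl fK gK.
have gl : linear g by move=> a x y; apply: (can_inj fK); rewrite gK fl !gK.
rewrite /ldim; congr (xget _ _); apply/seteqP; split=> n /=.
  exact: has_dim_bij fl fK gK.
exact: has_dim_bij gl gK fK.
Qed.

Lemma has_dim_sum V m (W : 'I_m -> lmodType k) (d : 'I_m -> nat)
    (i : forall a, W a -> V) (p : forall a, V -> W a) :
    (forall a, linear (i a)) -> (forall a, linear (p a)) ->
    (forall a, cancel (i a) (p a)) ->
    (forall a b x, a != b -> p b (i a x) = 0) ->
    (forall v, \sum_a i a (p a v) = v) ->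
    (forall a, has_dim (W a) (d a)) ->
  has_dim V (\sum_a d a).
Proof.
move=> il pl pi1 pi0 ip hd.
have hw a : exists w : Vector.axiom (d a) (W a), True.
  by case: (hd a) => w; exists w.
pose w a := sval (cid (hw a)); pose f a := let: exist2 v _ _ := w a in v.
have fl a : linear (f a) by rewrite /f; case: (w a).
have fb a : bijective (f a) by rewrite /f; case: (w a).
have hg a : exists g, cancel (f a) g /\ cancel g (f a).
  by case: (fb a) => g; exists g.
pose g a := sval (cid (hg a)).
have gP a : cancel (f a) (g a) /\ cancel (g a) (f a) by exact: svalP (cid (hg a)).
constructor; exists (fun v => \mxrow_a f a (p a v)).
  move=> a x y /=; apply/mxrowP => b; rewrite submxrowD !mxrowK.
  have -> (z : 'rV[k]_(\sum_a0 d a0)) : submxrow (a *: z) b = a *: submxrow z b.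
    by apply/matrixP => u c; rewrite !mxE.
  by rewrite mxrowK pl fl.
exists (fun x => \sum_a i a (g a (submxrow x a))) => x.
  rewrite -[RHS]ip; apply: eq_bigr => a _.
  by rewrite mxrowK (proj1 (gP a)).
apply/mxrowP => b; rewrite !mxrowK.
rewrite (lin_sum (pl b)) (bigD1 b) //= pi1 big1 ?addr0 ?(proj2 (gP b)) //.
by move=> a ab; rewrite pi0.
Qed.

Lemma has_dim0 V : (forall v : V, v = 0) -> has_dim V 0.
Proof.
move=> h; constructor; exists (fun=> 0); first by move=> a x y; rewrite scaler0 addr0.
by exists (fun=> 0) => x; rewrite ?(h x) //; apply/rowP; case.
Qed.

Lemma has_dim1 V (v : V) :
  v != 0 -> (forall w : V, exists a, w = a *: v) -> has_dim V 1.
Proof.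
move=> v0 h; have [f fE] := choice h.
have vI : injective (fun a => a *: v).
  move=> a b /eqP; rewrite -subr_eq0 -scalerBl scaler_eq0 (negPf v0) orbF.
  by rewrite subr_eq0 => /eqP.
constructor; exists (fun w => (f w)%:M).
  move=> a x y; rewrite -scalemx1 -[(f x)%:M]scalemx1 -[(f y)%:M]scalemx1.
  rewrite scalerA -scalerDl; congr (_ *: _); apply: vI => /=.
  by rewrite scalerDl -scalerA -!fE.
exists (fun x : 'rV[k]_1 => x 0 0 *: v) => x.
  by rewrite mxE eqxx mulr1n -fE.
by rewrite [RHS]mx11_scalar; congr (_%:M); apply: vI; rewrite -fE.
Qed.

Lemma has_dim_eq0 V : has_dim V 0 -> forall v : V, v = 0.
Proof.
move=> [[f fl fb]] v; apply: (bij_inj fb); rewrite (lin0 fl).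
by apply/rowP; case.
Qed.

End Dim.

Section HomDim.
Variables (k : closedFieldType) (C : kcat k).
Hypothesis C_ss : semisimple_cat C.
Hypothesis C_fin : forall X Y : C, exists n, has_dim (hom X Y) n.
Implicit Types (X Y Z W : C).

Lemma has_ldim X Y : has_dim (hom X Y) (ldim (hom X Y)).
Proof. by have [n h] := C_fin X Y; rewrite (ldimE h). Qed.

Lemma ldim_dsumr m (s : 'I_m -> C) X Z : is_dsum s X ->
  ldim (hom Z X) = (\sum_a ldim (hom Z (s a)))%N.
Proof.
move=> [i [p [pi1 pi0 ip]]]; apply: ldimE.
apply: (@has_dim_sum _ _ _ _ _ (fun a f => i a ∘ f) (fun a f => p a ∘ f)).
- by move=> a; apply: kcomp_linearr.
- by move=> a; apply: kcomp_linearr.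
- by move=> a f; rewrite kcompA pi1 kcomp1m.
- by move=> a b f ab; rewrite kcompA pi0 // comp0m.
- move=> f; rewrite -[RHS]kcomp1m -ip comp_suml; apply: eq_bigr => a _.
  by rewrite kcompA.
- by move=> a; apply: has_ldim.
Qed.

Lemma ldim_dsuml m (s : 'I_m -> C) X Z : is_dsum s X ->
  ldim (hom X Z) = (\sum_a ldim (hom (s a) Z))%N.
Proof.
move=> [i [p [pi1 pi0 ip]]]; apply: ldimE.
apply: (@has_dim_sum _ _ _ _ _ (fun a f => f ∘ p a) (fun a f => f ∘ i a)).
- by move=> a; apply: kcomp_linearl.
- by move=> a; apply: kcomp_linearl.
- by move=> a f; rewrite -kcompA pi1 kcompm1.
- by move=> a b f ab; rewrite -kcompA pi0 1?eq_sym // compm0.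
- move=> f; rewrite -[RHS]kcompm1 -ip comp_sumr; apply: eq_bigr => a _.
  by rewrite kcompA.
- by move=> a; apply: has_ldim.
Qed.

Lemma ldim_simple X Y : simple X -> simple Y ->
  ldim (hom X Y) = `[< isomorphic X Y >].
Proof.
move=> sX sY; apply: ldimE; case: asboolP => [[i]|ni].
  have i0 : fwd i != 0.
    rewrite -[fwd i]kcompm1 comp_iso_neq0 ?simple_id_neq0 //; by exists i.
  apply: (has_dim1 i0) => g.
  exact: (simple_hom_scalar C_ss C_fin g sX sY i0).
apply: has_dim0 => f; apply/eqP/negP => /negP f0; apply: ni.
exact: is_iso_isomorphic (schur C_ss sX sY f0).
Qed.

Lemma ldim_gt0 X Y : (0 < ldim (hom X Y))%N <-> occurs X Y.
Proof.
rewrite lt0n; split=> [/eqP h|[f f0]].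
  apply: contrapT => no; apply: h; apply: ldimE; apply: has_dim0 => f.
  by apply/eqP/negP => /negP f0; apply: no; exists f.
apply/eqP => d0; have := has_ldim X Y; rewrite d0 => /has_dim_eq0/(_ f).
by move/eqP: f0.
Qed.

Lemma ldim_iso X X' Y Y' : isomorphic X X' -> isomorphic Y Y' ->
  ldim (hom X Y) = ldim (hom X' Y').
Proof.
move=> [i] [j].
apply: (@ldim_bij _ _ _ (fun f => fwd j ∘ f ∘ bwd i) (fun f => bwd j ∘ f ∘ fwd i)).
- by move=> a f g; rewrite kcomp_linearr kcomp_linearl.
- by move=> f; rewrite !kcompA bwdK kcomp1m -kcompA bwdK kcompm1.
- by move=> f; rewrite !kcompA fwdK kcomp1m -kcompA fwdK kcompm1.
Qed.

Lemma occurs_dsum m (s : 'I_m -> C) X Z : is_dsum s X ->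
  occurs Z X -> exists a, occurs Z (s a).
Proof.
move=> [i [p [pi1 pi0 ip]]] [f f0]; apply: contrapT => no.
case/eqP: f0; rewrite -[f]kcomp1m -ip comp_suml big1 // => a _; rewrite -kcompA.
case: (eqVneq (p a ∘ f) 0) => [->|nz]; first exact: compm0.
by case: no; exists a, (p a ∘ f).
Qed.

Lemma dsum_occurs m (s : 'I_m -> C) X a : is_dsum s X -> simple (s a) ->
  occurs (s a) X.
Proof.
move=> [i [p [pi1 pi0 ip]]] sa; exists (i a).
by apply: contraNneq (simple_id_neq0 sa) => e; rewrite -pi1 e compm0.
Qed.

Section Reps.
Variables (n : nat) (r : 'I_n -> C).
Hypothesis r_reps : simple_reps r.

Lemma reps_simple i : simple (r i).
Proof. by case: r_reps. Qed.
Lemma reps_inj i j : isomorphic (r i) (r j) -> i = j.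
Proof. by case: r_reps => _ h _; apply: h. Qed.
Lemma reps_ex X : simple X -> exists i, isomorphic X (r i).
Proof. by case: r_reps => _ _ h; apply: h. Qed.

(** This is the inner product on the Grothendieck ring for which the simple objects are orthonormal.
    It gives the symmetry of [ldim] and, later, the Gram matrix of a fusion matrix. *)
Lemma ldim_mult X Y :
  ldim (hom X Y) = (\sum_i ldim (hom (r i) X) * ldim (hom (r i) Y))%N.
Proof.
have [m [s [ss dX]]] := ss_decomp C_ss X.
rewrite (ldim_dsuml Y dX).
under [RHS]eq_bigr => i _ do rewrite (ldim_dsumr (r i) dX) big_distrl /=.
rewrite exchange_big /=; apply: eq_bigr => a _.
have [i0 ai] := reps_ex (ss a).
rewrite (bigD1 i0) //= big1 ?addn0 => [|i ii].
  rewrite [in RHS](ldim_simple (reps_simple i0) (ss a)).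
  have ia := isomorphic_sym ai; rewrite asboolT // mul1n.
  exact: ldim_iso ai (isomorphic_refl _).
rewrite (ldim_simple (reps_simple i) (ss a)).
rewrite asboolF ?mul0n // => ia; case/eqP: ii; apply: reps_inj.
exact: isomorphic_trans ia ai.
Qed.

End Reps.
End HomDim.

(** * Fusion rules *)

(** With these instances isomorphisms can be used for rewriting, so fusion rules are manipulated
    like identities in a commutative ring. *)
#[export] Instance isomorphic_equiv (k : fieldType) (C : kcat k) :
  Equivalence (@isomorphic k C).
Proof.
split=> [X|X Y|X Y Z]; first exact: isomorphic_refl.
  exact: isomorphic_sym.
exact: isomorphic_trans.
Qed.

#[export] Instance tens_proper (k : fieldType) (C : moncat k) :
  Proper (@isomorphic k C ==> @isomorphic k C ==> @isomorphic k C)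
    (bobj (@tens k C)).
Proof. by move=> X X' XX' Y Y' YY'; apply: tens_isomorphic. Qed.

#[export] Instance occurs_proper (k : fieldType) (C : kcat k) :
  Proper (@isomorphic k C ==> @isomorphic k C ==> iff) (@occurs k C).
Proof.
by move=> X X' XX' Y Y' YY'; split; apply: occurs_isomorphic => //;
  apply: isomorphic_sym.
Qed.

#[export] Instance simple_proper (k : fieldType) (C : kcat k) :
  Proper (@isomorphic k C ==> iff) (@simple k C).
Proof.
by move=> X X' XX'; split; apply: simple_isomorphic => //; apply: isomorphic_sym.
Qed.

#[export] Instance itens_proper (k : fieldType) (C : moncat k) :
  Proper (@isomorphic k C ==> eq ==> @isomorphic k C ==> @isomorphic k C)
    (@itens k C).
Proof.
move=> X X' XX' n _ <- Y Y' YY'; elim: n => //= n IH.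
exact: tens_isomorphic.
Qed.

#[export] Instance invertible_proper (k : fieldType) (C : moncat k) :
  Proper (@isomorphic k C ==> iff) (@invertible k C).
Proof.
move=> X X' XX'; split=> -[Y]; exists Y; first by rewrite -XX'.
by rewrite XX'.
Qed.

#[local] Hint Resolve isomorphic_refl : core.

Section Words.
Variables (k : fieldType) (C : moncat k) (bc : braiding C).
Implicit Types (X Y Z W U V T a b c : C).

Lemma tensA X Y Z : (X ⊗ Y) ⊗ Z ≅ X ⊗ (Y ⊗ Z).
Proof. exact: inhabits (asc X Y Z). Qed.
Lemma tens1X X : 𝟙 ⊗ X ≅ X.
Proof. exact: inhabits (lun X). Qed.
Lemma tensX1 X : X ⊗ 𝟙 ≅ X.
Proof. exact: inhabits (run X). Qed.
Lemma tensC X Y : X ⊗ Y ≅ Y ⊗ X.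
Proof. exact: inhabits (braid bc X Y). Qed.
Lemma tensCA X Y Z : X ⊗ (Y ⊗ Z) ≅ Y ⊗ (X ⊗ Z).
Proof. by rewrite -tensA (tensC X Y) tensA. Qed.
Lemma tensACA X Y Z W : (X ⊗ Y) ⊗ (Z ⊗ W) ≅ (X ⊗ Z) ⊗ (Y ⊗ W).
Proof. by rewrite !tensA (tensCA Y Z). Qed.

Lemma itensE X n Z : itens X n Z ≅ itens X n 𝟙 ⊗ Z.
Proof. by elim: n => [|n IH] /=; rewrite ?tens1X // tensA -IH. Qed.
Lemma itens1 n : itens (𝟙 : C) n 𝟙 ≅ 𝟙.
Proof. by elim: n => //= n IH; rewrite tens1X. Qed.
Lemma itensD X m n Z : itens X (m + n) Z = itens X m (itens X n Z).
Proof. by elim: m => //= m ->. Qed.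
Lemma itensM X m n : itens X (m * n) 𝟙 ≅ itens (itens X m 𝟙) n 𝟙.
Proof.
elim: n => [|n IH]; first by rewrite muln0.
by rewrite mulnS itensD itensE IH.
Qed.
Lemma itens_tens X Y n : itens (X ⊗ Y) n 𝟙 ≅ itens X n 𝟙 ⊗ itens Y n 𝟙.
Proof.
elim: n => [|n IH] /=; first by rewrite tens1X.
by rewrite IH tensACA.
Qed.

Lemma invertible1 : invertible (𝟙 : C).
Proof. by exists 𝟙; rewrite tens1X. Qed.
Lemma invertible_tens a b : invertible a -> invertible b -> invertible (a ⊗ b).
Proof.
move=> [a' [aa' a'a]] [b' [bb' b'b]]; exists (b' ⊗ a'); split.
  by rewrite tensA -(tensA b) bb' tens1X.
by rewrite tensA -(tensA a') a'a tens1X.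
Qed.
Lemma invertible_itens a n : invertible a -> invertible (itens a n 𝟙).
Proof.
move=> ia; elim: n => [|n IH] /=; first exact: invertible1.
exact: invertible_tens.
Qed.
Lemma invertible_inv a :
  invertible a -> exists b, [/\ invertible b, a ⊗ b ≅ 𝟙 & b ⊗ a ≅ 𝟙].
Proof. by move=> [b [ab ba]]; exists b; split=> //; exists a. Qed.

Lemma inv_cancel a X Y : invertible a -> a ⊗ X ≅ a ⊗ Y -> X ≅ Y.
Proof.
move=> [b [ab ba]] e.
by rewrite -(tens1X X) -(tens1X Y) -ba !tensA e.
Qed.
Lemma inv_cancelr a X : invertible X -> a ⊗ X ≅ X -> a ≅ 𝟙.
Proof.
move=> [Y [XY YX]] e; rewrite -(tensX1 a) -XY -tensA e; by [].
Qed.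

End Words.

Section Fusion.
Variables (k : closedFieldType) (C : fusionCat k) (bc : braiding C).
Implicit Types (X Y Z W U V T a b c : C).

Lemma fus_ss : semisimple_cat C. Proof. by case: (fusionP C). Qed.
Lemma fus_fin X Y : exists n, has_dim (hom X Y) n.
Proof. by case: (fusionP C). Qed.
Lemma fus_one : simple (𝟙 : C). Proof. by case: (fusionP C). Qed.
Lemma fus_dual X : exists Y, left_dual Y X.
Proof. by case: (fusionP C) => _ R _ _ _; have [] := R X. Qed.

Lemma adj_ldim X Y U V : left_dual Y X ->
  ldim (hom (X ⊗ U) V) = ldim (hom U (Y ⊗ V)).
Proof.
move=> [ev [coev [s1 s2]]].
apply: (@ldim_bij _ _ _ (fun f => (Y ◁ f) ∘ coevh coev U)
  (fun g => evh ev V ∘ (X ◁ g))).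
- by move=> a f g; rewrite bmor_linearr kcomp_linearl.
- by move=> f; apply: adjK.
- by move=> g; apply: adjK'.
Qed.

(** Frobenius reciprocity; semisimplicity turns a morphism onto the simple object [V] into one out
    of it. *)
Lemma adj_occurs X Y U V : left_dual Y X -> simple V ->
  occurs U (Y ⊗ V) <-> occurs V (X ⊗ U).
Proof.
move=> XY sV; rewrite -(ldim_gt0 fus_fin) -(adj_ldim _ _ XY).
rewrite (occurs_to fus_ss) //; exact: ldim_gt0 fus_fin _ _.
Qed.

Lemma inv_nonzero a : invertible a -> ~ is_zero a.
Proof.
move=> [b [ab _]] za; apply: (proj1 fus_one).
exact: is_zero_isomorphic ab (is_zero_0tens b za).
Qed.

(** If [b] is inverse to [a], an endomorphism of [a ⊗ X] becomes scalar after tensoring with [b], by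
    Schur's lemma for [b ⊗ (a ⊗ X) ≅ X], and [b ⊗ -] is faithful. *)
Lemma inv_simple a X : invertible a -> simple X -> simple (a ⊗ X).
Proof.
move=> ia sX; have [b [ab ba]] := ia.
have e : b ⊗ (a ⊗ X) ≅ X by rewrite -tensA ba tens1X.
have sbX : simple (b ⊗ (a ⊗ X)) by rewrite e.
apply: (scalar_end_simple fus_ss) => [z|f].
  by case: (proj1 sbX); apply: is_zero_tens0.
have [c fc] := schur_scalar fus_ss fus_fin (b ◁ f) sbX; exists c.
have nb : ~ is_zero b by apply: inv_nonzero; exists a.
apply/eqP; rewrite -subr_eq0; apply/eqP.
apply: (lw_faithful (fusionP C) nb).
by rewrite (linB (bmor_linearr tens \id_b)) fc lwZ lw1 subrr.
Qed.

Lemma invertible_simple a : invertible a -> simple a.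
Proof. by move=> ia; rewrite -(tensX1 a); apply: inv_simple => //; exact: fus_one. Qed.

Lemma nonzero_tens X Y : ~ is_zero X -> ~ is_zero Y -> ~ is_zero (X ⊗ Y).
Proof.
move=> nX nY z; apply: nY; apply: (lw_faithful (fusionP C) nX).
by rewrite lw1.
Qed.
Lemma nonzero_itens X n : ~ is_zero X -> ~ is_zero (itens X n 𝟙).
Proof.
move=> nX; elim: n => [|n IH] /=; first exact: (proj1 fus_one).
exact: nonzero_tens.
Qed.

Lemma dsum_tens (I : finType) (s : I -> C) X Y : is_dsum s Y ->
  is_dsum (fun j : I => X ⊗ s j) (X ⊗ Y).
Proof.
move=> [i [p [pi1 pi0 ip]]].
exists (fun j => X ◁ i j), (fun j => X ◁ p j); split.
- by move=> a; rewrite -lwM pi1 lw1.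
- by move=> a b ab; rewrite -lwM pi0 // lw0.
by under eq_bigr => a _ do rewrite -lwM; rewrite -lw_sum ip lw1.
Qed.

Lemma dsum_tensr (I : finType) (s : I -> C) X Y : is_dsum s Y ->
  is_dsum (fun j : I => s j ⊗ X) (Y ⊗ X).
Proof.
move=> [i [p [pi1 pi0 ip]]].
exists (fun j => i j ▷ X), (fun j => p j ▷ X); split.
- by move=> a; rewrite -rwM pi1 rw1.
- by move=> a b ab; rewrite -rwM pi0 // rw0.
by under eq_bigr => a _ do rewrite -rwM; rewrite -rw_sum ip rw1.
Qed.

Lemma occurs_tens X W Z : occurs Z (X ⊗ W) ->
  exists V, [/\ simple V, occurs V W & occurs Z (X ⊗ V)].
Proof.
have [m [s [ss dW]]] := ss_decomp fus_ss W.
move=> /(occurs_dsum (dsum_tens X dW)) [a oa]; exists (s a); split=> //.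
exact: dsum_occurs dW (ss a).
Qed.

Lemma tens_occurs X V W Z : simple V -> occurs V W -> occurs Z (X ⊗ V) ->
  occurs Z (X ⊗ W).
Proof.
move=> sV [i i0] [f f0]; have [p pi] := from_simple_split fus_ss sV i0.
exists ((X ◁ i) ∘ f); apply: contraNneq f0 => e.
by rewrite -[f]kcomp1m -lw1 -pi lwM -kcompA e compm0.
Qed.

Lemma occurs_tens2 X W Z : occurs Z (X ⊗ W) ->
  exists U V, [/\ simple U, simple V, occurs U X, occurs V W & occurs Z (U ⊗ V)].
Proof.
move=> /occurs_tens [V [sV VW]]; rewrite (tensC bc) => /occurs_tens [U [sU UX]].
by rewrite (tensC bc) => o; exists U, V.
Qed.

Lemma one_occurs X Y : simple X -> left_dual Y X -> occurs 𝟙 (Y ⊗ X).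
Proof.
move=> sX XY; apply/(adj_occurs _ XY sX); rewrite tensX1.
exact: (occurs_simple sX (isomorphic_refl X)).
Qed.

(** By adjunction, the symmetry of multiplicities and the braiding, [hom Y Y] has the dimension of
    [hom (X ⊗ Y) 𝟙], of [hom 𝟙 (X ⊗ Y)], of [hom 𝟙 (Y ⊗ X)] and finally of [hom X X], which is 1. *)
Lemma dual_simple X Y : simple X -> left_dual Y X -> simple Y.
Proof.
move=> sX XY; apply: (scalar_end_simple fus_ss).
  move=> zY; have [f f0] := one_occurs sX XY.
  by case/eqP: f0; apply: is_zero_to; apply: is_zero_0tens.
have d1 : ldim (hom Y Y) = 1%N.
  rewrite -(ldim_iso (isomorphic_refl Y) (tensX1 Y)) -(adj_ldim _ _ XY).
  have [n [s [ss dM]]] := ss_decomp fus_ss (X ⊗ Y).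
  rewrite (ldim_dsuml fus_fin _ dM).
  under eq_bigr => a _.
    rewrite (ldim_simple fus_ss fus_fin (ss a) fus_one).
    have -> : `[< s a ≅ 𝟙 >] = `[< 𝟙 ≅ s a >].
      by apply/asboolP/asboolP => h; apply: isomorphic_sym.
    rewrite -(ldim_simple fus_ss fus_fin fus_one (ss a)); over.
  rewrite -(ldim_dsumr fus_fin _ dM).
  rewrite (ldim_iso (isomorphic_refl _) (tensC bc X Y)) -(adj_ldim _ _ XY).
  rewrite (ldim_iso (tensX1 X) (isomorphic_refl X)).
  by rewrite (ldim_simple fus_ss fus_fin sX sX) asboolT.
have [f0|nz] := eqVneq (\id_Y) 0.
  by move=> f; exists 0; rewrite -[f]kcompm1 f0 compm0 scaler0.
move=> f; have [[v vl vb]] : has_dim (hom Y Y) 1.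
  by rewrite -d1; apply: has_ldim fus_fin _ _.
have v0 : v \id_Y 0 0 != 0.
  apply: contraNneq nz => e; apply/eqP; apply: (bij_inj vb); rewrite (lin0 vl).
  by apply/rowP => i; rewrite ord1 e mxE.
exists (v f 0 0 / v \id_Y 0 0); apply: (bij_inj vb).
by apply/rowP => i; rewrite ord1 (linZ vl) mxE divfK.
Qed.

End Fusion.

(** * Degree maps with pointed trivial component *)

(** All that is kept of the extension: a grading of the simple objects, compatible with fusion,
    whose degree 0 part is invertible. The values on other objects carry no meaning. *)
Definition degree_map (k : fieldType) (q : nat) (C : fusionCat k)
    (d : C -> 'Z_q) : Prop :=
  (forall X Y Z : C, simple X -> simple Y -> simple Z ->
     occurs Z (X ⊗ Y) -> d Z = d X + d Y) /\
  (forall X : C, simple X -> d X = 0 -> invertible X).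

Section Degree.
Variables (k : closedFieldType) (C : fusionCat k) (bc : braiding C).
Variables (q : nat) (q_prime : prime q) (d : C -> 'Z_q).
Hypothesis d_deg : degree_map d.
Implicit Types (X Y Z W U V T S a b c : C).

Let ss := fus_ss C.
Let fin := @fus_fin k C.
Let one1 := fus_one C.

Lemma degM X Y Z : simple X -> simple Y -> simple Z -> occurs Z (X ⊗ Y) ->
  d Z = d X + d Y.
Proof. exact: (proj1 d_deg). Qed.
Lemma deg0_inv X : simple X -> d X = 0 -> invertible X.
Proof. exact: (proj2 d_deg). Qed.

Lemma deg1 : d 𝟙 = 0.
Proof.
apply: (addrI (d 𝟙)); rewrite addr0 -(@degM _ _ 𝟙) //.
by apply: occurs_simple => //; rewrite tens1X.
Qed.

Lemma deg_iso X Y : simple X -> X ≅ Y -> d X = d Y.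
Proof.
move=> sX e; have sY : simple Y by rewrite -e.
rewrite -[RHS]add0r -deg1; apply: degM => //.
by apply: (occurs_simple sX); rewrite tens1X.
Qed.

Lemma deg_tens X Y Z : simple X -> simple Y -> simple Z -> Z ≅ X ⊗ Y ->
  d Z = d X + d Y.
Proof. by move=> sX sY sZ e; apply: degM => //; apply: occurs_simple. Qed.

Lemma deg_one_occurs X Y : simple X -> simple Y -> occurs 𝟙 (X ⊗ Y) ->
  d Y = - d X.
Proof.
move=> sX sY o; apply/eqP.
by rewrite -addr_eq0 addrC -(degM sX sY one1 o) deg1.
Qed.

Lemma deg_dual X Y : simple X -> left_dual Y X -> d Y = - d X.
Proof.
move=> sX XY; apply: deg_one_occurs => //; first exact: (dual_simple bc sX XY).
by rewrite (tensC bc); apply: one_occurs.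
Qed.

Lemma deg_itens X n Z : simple X -> simple Z -> occurs Z (itens X n 𝟙) ->
  d Z = d X *+ n.
Proof.
move=> sX; elim: n Z => [|n IH] Z sZ /= o.
  rewrite mulr0n -deg1; apply: deg_iso => //. exact (simple_occurs ss sZ one1 o).
have [V [sV VX ZV]] := occurs_tens o.
by rewrite (degM sX sV sZ ZV) (IH V) // mulrS.
Qed.

Lemma stab_deg0 a X : simple a -> simple X -> a ⊗ X ≅ X -> d a = 0.
Proof.
move=> sa sX e; apply: (addIr (d X)); rewrite add0r; symmetry.
by apply: deg_tens => //; symmetry.
Qed.

(** A constituent [a] of [X^∨ ⊗ Z] has degree 0, hence is invertible, and by reciprocity [Z] occurs
    in the simple object [a ⊗ X]. *)
Lemma inv_trans X Z : simple X -> simple Z -> d X = d Z ->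
  exists a, [/\ simple a, invertible a, d a = 0 & a ⊗ X ≅ Z].
Proof.
move=> sX sZ e; have [Y XY] := fus_dual X.
have sY := dual_simple bc sX XY.
have [a [sa oa]] := exists_constituent ss
  (nonzero_tens (proj1 sY) (proj1 sZ)).
have da : d a = 0 by rewrite (degM sY sZ sa oa) (deg_dual sX XY) e addNr.
have ia := deg0_inv sa da.
exists a; split=> //; rewrite (tensC bc); symmetry.
move/(adj_occurs _ XY sZ): oa => o; apply: (simple_occurs ss) => //.
by rewrite (tensC bc); apply: inv_simple.
Qed.

(** A constituent [T] of [X^∨ ⊗ X] has degree 0, so [T ⊗ X] is simple, and [X] can occur in it only
    by being isomorphic to it. *)
Lemma dual_tens_occurs X Y T : simple X -> left_dual Y X -> simple T ->
  occurs T (Y ⊗ X) <-> T ⊗ X ≅ X.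
Proof.
move=> sX XY sT; rewrite (adj_occurs _ XY sX) (tensC bc X T); split=> [o|e].
  have sY := dual_simple bc sX XY.
  have o' : occurs T (Y ⊗ X).
    by apply/(adj_occurs _ XY sX); rewrite (tensC bc).
  have dT : d T = 0 by rewrite (degM sY sX sT o') (deg_dual sX XY) addNr.
  symmetry; apply: (simple_occurs ss) => //.
  exact: inv_simple (deg0_inv sT dT) sX.
by apply: occurs_simple => //; symmetry.
Qed.

Lemma stab_inv S X : simple S -> simple X -> S ⊗ X ≅ X -> invertible S.
Proof. by move=> sS sX e; apply: deg0_inv => //; apply: stab_deg0 e. Qed.

(** By reciprocity [V] occurs in [X^∨ ⊗ Z], so [Z'] occurs in [(X^∨ ⊗ X) ⊗ Z], that is, in [T ⊗ Z]
    for some [T] stabilising [X]. *)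
Lemma orbit_lemma X V Z Z' : simple X -> simple V -> simple Z -> simple Z' ->
  occurs Z (X ⊗ V) -> occurs Z' (X ⊗ V) ->
  exists T, [/\ simple T, invertible T, T ⊗ X ≅ X & T ⊗ Z ≅ Z'].
Proof.
move=> sX sV sZ sZ' oZ oZ'; have [Y XY] := fus_dual X.
move/(adj_occurs _ XY sZ): oZ => oV.
have : occurs Z' ((Y ⊗ X) ⊗ Z).
  rewrite (tensC bc Y X) tensA.
  exact: tens_occurs sV oV oZ'.
rewrite (tensC bc (Y ⊗ X)) => /occurs_tens [T [sT oT]].
move/(dual_tens_occurs sX XY sT): oT => e.
have iT := stab_inv sT sX e.
rewrite (tensC bc) => o; exists T; split=> //; symmetry.
by apply: (simple_occurs ss) => //; apply: inv_simple.
Qed.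

Lemma orbit_itens X n Z Z' : simple X -> simple Z -> simple Z' ->
  occurs Z (itens X n 𝟙) -> occurs Z' (itens X n 𝟙) ->
  exists T, [/\ simple T, invertible T, T ⊗ X ≅ X & T ⊗ Z ≅ Z'].
Proof.
move=> sX; elim: n Z Z' => [|n IH] Z Z' sZ sZ' /= o o'.
  exists 𝟙; split=> //; [exact: invertible1 | exact: tens1X |].
  rewrite tens1X (simple_occurs ss sZ _ o) //.
  by symmetry; apply: (simple_occurs ss _ _ o').
have [V [sV oV ZV]] := occurs_tens o; have [V' [sV' oV' ZV']] := occurs_tens o'.
have [S [sS iS eS eV]] := IH V V' sV sV' oV oV'.
apply: (orbit_lemma sX sV) => //.
(* [V'] differs from [V] by [S], which the new letter [X] absorbs, so [Z] and [Z'] occur in the same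
   object [X ⊗ V]. *)
by move: ZV'; rewrite -eV -tensA (tensC bc X) eS.
Qed.

Lemma absorb S X n Z : simple X -> S ⊗ X ≅ X -> simple Z ->
  occurs Z (itens X n 𝟙) -> itens S n Z ≅ Z.
Proof.
move=> sX e sZ o; apply: (constituent_absorbs bc (fusionP C) sX e _ sZ o).
move=> Y T XY sT /(dual_tens_occurs sX XY sT) eT.
by rewrite (tensC bc) eT.
Qed.

Lemma stab_exponent S X : simple S -> simple X -> S ⊗ X ≅ X ->
  itens S q 𝟙 ≅ 𝟙.
Proof.
move=> sS sX e.
have [Z [sZ oZ]] := exists_constituent ss (@nonzero_itens _ _ X q (proj1 sX)).
have dZ : d Z = 0.
  rewrite (deg_itens sX sZ oZ) -mulr_natr.
  by rewrite pchar_Zp ?mulr0 // prime_gt1.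
have := absorb sX e sZ oZ; rewrite itensE; apply: inv_cancelr.
exact: deg0_inv.
Qed.

Lemma deg_multiple (x y : 'Z_q) : x != 0 -> y != 0 ->
  exists n, y = x *+ n /\ coprime n q.
Proof.
move=> x0 y0; have q1 := prime_gt1 q_prime.
have nz (z : 'Z_q) : z != 0 -> coprime q z.
  move=> z0; rewrite prime_coprime //; apply: contra z0 => /dvdnP[m e].
  rewrite -[z]natr_Zp e natrM.
  by rewrite pchar_Zp // mulr0.
have xu : x \is a GRing.unit by rewrite -[x]natr_Zp unitZpE // nz.
(* The witness is the natural representative of the quotient, prime to [q] because it is nonzero
   modulo the prime [q]. *)
exists (y / x : 'Z_q); split.
  by rewrite -mulr_natr natr_Zp mulrC divrK.
rewrite coprime_sym nz //; apply: contra y0 => /eqP e.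
by rewrite -[y](divrK xu) e mul0r.
Qed.

(** Let [n] times the degree of [X] be the degree of [Y]. Then [S^n] fixes a constituent of [X^n],
    hence also [Y], which is that constituent times an invertible object. Since [n] is prime to [q],
    [S] is a power of [S^n]. *)
Lemma stab_transfer S X Y : simple S -> simple X -> simple Y ->
  d X != 0 -> d Y != 0 -> S ⊗ X ≅ X -> S ⊗ Y ≅ Y.
Proof.
move=> sS sX sY dX dY e; have [n [en con]] := deg_multiple dX dY.
have [Z [sZ oZ]] := exists_constituent ss (@nonzero_itens _ _ X n (proj1 sX)).
have dZ : d Z = d Y by rewrite (deg_itens sX sZ oZ).
have [a [sa ia _ aZ]] := inv_trans sZ sY dZ.
have eZ := absorb sX e sZ oZ.
have eY : itens S n 𝟙 ⊗ Y ≅ Y.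
  by rewrite -aZ (tensCA bc) -itensE eZ.
have n0 : (0 < n)%N.
  by case: (n) con (prime_gt1 q_prime) => // h; rewrite -(eqP h) gcd0n ltnn.
(* Bezout: [m * n = j * q + 1], so the [m]-th power of [S^n] is [S], by [S^q ≅ 𝟙]. *)
have [m j E _] := egcdnP q n0.
have eYm i : itens (itens S n 𝟙) i Y ≅ Y.
  by elim: i => //= i IH; rewrite IH.
have := eYm m; rewrite itensE -itensM mulnC E (eqP con) addnC itensD.
rewrite mulnC.
have -> : itens S 1 (itens S (q * j) 𝟙) ≅ S.
  by rewrite /= itensM (stab_exponent sS sX e) itens1 tensX1.
by [].
Qed.

End Degree.

(** * Full fusion subcategories *)

Section FullSubcategory.
Variables (k : fieldType) (C : kcat k) (P : C -> Prop).

Definition sub_kcat : kcat k :=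
  @KCat k {X : C | P X} (fun X Y => hom (sval X) (sval Y))
    (fun X => \id_(sval X)) (fun X Y Z g f => g ∘ f)
    (fun X Y f => kcomp1m f) (fun X Y f => kcompm1 f)
    (fun X Y Z W h g f => kcompA h g f)
    (fun X Y Z f => kcomp_linearl f) (fun X Y Z g => kcomp_linearr g).

Implicit Types (X Y : sub_kcat).

Definition sub_obj (X : C) (PX : P X) : sub_kcat := exist P X PX.

Definition sub_iso X Y (i : iso (sval X) (sval Y)) : iso X Y :=
  @Iso k sub_kcat X Y (fwd i) (bwd i) (bwdK i) (fwdK i).
Definition iso_sub X Y (i : iso X Y) : iso (sval X) (sval Y) :=
  @Iso k C (sval X) (sval Y) (fwd i) (bwd i) (bwdK i) (fwdK i).

Lemma sub_isomorphic X Y : X ≅ Y <-> sval X ≅ sval Y.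
Proof. by split=> -[i]; exists; [apply: iso_sub | apply: sub_iso]. Qed.

Lemma sub_is_iso X Y (f : hom X Y) :
  is_iso f <-> @is_iso k C (sval X) (sval Y) f.
Proof. by split=> -[i <-]; [exists (iso_sub i) | exists (sub_iso i)]. Qed.

Hypothesis C_ss : semisimple_cat C.
Hypothesis P_retract : forall (X Y : C) (i : hom X Y) (p : hom Y X),
  p ∘ i = \id_X -> P Y -> P X.
Hypothesis P_dsum : forall n (s : 'I_n -> C) (X : C),
  (forall a, P (s a)) -> is_dsum s X -> P X.

Lemma sub_mono_split X Y (f : hom X Y) : mono f ->
  exists g : hom Y X, g ∘ f = \id_X.
Proof.
move=> mf; have [g e] := ss_regular C_ss (f : @hom k C (sval X) (sval Y)).
exists g; apply: mf; rewrite kcompm1 -[RHS]e; exact: (@kcompA k C).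
Qed.
Lemma sub_epi_split X Y (f : hom X Y) : epi f ->
  exists g : hom Y X, f ∘ g = \id_Y.
Proof.
move=> mf; have [g e] := ss_regular C_ss (f : @hom k C (sval X) (sval Y)).
by exists g; apply: mf; rewrite kcomp1m -[RHS]e.
Qed.

(** Simplicity depends on the available subobjects. Monomorphisms split on both sides: a subobject
    in [C] is a retract and so satisfies [P], and a monomorphism of the subcategory stays one in
    [C]. *)
Lemma sub_simple X : simple X <-> simple (sval X).
Proof.
split=> -[nz sX]; split=> // Y i mi.
  have [g gi] := mono_split C_ss mi.
  pose Y' := sub_obj (P_retract gi (svalP X)).
  have mi' : @mono k sub_kcat Y' X i by move=> Z u v; apply: mi.
  by case: (sX Y' i mi') => [|/sub_is_iso]; [left | right].
have [g gi] := sub_mono_split mi.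
have mi' : @mono k C (sval Y) (sval X) i := @split_mono k C _ _ i g gi.
by case: (sX (sval Y) i mi') => [|ii]; [left | right; apply/sub_is_iso].
Qed.

(** Kernels and cokernels computed in [C] are retracts, so they satisfy [P]; a split monomorphism or
    epimorphism is a kernel or cokernel of the complementary idempotent. *)
Lemma sub_abelian : abelian_cat sub_kcat.
Proof.
split.
- move=> n s; have [X dX] := ss_dsum C_ss (fun a => sval (s a)).
  by exists (sub_obj (P_dsum (fun a => svalP (s a)) dX)).
- move=> X Y f.
  have [K [i ki]] := ss_kernel C_ss (f : @hom k C (sval X) (sval Y)).
  have /(kernel_splitP C_ss)[_ [r [g [ri _]]]] := ki.
  exists (sub_obj (P_retract ri (svalP X))), i.
  by case: ki => fi u; split=> // Z; apply: u.
- move=> X Y f.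
  have [K [p kp]] := ss_cokernel C_ss (f : @hom k C (sval X) (sval Y)).
  have /(cokernel_splitP C_ss)[_ [r [g [ri _]]]] := kp.
  exists (sub_obj (P_retract ri (svalP Y))), p.
  by case: kp => fi u; split=> // Z; apply: u.
- move=> X Y f /sub_mono_split[g gf]; exists Y, (\id_Y - f ∘ g); split.
    by rewrite compBl kcomp1m -kcompA gf kcompm1 subrr.
  move=> Z h /eqP; rewrite compBl kcomp1m subr_eq0 => /eqP e.
  exists (g ∘ h); split; first by rewrite kcompA.
  by move=> u <-; rewrite kcompA gf kcomp1m.
- move=> X Y f /sub_epi_split[g gf]; exists X, (\id_X - g ∘ f); split.
    by rewrite compBr kcompm1 kcompA gf kcomp1m subrr.
  move=> Z h /eqP; rewrite compBr kcompm1 subr_eq0 => /eqP e.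
  exists (h ∘ g); split; first by rewrite -kcompA.
  by move=> u <-; rewrite -kcompA gf kcompm1.
Qed.

Lemma sub_semisimple : semisimple_cat sub_kcat.
Proof.
split; first exact: sub_abelian.
move=> X; have [n [s [ss dX]]] := ss_decomp C_ss (sval X).
have Ps a : P (s a).
  by case: dX => i [p [pi1 _ _]]; exact: (P_retract (pi1 a) (svalP X)).
exists n, (fun a => sub_obj (Ps a)); split=> // a; apply/sub_simple; exact: ss.
Qed.

Lemma sub_simple_reps : (exists r : {n : nat & 'I_n -> C}, simple_reps (projT2 r))
  -> exists r : {n : nat & 'I_n -> sub_kcat}, simple_reps (projT2 r).
Proof.
move=> [[n r] /= [r_simple r_inj r_ex]].
pose A := [set i | `[< P (r i) >]]%SET.
have PA (i : 'I_#|A|) : P (r (enum_val i)).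
  by have := enum_valP i; rewrite inE => /asboolP.
exists (existT (fun m => 'I_m -> sub_kcat) #|A| (fun i => sub_obj (PA i))); split=> /=.
- move=> i; apply/sub_simple. exact: r_simple.
- by move=> i j /sub_isomorphic /= /r_inj/enum_val_inj.
move=> X /sub_simple sX; have [i [e]] := r_ex _ sX.
have Pi : P (r i) by exact: (P_retract (fwdK e) (svalP X)).
have Ai : i \in A by rewrite inE; apply/asboolP.
exists (enum_rank_in Ai i); apply/sub_isomorphic => /=.
by rewrite enum_rankK_in.
Qed.

End FullSubcategory.

Section FullSubMonoidal.
Variables (k : fieldType) (C : moncat k) (P : C -> Prop).
Hypothesis P_one : P 𝟙.
Hypothesis P_tens : forall X Y : C, P X -> P Y -> P (X ⊗ Y).
Notation D := (sub_kcat P).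

Definition sub_tens : bifunctor D D D :=
  @BiFunctor k D D D
    (fun X Y => exist P (sval X ⊗ sval Y) (P_tens (svalP X) (svalP Y)))
    (fun X X' Y Y' f g => f ⊗₁ g)
    (fun X Y => bmor1 tens (sval X) (sval Y))
    (fun X X' X'' Y Y' Y'' f' f g' g => bmorM tens f' f g' g)
    (fun X X' Y Y' g => bmor_linearl tens g)
    (fun X X' Y Y' f => bmor_linearr tens f).

Definition sub_moncat : moncat k.
Proof.
refine (@MonCat k D sub_tens (exist P 𝟙 P_one)
  (fun X Y Z => @sub_iso k C P (sub_tens (sub_tens X Y) Z)
     (sub_tens X (sub_tens Y Z)) (asc (sval X) (sval Y) (sval Z)))
  (fun X => @sub_iso k C P (sub_tens (exist P 𝟙 P_one) X) X (lun (sval X)))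
  (fun X => @sub_iso k C P (sub_tens X (exist P 𝟙 P_one)) X (run (sval X)))
  _ _ _ _ _).
- by move=> *; apply: (@asc_natural k C).
- by move=> *; apply: (@lun_natural k C).
- by move=> *; apply: (@run_natural k C).
- by move=> *; apply: (@pentagon k C).
- by move=> *; apply: (@triangle k C).
Defined.

Definition sub_braiding (bc : braiding C) : braiding sub_moncat.
Proof.
refine (@Braiding k sub_moncat (fun X Y : sub_moncat =>
   @sub_iso k C P (X ⊗ Y) (Y ⊗ X) (braid bc (sval X) (sval Y))) _ _ _).
- by move=> *; apply: (@braid_natural k C).
- by move=> *; apply: (@hexagon1 k C).
- by move=> *; apply: (@hexagon2 k C).
Defined.

Lemma sub_left_dual (X Y : sub_moncat) :
  left_dual (sval X) (sval Y) -> left_dual X Y.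
Proof. by move=> [ev [coev [e1 e2]]]; exists ev, coev. Qed.

Lemma sub_itens (X : sub_moncat) n (U : sub_moncat) :
  sval (itens X n U) = itens (sval X) n (sval U).
Proof. by elim: n => //= n ->. Qed.

End FullSubMonoidal.

Section FullSubFusion.
Variables (k : closedFieldType) (C : fusionCat k) (bc : braiding C).
Variable Q : C -> Prop.
Implicit Types (X Y Z : C).
Hypothesis Q_iso : forall X Y, simple X -> X ≅ Y -> Q X -> Q Y.
Hypothesis Q_one : Q 𝟙.
Hypothesis Q_tens : forall X Y Z, simple X -> simple Y -> simple Z ->
  Q X -> Q Y -> occurs Z (X ⊗ Y) -> Q Z.
Hypothesis Q_dual : forall X Z, simple X -> simple Z -> Q X ->
  occurs 𝟙 (X ⊗ Z) -> Q Z.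

Let ss := fus_ss C.

(** [Q] is specified on simple objects; this is its additive closure, which holds vacuously for zero
    objects and is closed under sums and retracts. *)
Definition all_constituents X : Prop :=
  forall Z, simple Z -> occurs Z X -> Q Z.
Local Notation P := all_constituents.

Lemma ac_simple X : simple X -> P X <-> Q X.
Proof.
move=> sX; split=> [h|qX Z sZ o].
  by apply: h => //; apply: occurs_simple.
apply: Q_iso qX => //; symmetry; exact: (simple_occurs ss sZ sX o).
Qed.

Lemma ac_retract X Y (i : hom X Y) (p : hom Y X) :
  p ∘ i = \id_X -> P Y -> P X.
Proof.
move=> pi PY Z sZ [f f0]; apply: PY => //; exists (i ∘ f).
apply: contraNneq f0 => e.
by rewrite -[f]kcomp1m -pi -kcompA e compm0.
Qed.

Lemma ac_dsum n (s : 'I_n -> C) X : (forall a, P (s a)) -> is_dsum s X -> P X.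
Proof.
by move=> Ps dX Z sZ /(occurs_dsum dX)[a]; apply: Ps.
Qed.

Lemma ac_one : P 𝟙.
Proof. by apply/ac_simple => //; apply: fus_one. Qed.

Lemma ac_tens X Y : P X -> P Y -> P (X ⊗ Y).
Proof.
move=> PX PY Z sZ /(occurs_tens2 bc)[U [V [sU sV UX VY]]].
by apply: Q_tens => //; [apply: PX | apply: PY].
Qed.

Lemma ac_dual X Y : P X -> left_dual Y X -> P Y.
Proof.
move=> PX XY Z sZ; rewrite -(tensX1 Y).
move/(adj_occurs _ XY (fus_one C)); rewrite (tensC bc) => /occurs_tens.
move=> [V [sV VX o]]; apply: (Q_dual sV) => //; first exact: PX.
by rewrite (tensC bc).
Qed.

Lemma ac_dual' X Y : P X -> left_dual X Y -> P Y.
Proof.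
move=> PX YX Z sZ; rewrite -(tensX1 Y) => /(adj_occurs _ YX sZ).
rewrite (tensC bc) => /occurs_tens[V [sV VX o]].
by apply: (Q_dual sV) => //; [apply: PX | rewrite (tensC bc)].
Qed.

Notation M := (sub_moncat ac_one ac_tens).

Lemma sub_is_fusion : is_fusion M.
Proof.
have [_ R F Rp _] := fusionP C.
split.
- exact: (sub_semisimple ss ac_retract ac_dsum).
- move=> X; have [[Y XY] [Y' XY']] := R (sval X); split.
    exists (exist P Y (ac_dual' (svalP X) XY)); exact: sub_left_dual.
  exists (exist P Y' (ac_dual (svalP X) XY')); exact: sub_left_dual.
- by move=> X Y; apply: F.
- exact: (sub_simple_reps ss ac_retract).
- by apply/(sub_simple ss ac_retract); apply: fus_one.
Qed.

Definition sub_fusion : fusionCat k := FusionCat sub_is_fusion.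

End FullSubFusion.

(** * Frobenius-Perron dimensions *)

Section Indices.
Variables (k : closedFieldType) (C : fusionCat k) (bc : braiding C).
Implicit Types (X Y Z W U V T S a b c : C).
Notation n := (nsimple C).
Notation r := (@simple_obj k C).

Let ss := fus_ss C.
Let fin := @fus_fin k C.

Lemma r_reps : simple_reps r.
Proof. exact: (svalP (cid (simple_reps_ex C))). Qed.
Lemma r_simple i : simple (r i). Proof. by case: r_reps. Qed.
Lemma r_inj i j : r i ≅ r j -> i = j. Proof. by case: r_reps => _ h _; apply: h. Qed.
Lemma r_ex X : simple X -> exists i, X ≅ r i. Proof. by case: r_reps => _ _ h; apply: h. Qed.

Definition idx1 : 'I_n := sval (cid (r_ex (fus_one C))).
Definition idx X : 'I_n := odflt idx1 [pick i | `[< X ≅ r i >]].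

Lemma idxP X : simple X -> X ≅ r (idx X).
Proof.
move=> sX; rewrite /idx; case: pickP => [i /asboolP//|no].
by have [i /asboolP] := r_ex sX; rewrite no.
Qed.
Lemma idxr i : idx (r i) = i.
Proof. by apply/r_inj; symmetry; apply: idxP; apply: r_simple. Qed.
Lemma idx_iso X Y : X ≅ Y -> idx X = idx Y.
Proof.
move=> e; rewrite /idx; congr odflt; apply: eq_pick => i.
by apply/asboolP/asboolP; rewrite e.
Qed.
Lemma idx_inj X Y : simple X -> simple Y -> idx X = idx Y -> X ≅ Y.
Proof. by move=> sX sY e; rewrite (idxP sX) e -idxP. Qed.
Lemma idx_eq X i : simple X -> idx X = i <-> X ≅ r i.
Proof.
move=> sX; split=> [<-|e]; first exact: idxP.
by rewrite (idx_iso e) idxr.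
Qed.

Lemma ldim_sym X Y : ldim (hom X Y) = ldim (hom Y X).
Proof.
rewrite (ldim_mult ss fin r_reps) (ldim_mult ss fin r_reps Y).
by apply: eq_bigr => i _; rewrite mulnC.
Qed.

Lemma ldim_r i j : ldim (hom (r i) (r j)) = (i == j).
Proof.
rewrite (ldim_simple ss fin (r_simple i) (r_simple j)); congr nat_of_bool.
by apply/asboolP/eqP => [/r_inj|->].
Qed.

Lemma ldim_tens_mult U W V : ldim (hom U (W ⊗ V)) =
  (\sum_i ldim (hom (r i) W) * ldim (hom U (r i ⊗ V)))%N.
Proof.
have [m [s [sim dW]]] := ss_decomp ss W.
rewrite (ldim_dsumr fin U (dsum_tensr V dW)).
under [RHS]eq_bigr => i _ do rewrite (ldim_dsumr fin (r i) dW) big_distrl /=.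
rewrite exchange_big /=; apply: eq_bigr => a _.
rewrite (bigD1 (idx (s a))) //= big1 ?addn0 => [|i ii].
  rewrite (ldim_iso (isomorphic_refl _) (idxP (sim a))) ldim_r eqxx mul1n.
  apply: ldim_iso => //; apply: tens_isomorphic => //; exact: idxP.
rewrite (ldim_iso (isomorphic_refl _) (idxP (sim a))) ldim_r.
by rewrite (negPf ii) mul0n.
Qed.

Lemma ldim_inv a U V : invertible a -> ldim (hom (a ⊗ U) (a ⊗ V)) = ldim (hom U V).
Proof.
move=> ia; have sa := invertible_simple ia; have [Y aY] := fus_dual a.
rewrite (adj_ldim _ _ aY); apply: ldim_iso => //.
have : 𝟙 ≅ Y ⊗ a.
  apply: (simple_occurs ss (fus_one C)); last exact: one_occurs sa aY.
  rewrite (tensC bc); apply: inv_simple => //; exact: (dual_simple bc sa aY).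
by move=> e; rewrite -tensA -e tens1X.
Qed.

(** * The permutation action of invertible objects on simple objects *)

Definition iact a i := idx (a ⊗ r i).

Lemma iactP a i : invertible a -> a ⊗ r i ≅ r (iact a i).
Proof. by move=> ia; apply: idxP; apply: inv_simple => //; apply: r_simple. Qed.
Lemma iact_inj a : invertible a -> injective (iact a).
Proof.
move=> ia i j e; apply: r_inj; apply: (inv_cancel ia).
by rewrite !iactP // e.
Qed.
Lemma iact_iso a b i : a ≅ b -> iact a i = iact b i.
Proof. by move=> e; apply: idx_iso; rewrite e. Qed.
Lemma iact_tens a b i : invertible b -> iact (a ⊗ b) i = iact a (iact b i).
Proof. by move=> ib; apply: idx_iso; rewrite tensA iactP. Qed.
Lemma iact_one i : iact 𝟙 i = i.
Proof. by rewrite /iact (idx_iso (tens1X _)) idxr. Qed.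

(** Embeds the group of invertible objects into a permutation group, which makes Lagrange, Cauchy
    and orbit counting available. The action is faithful because [a] is recovered from the image of
    the unit. The default is for objects that do not act injectively. *)
Definition iperm a : {perm 'I_n} :=
  if pselect (injective (iact a)) is left h then perm h else 1%g.

Lemma ipermE a i : invertible a -> iperm a i = iact a i.
Proof.
by move=> ia; rewrite /iperm; case: pselect => [h|/(_ (iact_inj ia))//]; rewrite permE.
Qed.
Lemma ipermM a b : invertible a -> invertible b -> iperm (a ⊗ b) = (iperm b * iperm a)%g.
Proof.
move=> ia ib; apply/permP => i; rewrite permM !ipermE ?iact_tens //.
exact: invertible_tens.
Qed.
Lemma iperm_one : iperm 𝟙 = 1%g.
Proof.
by apply/permP => i; rewrite perm1 ipermE ?iact_one //; apply: invertible1.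
Qed.
Lemma iperm_iso a b : invertible a -> a ≅ b -> iperm a = iperm b.
Proof.
move=> ia e; apply/permP => i; rewrite !ipermE ?(iact_iso _ e) //.
by rewrite -e.
Qed.
Lemma iperm_inj a b : invertible a -> invertible b -> iperm a = iperm b -> a ≅ b.
Proof.
move=> ia ib e; apply: idx_inj; [exact: invertible_simple..|].
have := congr1 (fun p : {perm 'I_n} => p idx1) e; rewrite !ipermE // /iact.
have E : 𝟙 ≅ r idx1 by exact: (svalP (cid (r_ex (fus_one C)))).
have F x : x ⊗ r idx1 ≅ x by rewrite -E tensX1.
by rewrite !(idx_iso (F _)).
Qed.
Lemma iperm_itens a m : invertible a -> iperm (itens a m 𝟙) = (iperm a ^+ m)%g.
Proof.
move=> ia; elim: m => [|m IH] /=; first by rewrite iperm_one.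
by rewrite ipermM ?IH ?expgSr //; apply: invertible_itens.
Qed.

Definition inv_set : {set {perm 'I_n}} :=
  [set p | `[< exists a, invertible a /\ p = iperm a >]]%SET.

Lemma inv_setP p : p \in inv_set <-> exists a, invertible a /\ p = iperm a.
Proof. by rewrite inE; split=> /asboolP. Qed.

Lemma inv_group_set : group_set inv_set.
Proof.
apply/group_setP; split.
  by apply/inv_setP; exists 𝟙; rewrite iperm_one; split=> //; apply: invertible1.
move=> p p' /inv_setP[a [ia ->]] /inv_setP[b [ib ->]].
apply/inv_setP; exists (b ⊗ a); rewrite ipermM //; split=> //.
exact: invertible_tens.
Qed.
Definition inv_group := Group inv_group_set.

Lemma inv_exponent a : invertible a -> itens a #|inv_group| 𝟙 ≅ 𝟙.
Proof.
move=> ia; apply: iperm_inj; [exact: invertible_itens|exact: invertible1|].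
by rewrite iperm_itens // iperm_one expg_cardG //; apply/inv_setP; exists a.
Qed.

Lemma itens_eq1 a m : invertible a -> itens a m 𝟙 ≅ 𝟙 <-> (iperm a ^+ m = 1)%g.
Proof.
move=> ia; rewrite -iperm_itens // -iperm_one; split=> [e|]; last first.
  by apply: iperm_inj; [exact: invertible_itens|exact: invertible1].
by apply: iperm_iso => //; apply: invertible_itens.
Qed.

Definition stab x : {set 'I_n} := [set i | `[< r i ⊗ r x ≅ r x >]]%SET.

Lemma stabP i x : i \in stab x <-> r i ⊗ r x ≅ r x.
Proof. by rewrite inE; split=> /asboolP. Qed.

(** * Stabilisers and multiplicities *)

Section WithDegree.
Variables (q : nat) (q_prime : prime q) (d : C -> 'Z_q).
Hypothesis d_deg : degree_map d.
Notation deg i := (d (r i)).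

Lemma stab_invertible i x : i \in stab x -> invertible (r i).
Proof.
by move/stabP; apply: (stab_inv d_deg); apply: r_simple.
Qed.

Lemma ldim_dual_tens i x Y : left_dual Y (r x) ->
  ldim (hom (r i) (Y ⊗ r x)) = (i \in stab x).
Proof.
move=> xY; case: (boolP (i \in stab x)) => [ix|nix].
  rewrite -(adj_ldim _ _ xY).
  have e : r x ⊗ r i ≅ r x by rewrite (tensC bc); apply/stabP.
  by rewrite (ldim_iso e (isomorphic_refl _)) ldim_r eqxx.
apply/eqP; rewrite -leqn0 leqNgt; apply: contra nix => /(ldim_gt0 fin) o.
by apply/stabP/(dual_tens_occurs bc d_deg (r_simple x) xY (r_simple i)).
Qed.

(* [X^∨ ⊗ X] is the sum of the stabiliser of [X]. *)
Lemma gram x j j' :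
  (\sum_i ldim (hom (r i) (r x ⊗ r j)) * ldim (hom (r i) (r x ⊗ r j')) =
   \sum_(s in stab x) (iact (r s) j' == j))%N.
Proof.
have [Y xY] := fus_dual (r x).
rewrite -(ldim_mult ss fin r_reps) (adj_ldim _ _ xY).
rewrite -(ldim_iso (isomorphic_refl _) (tensA Y (r x) (r j'))) ldim_tens_mult.
rewrite [RHS]big_mkcond /=; apply: eq_bigr => s _.
rewrite (ldim_dual_tens s xY); case: ifP => [sx|_]; last by rewrite mul0n.
rewrite mul1n (ldim_iso (isomorphic_refl _) (iactP j' (stab_invertible sx))).
by rewrite ldim_r eq_sym.
Qed.

Lemma ldim_stab x s i j : s \in stab x ->
  ldim (hom (r (iact (r s) i)) (r x ⊗ r j)) = ldim (hom (r i) (r x ⊗ r j)).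
Proof.
move=> sx; have si := stab_invertible sx.
rewrite -[RHS](ldim_inv _ _ si); apply: ldim_iso; first by symmetry; apply: (iactP i si).
by rewrite -tensA; move/stabP: sx => ->.
Qed.

Lemma stab_deg x y : deg x != 0 -> deg y != 0 -> stab x = stab y.
Proof.
move=> dx dy; apply/setP => i; apply/idP/idP => /stabP e; apply/stabP;
  by apply: (stab_transfer bc q_prime d_deg _ _ _ _ _ e) => //; apply: r_simple.
Qed.

Lemma idx1E : 𝟙 ≅ r idx1.
Proof. exact: (svalP (cid (r_ex (fus_one C)))). Qed.

Lemma stab0 x : deg x = 0 -> stab x = [set idx1]%SET.
Proof.
move=> dx; apply/setP => i; rewrite finset.in_set1; apply/idP/eqP => [/stabP e|->].
  apply: r_inj; rewrite -idx1E; apply: inv_cancelr e.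
  exact: (deg0_inv d_deg (r_simple x)).
by apply/stabP; rewrite -idx1E tens1X.
Qed.

Lemma deg_idx1 : deg idx1 = 0.
Proof.
by rewrite -(deg_iso d_deg (fus_one C) idx1E) (deg1 d_deg).
Qed.

Lemma stab_card_gt0 x : (0 < #|stab x|)%N.
Proof.
by apply/card_gt0P; exists idx1; apply/stabP; rewrite -idx1E tens1X.
Qed.

Lemma deg_act a i : simple a -> invertible a -> d a = 0 -> deg (iact a i) = deg i.
Proof.
move=> sa ia da.
have e : r (iact a i) ≅ a ⊗ r i by symmetry; apply: (iactP i ia).
by rewrite (deg_tens d_deg sa (r_simple i) (r_simple _) e) da add0r.
Qed.

Lemma stab_act s x i : s \in stab x -> deg (iact (r s) i) = deg i.
Proof.
move=> sx; apply: deg_act; [exact: r_simple|exact: stab_invertible sx|].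
by move/stabP: sx => e; apply: (stab_deg0 d_deg _ _ e); apply: r_simple.
Qed.

Section FrobeniusPerron.
Variable R : realType.

Definition fpd x : R := Num.sqrt (#|stab x|%:R).

Lemma fpd_gt0 x : 0 < fpd x.
Proof. by rewrite sqrtr_gt0 ltr0n stab_card_gt0. Qed.
Lemma fpd_sqr x : fpd x ^+ 2 = #|stab x|%:R.
Proof. by rewrite sqr_sqrtr // ler0n. Qed.
Lemma fpd0 x : deg x = 0 -> fpd x = 1.
Proof. by move=> dx; rewrite /fpd stab0 // cards1 sqrtr1. Qed.

(* The constituents of [r y ⊗ r z] form one orbit of the stabiliser, and the sum
   of the squares of their multiplicities is given by [gram]. *)
Lemma fpd_tens y z :
  \sum_j fpd j * (ldim (hom (r j) (r y ⊗ r z)))%:R = fpd y * fpd z.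
Proof.
have main0 (u v : 'I_n) : deg u = 0 ->
    \sum_j fpd j * (ldim (hom (r j) (r u ⊗ r v)))%:R = fpd u * fpd v.
  move=> du; have iu := deg0_inv d_deg (r_simple u) du.
  under eq_bigr => j _ do
    rewrite (ldim_iso (isomorphic_refl _) (iactP v iu)) ldim_r.
  rewrite (bigD1 (iact (r u) v)) //= eqxx mulr1 big1 ?addr0; last first.
    by move=> j /negPf ->; rewrite mulr0.
  rewrite (fpd0 du) mul1r.
  have da : deg (iact (r u) v) = deg v by apply: deg_act => //; apply: r_simple.
  case: (eqVneq (deg v) 0) => dv; first by rewrite !fpd0 ?da.
  by rewrite /fpd (@stab_deg _ v) ?da.
case: (eqVneq (deg y) 0) => [/main0//|dy].
case: (eqVneq (deg z) 0) => [/main0 e|dz].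
  rewrite mulrC -e; apply: eq_bigr => j _; congr (_ * _%:R).
  by apply: ldim_iso => //; apply: tensC bc _ _.
have yz : fpd y * fpd z = #|stab y|%:R by rewrite -fpd_sqr expr2 /fpd (stab_deg dy dz).
rewrite {}yz.
have [Z [sZ oZ]] := exists_constituent ss
  (nonzero_tens (proj1 (r_simple y)) (proj1 (r_simple z))).
pose j0 := idx Z; pose m := ldim (hom (r j0) (r y ⊗ r z)).
have m_gt0 : (0 < m)%N by apply/(ldim_gt0 fin); rewrite -(idxP sZ).
have orb j : (0 < ldim (hom (r j) (r y ⊗ r z)))%N ->
    exists2 s, s \in stab y & j = iact (r s) j0.
  move=> /(ldim_gt0 fin) oj; move: m_gt0 => /(ldim_gt0 fin) o0.
  have [T [sT iT eT ej]] := orbit_lemma bc d_deg (r_simple y) (r_simple z)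
    (r_simple j0) (r_simple j) o0 oj.
  exists (idx T); first by apply/stabP; rewrite -idxP.
  by symmetry; apply/idx_eq; rewrite -?(idxP sT) // ej; apply: r_simple.
have mE s : s \in stab y -> ldim (hom (r (iact (r s) j0)) (r y ⊗ r z)) = m.
  exact: ldim_stab.
(* In [gram] with both indices [z], every [s] in [stab y = stab z] fixes [z], so each term is 1. *)
have sq : (\sum_j ldim (hom (r j) (r y ⊗ r z)) ^ 2 = #|stab y|)%N.
  under eq_bigr => j _ do rewrite -mulnn.
  rewrite gram -sum1_card; apply: eq_bigr => s sy; apply/eqP; rewrite eqb1.
  apply/eqP/idx_eq; last by apply/stabP; rewrite (stab_deg dz dy).
  by apply: inv_simple; [exact: stab_invertible sy | exact: r_simple].
(* In nonzero degree the stabiliser fixes [j0]: there is one constituent, with multiplicity the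
   square root of [#|stab y|]. In degree 0 it acts freely on the invertible [j0]: there are
   [#|stab y|] constituents, each with multiplicity 1. *)
case: (eqVneq (deg j0) 0) => d0; last first.
  have z0 j : j != j0 -> ldim (hom (r j) (r y ⊗ r z)) = 0%N.
    move=> jj; apply/eqP; rewrite -leqn0 leqNgt; apply: contra jj => /orb[s sy ->].
    apply/eqP/idx_eq; last by apply/stabP; rewrite (stab_deg d0 dy).
    by apply: inv_simple; [exact: stab_invertible sy | exact: r_simple].
  rewrite (bigD1 j0) //= big1 ?addr0 => [|j jj]; last by rewrite z0 // mulr0.
  move: sq; rewrite (bigD1 j0) //= big1 ?addn0 => [sq|j jj]; last by rewrite z0.
  rewrite -/m /fpd (stab_deg d0 dy) -sq natrX sqrtr_sqr ger0_norm ?ler0n //.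
pose O := [set iact (r s) j0 | s in stab y]%SET.
have inO j : j \in O -> ldim (hom (r j) (r y ⊗ r z)) = m.
  by move=> /imsetP[s sy ->]; apply: mE.
have notO j : j \notin O -> ldim (hom (r j) (r y ⊗ r z)) = 0%N.
  move=> jj; apply/eqP; rewrite -leqn0 leqNgt; apply: contra jj => /orb[s sy ->].
  exact: imset_f.
have cO : #|O| = #|stab y|.
  apply: card_in_imset => s t sy ty e; apply: r_inj.
  have i0 := deg0_inv d_deg (r_simple j0) d0.
  apply: (inv_cancel i0); rewrite !(tensC bc (r j0)).
  by rewrite (iactP _ (stab_invertible sy)) (iactP _ (stab_invertible ty)) e.
have m1 : m = 1%N.
  move: sq; rewrite (bigID (mem O)) /= [X in (_ + X)%N]big1 ?addn0; last first.
    by move=> j /notO ->.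
  under eq_bigr => j jO do rewrite (inO j jO).
  rewrite sum_nat_const cO => e.
  have : (m ^ 2 == 1 ^ 2)%N.
    by rewrite -(eqn_pmul2l (stab_card_gt0 y)) e muln1.
  by rewrite eqn_sqr => /eqP.
rewrite (bigID (mem O)) /= [X in _ + X]big1 ?addr0; last first.
  by move=> j /notO ->; rewrite mulr0.
rewrite (eq_bigr (fun=> 1)) ?sumr_const ?cO // => j jO.
rewrite inO // m1 mulr1 fpd0 //; have /imsetP[s sy ->] := jO.
by rewrite (stab_act _ sy).
Qed.

End FrobeniusPerron.
End WithDegree.
End Indices.

(** * Eigenvalues of fusion matrices *)

Section FPdimension.
Variables (k : closedFieldType) (C : fusionCat k) (bc : braiding C).
Implicit Types (X Y Z W U V T S a b c : C).
Notation n := (nsimple C).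
Notation r := (@simple_obj k C).
Variables (q : nat) (q_prime : prime q) (d : C -> 'Z_q).
Hypothesis d_deg : degree_map d.
Notation deg i := (d (r i)).
Variable R : realType.

Let ss := fus_ss C.
Let fin := @fus_fin k C.

(** Multiplicities in [X ⊗ r j] are constant on orbits of the stabiliser, so an eigenvector [v] for
    [e != 0] is too. By [gram], the fusion matrix times its transpose is the sum of the permutation
    matrices of the stabiliser, so the squared norm of [v] times the matrix is [#|stab x|] times
    that of [v]; it is also [e ^+ 2] times it. *)
Lemma fusion_eigenvalue x (e : R) : e != 0 ->
  eigenvalue (fusion_mx R (r x)) e -> e ^+ 2 = #|stab x|%:R.
Proof.
move=> e0 /eigenvalueP[v vM v0].
pose M j i : R := (ldim (hom (r i) (r x ⊗ r j)))%:R.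
have vE i : \sum_j v 0 j * M j i = e * v 0 i.
  have := congr1 (fun w : 'rV_n => w 0 i) vM; rewrite !mxE => <-.
  by apply: eq_bigr => j _; rewrite mxE.
have v_stab s i : s \in stab x -> v 0 (iact (r s) i) = v 0 i.
  move=> sx; apply: (mulfI e0); rewrite -!vE; apply: eq_bigr => j _.
  by rewrite /M (ldim_stab bc d_deg).
pose N := \sum_i v 0 i ^+ 2.
have N0 : N != 0.
  apply: contraNneq v0 => /eqP; rewrite psumr_eq0 => [/allP h|i _]; last first.
    exact: sqr_ge0.
  apply/eqP/rowP => i; rewrite mxE; apply/eqP; rewrite -sqrf_eq0.
  by apply: h; rewrite mem_index_enum.
apply: (mulIf N0).
have -> : e ^+ 2 * N = \sum_i (\sum_j v 0 j * M j i) ^+ 2.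
  by rewrite mulr_sumr; apply: eq_bigr => i _; rewrite vE exprMn.
transitivity (\sum_j \sum_j' v 0 j * v 0 j' * \sum_i M j i * M j' i).
  under eq_bigr => i _ do rewrite expr2 big_distrlr /=.
  rewrite exchange_big /=; apply: eq_bigr => j _.
  rewrite exchange_big /=; apply: eq_bigr => j' _.
  by rewrite mulr_sumr; apply: eq_bigr => i _; rewrite mulrACA.
have gramR j j' :
    \sum_i M j i * M j' i = \sum_(s in stab x) (iact (r s) j' == j)%:R.
  transitivity ((\sum_(s in stab x) (iact (r s) j' == j))%N%:R : R).
    rewrite -(gram bc d_deg) natr_sum; apply: eq_bigr => i _.
    by rewrite natrM.
  by rewrite natr_sum.
under eq_bigr => j _ do under eq_bigr => j' _ do rewrite gramR mulr_sumr.
under eq_bigr => j _ do rewrite exchange_big /=.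
rewrite exchange_big /= -sum1_card natr_sum mulr_suml; apply: eq_bigr => s sx.
rewrite exchange_big /= mul1r; apply: eq_bigr => j' _.
rewrite (bigD1 (iact (r s) j')) //= eqxx mulr1 big1 ?addr0 ?v_stab ?expr2 //.
by move=> j /negPf jj; rewrite eq_sym jj mulr0.
Qed.

Lemma fpd_dual x Y : left_dual Y (r x) -> fpd R (idx Y) = fpd R x.
Proof.
move=> xY; have sY := dual_simple bc (r_simple x) xY.
have dY : deg (idx Y) = - deg x.
  by rewrite -(deg_iso d_deg sY (idxP sY)) (deg_dual bc d_deg (r_simple x) xY).
case: (eqVneq (deg x) 0) => dx.
  by rewrite !(fpd0 d_deg) // dY dx oppr0.
by rewrite /fpd (@stab_deg _ _ bc _ q_prime _ d_deg (idx Y) x) // dY oppr_eq0.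
Qed.

(** The eigenvector is the vector of dimensions. As rows are acted on, the sum runs over the [j]
    with [r i] in [X ⊗ r j]; reciprocity turns it into the decomposition of [X^∨ ⊗ r i], and [X^∨]
    has the dimension of [X]. *)
Lemma fpd_eigenvalue x : eigenvalue (fusion_mx R (r x)) (fpd R x).
Proof.
apply/eigenvalueP; exists (\row_j fpd R j); last first.
  apply/eqP => /rowP/(_ x); rewrite !mxE => e.
  by have := fpd_gt0 R x; rewrite e ltxx.
apply/rowP => i; rewrite !mxE.
have [Y xY] := fus_dual (r x); have sY := dual_simple bc (r_simple x) xY.
rewrite -(fpd_dual xY) -(fpd_tens bc q_prime d_deg); apply: eq_bigr => j _.
rewrite !mxE; congr (_ * _%:R).
rewrite ldim_sym (adj_ldim _ _ xY); apply: ldim_iso => //.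
by apply: tens_isomorphic => //; apply: idxP.
Qed.

Lemma FPdim_r x : FPdim R (r x) = fpd R x.
Proof.
rewrite /FPdim; set A := [set _ | _]%classic.
have Ax : A (fpd R x) by split; [exact/ltW/fpd_gt0 | exact: fpd_eigenvalue].
have ubA : ubound A (fpd R x).
  move=> e [e0 ee]; case: (eqVneq e 0) => [->|ne]; first exact/ltW/fpd_gt0.
  rewrite -(@ler_pXn2r _ 2) ?nnegrE ?(ltW (fpd_gt0 R x)) //.
  by rewrite (fusion_eigenvalue ne ee) fpd_sqr.
apply/eqP; rewrite eq_le; apply/andP; split.
  by apply: ge_sup => //; exists (fpd R x).
by apply: ub_le_sup => //; exists (fpd R x).
Qed.

(** * Counting simple objects by degree *)

Section Counting.
Variable x0 : 'I_n.
Hypothesis x0_ninv : ~ invertible (r x0).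
Hypothesis q_power : forall a, invertible a -> exists K, itens a (q ^ K) 𝟙 ≅ 𝟙.

Lemma deg_x0 : deg x0 != 0.
Proof. by apply/eqP => /(deg0_inv d_deg (r_simple x0)). Qed.

(** Otherwise [X^∨ ⊗ X] would be a sum of copies of [𝟙], their number being the dimension 1 of
    [hom X X], and [X] would be invertible. *)
Lemma stab_nontrivial : exists2 s, s \in stab x0 & s != idx1 C.
Proof.
apply: contrapT => no; apply: x0_ninv.
have st s : s \in stab x0 -> s = idx1 C.
  by move=> sx; apply/eqP/negP => /negP ns; apply: no; exists s.
have [Y xY] := fus_dual (r x0).
have [m [t [st1 dM]]] := ss_decomp ss (Y ⊗ r x0).
have one j : t j ≅ 𝟙.
  have o := dsum_occurs dM (st1 j).
  have := st (idx (t j)); rewrite stabP -(idxP (st1 j)) => h.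
  rewrite (idx1E C); apply/(idx_eq _ (st1 j)); apply: h.
  exact/(dual_tens_occurs bc d_deg (r_simple x0) xY (st1 j)).
have m1 : m = 1%N.
  have := ldim_dsumr fin 𝟙 dM.
  rewrite -(adj_ldim _ _ xY) (ldim_iso (tensX1 _) (isomorphic_refl _)) ldim_r eqxx.
  under eq_bigr => j _ do rewrite (ldim_iso (isomorphic_refl _) (one j))
    (ldim_simple ss fin (fus_one C) (fus_one C)) asboolT //.
  by rewrite sum_nat_const card_ord muln1.
move: t st1 dM one; rewrite m1 => t _ [i [p [pi1 _ ip]]] one.
have e : Y ⊗ r x0 ≅ 𝟙.
  rewrite -(one ord0); exists; apply: (@Iso _ _ _ _ (p ord0) (i ord0)).
    by rewrite -ip big_ord1.
  exact: pi1.
by exists Y; split=> //; rewrite (tensC bc).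
Qed.

(** An invertible object has trivial stabiliser, while every simple object of nonzero degree has the
    nontrivial stabiliser of [x0]. *)
Lemma invertible_deg0 i : invertible (r i) <-> deg i = 0.
Proof.
split; last exact: (deg0_inv d_deg (r_simple i)).
move=> ii; apply/eqP/negP => /negP di.
have [s sx ns] := stab_nontrivial; case/eqP: ns.
rewrite (stab_deg bc q_prime d_deg deg_x0 di) in sx.
apply: r_inj; rewrite -(idx1E C); apply: (inv_cancelr ii); exact/stabP.
Qed.

Notation G := (inv_group C).

Lemma inv_group_pgroup : (q.-group G)%g.
Proof.
apply/pgroupP => p p_prime /(Cauchy p_prime)[x xG xp].
have /inv_setP[a [ia e]] := xG.
have [K /(itens_eq1 _ ia) aK] := q_power ia.
have : (p %| q ^ K)%N by rewrite -xp order_dvdn e aK.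
by rewrite Euclid_dvdX // => /andP[]; rewrite dvdn_prime2.
Qed.

Lemma card_stab_astab (x : 'I_n) : #|('C_G[x | 'P])%g| = #|stab x|.
Proof.
symmetry; rewrite -(card_in_imset (f := fun s => iperm (r s))); last first.
  move=> s t /(stab_invertible d_deg) si /(stab_invertible d_deg) ti e.
  by apply: r_inj; apply: iperm_inj.
congr #|(_ : {set _})|; apply/setP => p; apply/imsetP/setIP.
  move=> [s sx ->]; have si := stab_invertible d_deg sx; split.
    by apply/inv_setP; exists (r s).
  apply/astab1P; rewrite /= apermE ipermE //; apply/idx_eq; last exact/stabP.
  by apply: inv_simple => //; apply: r_simple.
move=> [/inv_setP[a [ia ->]] /astab1P]; rewrite /= apermE ipermE // => e.
have sa := invertible_simple ia.
exists (idx a); last by apply: iperm_iso => //; apply: idxP.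
apply/stabP; rewrite -(idxP sa) -{2}e; exact: iactP.
Qed.

Lemma card_stab_q (x : 'I_n) : exists M, #|stab x| = (q ^ M)%N.
Proof.
rewrite -card_stab_astab; have : (q.-group 'C_G[x | 'P])%g.
  by apply: pgroupS inv_group_pgroup; apply: subsetIl.
by move/card_pgroup => eM; exists (logn q #|('C_G[x | 'P])%g|).
Qed.

Lemma card_deg0 : #|[set i | deg i == 0]%SET| = #|G|.
Proof.
rewrite -(card_in_imset (f := fun s => iperm (r s))); last first.
  move=> s t; rewrite !inE => /eqP/invertible_deg0 si /eqP/invertible_deg0 ti e.
  by apply: r_inj; apply: iperm_inj.
congr #|(_ : {set _})|; apply/setP => p; apply/imsetP/idP.
  move=> [s]; rewrite inE => /eqP/invertible_deg0 si ->.
  by apply/inv_setP; exists (r s).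
move=> /inv_setP[a [ia ->]]; have sa := invertible_simple ia.
exists (idx a); last by apply: iperm_iso => //; apply: idxP.
by rewrite inE; apply/eqP/invertible_deg0; rewrite -(idxP sa).
Qed.

(** The orbit-stabiliser formula. It says that each component of nonzero degree has dimension
    [#|G|], like the component of degree 0. *)
Lemma card_deg x : deg x != 0 ->
  (#|[set i | deg i == deg x]%SET| * #|stab x| = #|G|)%N.
Proof.
move=> dx; rewrite -card_stab_astab -(card_orbit_stab 'P G x).
congr (_ * _)%N; congr #|(_ : {set _})|; apply/setP => i; rewrite inE.
apply/eqP/orbitP => [e|[p /inv_setP[a [ia ->]] <-]].
  have [a [sa ia _ aX]] := inv_trans bc d_deg (r_simple x) (r_simple i) (esym e).
  exists (iperm a); first by apply/inv_setP; exists a.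
  rewrite /= apermE ipermE //; apply/idx_eq => //.
  by apply: inv_simple => //; apply: r_simple.
have sa := invertible_simple ia.
rewrite /= apermE ipermE //; apply: (deg_act d_deg) => //.
by rewrite (deg_iso d_deg sa (idxP sa)); apply/invertible_deg0; rewrite -(idxP sa).
Qed.

Lemma deg_onto (g : 'Z_q) : exists i, deg i = g.
Proof.
case: (eqVneq g 0) => [->|g0]; first by exists (idx1 C); apply: deg_idx1.
have [m [e _]] := deg_multiple q_prime deg_x0 g0.
have [Z [sZ oZ]] := exists_constituent ss
  (@nonzero_itens _ _ (r x0) m (proj1 (r_simple x0))).
exists (idx Z); rewrite -(deg_iso d_deg sZ (idxP sZ)) e.
exact: (deg_itens d_deg (r_simple x0) sZ oZ).
Qed.

Lemma fpd_cases i : fpd R i = if deg i == 0 then 1 else fpd R x0.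
Proof.
case: eqVneq => [/(fpd0 d_deg)//|di].
by rewrite /fpd (stab_deg bc q_prime d_deg di deg_x0).
Qed.

Lemma fpd_x0_gt1 : 1 < fpd R x0.
Proof.
have [s sx ns] := stab_nontrivial.
rewrite -sqrtr1 ltr_sqrt ?ltr0n ?stab_card_gt0 // ltr1n.
have -> : 2%N = #|[set s; idx1 C]%SET| by rewrite cards2 ns.
apply: subset_leq_card; apply/fintype.subsetP => t.
rewrite finset.in_set2 => /orP[/eqP->//|/eqP->].
by apply/stabP; rewrite -(idx1E C) tens1X.
Qed.

Lemma FPdim_cat_power : exists M : nat, FPdim_cat R C = q%:R ^+ M.
Proof.
have [M cG] : exists M, #|G| = (q ^ M)%N.
  by have := card_pgroup inv_group_pgroup => e; exists (logn q #|G|).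
(* There are [q] components, each of dimension [#|G| = q ^ M]. *)
exists M.+1; rewrite /FPdim_cat.
under eq_bigr => i _ do rewrite FPdim_r fpd_sqr.
rewrite (partition_big (fun i => deg i) predT) //=.
have part (g : 'Z_q) :
    \sum_(i | deg i == g) (#|stab i|%:R : R) = q%:R ^+ M.
  have [x ex] := deg_onto g; rewrite -natr_sum -natrX -cG; congr _%:R.
  case: (eqVneq g 0) => g0.
    rewrite -card_deg0 -sum1_card; rewrite g0.
    rewrite [RHS](eq_bigl (fun i => deg i == 0)); last by move=> i; rewrite inE.
    by apply: eq_bigr => i /eqP di; rewrite (stab0 d_deg di) cards1.
  rewrite -(@card_deg x) ?ex // -sum_nat_const.
  rewrite [RHS](eq_bigl (fun i => deg i == g)); last by move=> i; rewrite inE.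
  apply: eq_bigr => i /eqP di.
  by rewrite (@stab_deg _ _ bc _ q_prime _ d_deg i x) ?ex ?di.
rewrite (eq_bigr (fun=> q%:R ^+ M)) ?sumr_const; last by move=> g _; apply: part.
by rewrite card_ord Zp_cast ?prime_gt1 // exprS mulr_natl.
Qed.

Theorem nonpointed_type : exists (m l : nat) (alpha : R),
  [/\ (0 < m)%N, (0 < l)%N, 1 < alpha,
      exists M : nat, alpha ^+ 2 = q%:R ^+ M
    & of_type C [:: (1, m); (alpha, l)]].
Proof.
pose alpha := fpd R x0.
pose A g := [set i : 'I_n | (FPdim R (r i)) == g]%SET.
have A1 : (0 < #|A 1%R|)%N.
  apply/card_gt0P; exists (idx1 C); rewrite inE FPdim_r fpd_cases.
  by rewrite (deg_idx1 d_deg) !eqxx.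
have Aa : (0 < #|A alpha|)%N.
  by apply/card_gt0P; exists x0; rewrite inE FPdim_r.
exists #|A 1%R|, #|A alpha|, alpha; split=> //; first exact: fpd_x0_gt1.
  by have [M e] := card_stab_q x0; exists M; rewrite fpd_sqr e natrX.
split=> //=; first by rewrite fpd_x0_gt1.
- by rewrite A1 Aa.
- move=> i; rewrite FPdim_r fpd_cases !inE.
  by case: ifP; rewrite eqxx ?orbT.
- by move=> dn; rewrite !inE => /orP[/eqP->|/eqP->].
Qed.

End Counting.
End FPdimension.

(** * The tensor product as a monoidal functor *)

Section Interchange.
Variables (k : fieldType) (C : moncat k) (bc : braiding C).
Implicit Types (X Y Z W U V : C).
Notation ch := (ch bc).
Notation α X Y Z := (fwd (asc X Y Z)).
Notation α' X Y Z := (bwd (asc X Y Z)).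

Definition ch_iso X Y U : iso (X ⊗ (Y ⊗ U)) (Y ⊗ (X ⊗ U)) :=
  iso_comp (iso_comp (iso_inv (asc X Y U)) (rw_iso U (braid bc X Y)))
    (asc Y X U).

Lemma ch_isoE X Y U : fwd (ch_iso X Y U) = ch X Y U.
Proof. by rewrite ch.unlock hat.unlock. Qed.

(** The middle-four interchange, crossing [Y] with [X']. It is the structure that makes the tensor
    product of a braided category a monoidal functor of two variables. *)
Definition swap_iso X Y X' Y' : iso ((X ⊗ Y) ⊗ (X' ⊗ Y')) ((X ⊗ X') ⊗ (Y ⊗ Y')) :=
  iso_comp (iso_comp (asc X Y (X' ⊗ Y')) (lw_iso X (ch_iso Y X' Y')))
    (iso_inv (asc X X' (Y ⊗ Y'))).

Lemma swap_isoE X Y X' Y' : fwd (swap_iso X Y X' Y') =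
  α' X X' (Y ⊗ Y') ∘ (X ◁ ch Y X' Y') ∘ α X Y (X' ⊗ Y').
Proof. by rewrite /= -ch_isoE /= !kcompA. Qed.

Lemma ascN' X X' Y Y' Z Z' (f : hom X X') (g : hom Y Y') (h : hom Z Z') :
  α' X' Y' Z' ∘ (f ⊗₁ (g ⊗₁ h)) = ((f ⊗₁ g) ⊗₁ h) ∘ α' X Y Z.
Proof. exact/iso_conj/asc_natural. Qed.

Lemma ch_natural X X' Y Y' U U' (f : hom X X') (g : hom Y Y') (h : hom U U') :
  ch X' Y' U' ∘ (f ⊗₁ (g ⊗₁ h)) = (g ⊗₁ (f ⊗₁ h)) ∘ ch X Y U.
Proof.
rewrite ch.unlock hat.unlock !kcompA -[LHS]kcompA ascN' !kcompA.
have -> : α Y' X' U' ∘ (fwd (braid bc X' Y') ▷ U') ∘ ((f ⊗₁ g) ⊗₁ h) =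
   α Y' X' U' ∘ ((g ⊗₁ f) ⊗₁ h) ∘ (fwd (braid bc X Y) ▷ U).
  by rewrite -!kcompA -!bmorM braid_natural kcomp1m kcompm1.
by rewrite asc_natural.
Qed.

Lemma swap_natural X Z Y W X' Z' Y' W'
    (f : hom X Z) (g : hom Y W) (f' : hom X' Z') (g' : hom Y' W') :
  fwd (swap_iso Z W Z' W') ∘ ((f ⊗₁ g) ⊗₁ (f' ⊗₁ g')) =
  ((f ⊗₁ f') ⊗₁ (g ⊗₁ g')) ∘ fwd (swap_iso X Y X' Y').
Proof.
rewrite !swap_isoE -[LHS]kcompA asc_natural !kcompA.
have -> : α' Z Z' (W ⊗ W') ∘ (Z ◁ ch W Z' W') ∘ (f ⊗₁ (g ⊗₁ (f' ⊗₁ g'))) =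
   α' Z Z' (W ⊗ W') ∘ (f ⊗₁ (f' ⊗₁ (g ⊗₁ g'))) ∘ (X ◁ ch Y X' Y').
  by rewrite -!kcompA -!bmorM ch_natural kcomp1m kcompm1.
by rewrite ascN'.
Qed.

Lemma ch_asc X Y W V :
  (Y ◁ α X W V) ∘ α Y (X ⊗ W) V ∘ (ch X Y W ▷ V) ∘ α' X (Y ⊗ W) V =
  ch X Y (W ⊗ V) ∘ (X ◁ α Y W V).
Proof.
rewrite ch.unlock hat.unlock !rwM !kcompA -pentagon.
rewrite (comp2 _ (ascN1 _ _ _)) !kcompA -[RHS]kcompA pent3 !kcompA.
by [].
Qed.

(** On right-nested words both sides are products of crossings: the hexagons split the crossing of
    [Y1 ⊗ Y2] with [X3] and that of [Y1] with [X2 ⊗ X3], and the remaining crossings act on disjoint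
    letters and commute. *)
Lemma swap_asc X1 X2 X3 Y1 Y2 Y3 :
  (α X1 X2 X3 ⊗₁ α Y1 Y2 Y3) ∘ fwd (swap_iso (X1 ⊗ X2) (Y1 ⊗ Y2) X3 Y3)
    ∘ (fwd (swap_iso X1 Y1 X2 Y2) ▷ (X3 ⊗ Y3)) =
  fwd (swap_iso X1 Y1 (X2 ⊗ X3) (Y2 ⊗ Y3))
    ∘ ((X1 ⊗ Y1) ◁ fwd (swap_iso X2 Y2 X3 Y3))
    ∘ α (X1 ⊗ Y1) (X2 ⊗ Y2) (X3 ⊗ Y3).
Proof.
rewrite !swap_isoE.
apply: (fwd_inj (i := asc X1 (X2 ⊗ X3) (Y1 ⊗ (Y2 ⊗ Y3)))).
apply: (fwd_inj (i := lw_iso X1 (asc X2 X3 (Y1 ⊗ (Y2 ⊗ Y3))))) => /=.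
rewrite -(lrw (α X1 X2 X3) (α Y1 Y2 Y3)) !lwM !rwM !kcompA.
have -> : (X1 ◁ α X2 X3 (Y1 ⊗ (Y2 ⊗ Y3))) ∘ α X1 (X2 ⊗ X3) (Y1 ⊗ (Y2 ⊗ Y3))
   ∘ (α X1 X2 X3 ▷ (Y1 ⊗ (Y2 ⊗ Y3))) =
   α X1 X2 (X3 ⊗ (Y1 ⊗ (Y2 ⊗ Y3))) ∘ α (X1 ⊗ X2) X3 (Y1 ⊗ (Y2 ⊗ Y3)).
  by rewrite pentagon.
rewrite fwdKr; set V := X3 ⊗ Y3; set W := Y2 ⊗ Y3.
rewrite (comp2 _ (esym (ascN3' _ _ _))) !kcompA fwdKr.
have e1 : ((X1 ⊗ X2) ◁ (X3 ◁ α Y1 Y2 Y3)) ∘ ((X1 ⊗ X2) ◁ ch (Y1 ⊗ Y2) X3 Y3) =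
  ((X1 ⊗ X2) ◁ ch Y1 X3 W) ∘ ((X1 ⊗ X2) ◁ (Y1 ◁ ch Y2 X3 Y3)) ∘
  ((X1 ⊗ X2) ◁ α Y1 Y2 V).
  rewrite -!lwM; congr (_ ◁ _).
  apply: (bwd_injr (i := asc Y1 Y2 V)); rewrite fwdKr -kcompA ch_tens_left.
  by rewrite !kcompA -lwM fwdK lw1 kcomp1m.
rewrite (comp2 _ e1) !kcompA ascN3.
do 6?[rewrite (comp2 _ (ascN3 _ _ _)) !kcompA].
rewrite [in LHS](comp2 _ (pentagon X1 X2 (Y1 ⊗ Y2) V)) !kcompA.
have e2 : (α X1 X2 (Y1 ⊗ Y2) ▷ V) ∘ (α' X1 X2 (Y1 ⊗ Y2) ▷ V) = \id_(_).
  by rewrite -rwM fwdK rw1.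
rewrite (comp2 _ e2) kcompm1 (comp2 _ (ascN2 _ _ _)) !kcompA.
have e3 : α X1 (Y1 ⊗ (X2 ⊗ Y2)) V ∘ (α X1 Y1 (X2 ⊗ Y2) ▷ V) =
   (X1 ◁ α' Y1 (X2 ⊗ Y2) V) ∘ α X1 Y1 ((X2 ⊗ Y2) ⊗ V) ∘
   α (X1 ⊗ Y1) (X2 ⊗ Y2) V.
  rewrite -kcompA pentagon !kcompA -lwM bwdK lw1 kcomp1m.
  by [].
rewrite (comp2 _ e3) !kcompA; congr (_ ∘ _).
congr (_ ∘ _).
rewrite -!lwM; congr (_ ◁ _).
rewrite -[RHS]kcompA.
have e4 : α X2 X3 (Y1 ⊗ W) ∘ ch Y1 (X2 ⊗ X3) W ∘ (Y1 ◁ α' X2 X3 W) =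
   (X2 ◁ ch Y1 X3 W) ∘ ch Y1 X2 (X3 ⊗ W).
  by rewrite -kcompA ch_tens_mid !kcompA fwdK kcomp1m.
rewrite e4 [RHS]kcompA -[_ ∘ ch Y1 X2 _ ∘ _]kcompA ch_tail.
by rewrite !lwM !kcompA (comp2 _ (esym (ch_asc Y1 X2 Y2 V))) !kcompA.
Qed.

Lemma swap_lun X Y :
  (fwd (lun X) ⊗₁ fwd (lun Y)) ∘ fwd (swap_iso 𝟙 𝟙 X Y)
    ∘ (bwd (lun 𝟙) ▷ (X ⊗ Y)) = fwd (lun (X ⊗ Y)).
Proof.
rewrite swap_isoE -lrw !kcompA.
rewrite (comp2 _ (esym (ascN3' _ _ _))) !kcompA.
have e X' Y' : (fwd (lun X') ▷ Y') ∘ α' 𝟙 X' Y' = fwd (lun (X' ⊗ Y')).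
  by rewrite -lun_tens fwdKr.
rewrite e.
have e1 : (𝟙 ◁ (X ◁ fwd (lun Y))) ∘ (𝟙 ◁ ch 𝟙 X Y) = 𝟙 ◁ fwd (lun (X ⊗ Y)).
  rewrite -lwM; congr (_ ◁ _).
  by rewrite ch.unlock hat.unlock !kcompA triangle -rwM braid_unitl e.
rewrite (comp2 _ e1) (comp2 _ (triangle _ _)) -lun_run_one.
by rewrite (comp2 _ (esym (rwM _ _ _))) fwdK rw1 kcompm1.
Qed.

Lemma swap_run X Y :
  (fwd (run X) ⊗₁ fwd (run Y)) ∘ fwd (swap_iso X Y 𝟙 𝟙)
    ∘ ((X ⊗ Y) ◁ bwd (lun 𝟙)) = fwd (run (X ⊗ Y)).
Proof.
rewrite swap_isoE -lrw !kcompA.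
rewrite (comp2 _ (esym (ascN3' _ _ _))) !kcompA triangle'.
have e1 : (X ◁ fwd (lun Y)) ∘ (X ◁ (𝟙 ◁ fwd (run Y))) ∘ (X ◁ ch Y 𝟙 𝟙) =
    (X ◁ fwd (run Y)) ∘ (X ◁ (Y ◁ fwd (lun 𝟙))).
  rewrite -!lwM; congr (_ ◁ _).
  rewrite ch.unlock hat.unlock !kcompA -[_ ∘ _ ∘ α _ _ _]kcompA run_tens.
  by rewrite -run_natural (comp2 _ (esym (rwM _ _ _))) braid_unitr -kcompA triangle'.
rewrite e1 (comp2 _ (ascN3 _ _ _)) !kcompA -[_ ∘ _ ∘ (X ◁ (Y ◁ bwd _))]kcompA.
by rewrite -!lwM fwdK !lw1 kcompm1 run_tens.
Qed.

End Interchange.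

(** * Deligne products of semisimple categories *)

Section FunctorLinearity.
Variables (k : fieldType) (B E D : kcat k).

Lemma fmor_sum (F : kfunctor B D) (X Y : B) (I : Type) (r : seq I) (P : pred I)
    (f : I -> hom X Y) :
  fmor F (\sum_(i <- r | P i) f i) = \sum_(i <- r | P i) fmor F (f i).
Proof. exact: (lin_sum (@fmor_linear k B D F X Y)). Qed.
Lemma fmorZ (F : kfunctor B D) (X Y : B) a (f : hom X Y) :
  fmor F (a *: f) = a *: fmor F f.
Proof. exact: (linZ (@fmor_linear _ _ _ F X Y)). Qed.
Lemma fmor0 (F : kfunctor B D) (X Y : B) : fmor F (0 : hom X Y) = 0.
Proof. exact: (lin0 (@fmor_linear _ _ _ F X Y)). Qed.
Lemma fmorB (F : kfunctor B D) (X Y : B) (f g : hom X Y) :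
  fmor F (f - g) = fmor F f - fmor F g.
Proof. exact: (linB (@fmor_linear _ _ _ F X Y)). Qed.

Lemma bmor_suml (F : bifunctor B E D) (X X' : B) (Y Y' : E) (I : Type)
    (r : seq I) (P : pred I) (f : I -> hom X X') (g : hom Y Y') :
  bmor F (\sum_(i <- r | P i) f i) g = \sum_(i <- r | P i) bmor F (f i) g.
Proof. exact: (lin_sum (bmor_linearl F g)). Qed.
Lemma bmor_sumr (F : bifunctor B E D) (X X' : B) (Y Y' : E) (I : Type)
    (r : seq I) (P : pred I) (f : hom X X') (g : I -> hom Y Y') :
  bmor F f (\sum_(i <- r | P i) g i) = \sum_(i <- r | P i) bmor F f (g i).
Proof. exact: (lin_sum (bmor_linearr F f)). Qed.
Lemma bmorZl (F : bifunctor B E D) (X X' : B) (Y Y' : E) a (f : hom X X')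
  (g : hom Y Y') : bmor F (a *: f) g = a *: bmor F f g.
Proof. exact: (linZ (bmor_linearl F g)). Qed.
Lemma bmorZr (F : bifunctor B E D) (X X' : B) (Y Y' : E) a (f : hom X X')
  (g : hom Y Y') : bmor F f (a *: g) = a *: bmor F f g.
Proof. exact: (linZ (bmor_linearr F f)). Qed.
Lemma bmor0l (F : bifunctor B E D) (X X' : B) (Y Y' : E) (g : hom Y Y') :
  bmor F (0 : hom X X') g = 0.
Proof. exact: (lin0 (bmor_linearl F g)). Qed.
Lemma bmor0r (F : bifunctor B E D) (X X' : B) (Y Y' : E) (f : hom X X') :
  bmor F f (0 : hom Y Y') = 0.
Proof. exact: (lin0 (bmor_linearr F f)). Qed.

Definition bi_left (F : bifunctor B E D) (Y : E) : kfunctor B D.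
Proof.
refine (@KFunctor k B D (fun X => F X Y) (fun X X' f => bmor F f \id_Y) _ _ _).
- by move=> X; apply: bmor1.
- by move=> X X' X'' g f; rewrite -bmorM kcomp1m.
- by move=> X X'; apply: bmor_linearl.
Defined.
Definition bi_right (F : bifunctor B E D) (X : B) : kfunctor E D.
Proof.
refine (@KFunctor k E D (fun Y => F X Y) (fun Y Y' f => bmor F \id_X f) _ _ _).
- by move=> Y; apply: bmor1.
- by move=> Y Y' Y'' g f; rewrite -bmorM kcomp1m.
- by move=> Y Y'; apply: bmor_linearr.
Defined.

End FunctorLinearity.

Lemma ss_right_exact (k : fieldType) (B D : kcat k) (F : kfunctor B D) :
  semisimple_cat B -> right_exact F.
Proof.
move=> ss X Y Q f p /(cokernel_splitP ss)[pf [r [g [pr rp]]]]; split.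
  by rewrite -fmorM pf fmor0.
move=> Z h hf; exists (h ∘ fmor F r); split.
  rewrite -kcompA -fmorM rp fmorB fmor1 fmorM compBr kcompm1 kcompA hf comp0m.
  by rewrite subr0.
by move=> u <-; rewrite -kcompA -fmorM pr fmor1 kcompm1.
Qed.

Lemma ss_right_exact2 (k : fieldType) (B E D : kcat k) (F : bifunctor B E D) :
  semisimple_cat B -> semisimple_cat E -> right_exact2 F.
Proof.
move=> sB sE; split.
  by move=> X Y Q Z f p; exact: (@ss_right_exact k B D (bi_left F Z) sB X Y Q f p).
by move=> Z X Y Q f p; exact: (@ss_right_exact k E D (bi_right F Z) sE X Y Q f p).
Qed.

Section Delta.
Variables (k : fieldType) (C : kcat k) (I : eqType) (X : I -> C).

(** A Kronecker delta; the cast is needed because an equality of indices is not a conversion between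
    the types of morphisms. *)
Definition delta i j : hom (X i) (X j) :=
  match i =P j with
  | ReflectT e => ecast l (hom (X i) (X l)) e \id_(X i)
  | ReflectF _ => 0
  end.

Lemma delta_id i : delta i i = \id_(X i).
Proof. by rewrite /delta; case: eqP => // e; rewrite (eq_axiomK e). Qed.
Lemma delta_neq i j : i != j -> delta i j = 0.
Proof. by rewrite /delta; case: eqP. Qed.

End Delta.

(** * Extending data from simple objects to a semisimple category *)

Section SimpleFamily.
Variables (k : closedFieldType) (C : kcat k).
Hypothesis C_ss : semisimple_cat C.
Hypothesis C_fin : forall X Y : C, exists n, has_dim (hom X Y) n.
Variables (I : eqType) (s : I -> C).
Hypothesis s_simple : forall i, simple (s i).
Hypothesis s_inj : forall i j, s i ≅ s j -> i = j.
Hypothesis s_ex : forall X, simple X -> exists i, X ≅ s i.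

Lemma hom_delta i j (f : hom (s i) (s j)) : exists c, f = c *: delta s i j.
Proof.
case: (eqVneq i j) => [ij|ij].
  by case: _ / ij f => f; rewrite delta_id; apply: schur_scalar.
exists 0; rewrite scale0r; apply/eqP/negP => /negP f0; case/eqP: ij.
by apply: s_inj; apply: is_iso_isomorphic (schur C_ss _ _ f0).
Qed.

(** The summands are members of the fixed family, not merely isomorphic to them, so that data given
    on the family can be applied to them directly. *)
Record decomposition (X : C) := Decomposition {
  dec_size : nat;
  dec_idx : 'I_dec_size -> I;
  dec_in : forall a, hom (s (dec_idx a)) X;
  dec_out : forall a, hom X (s (dec_idx a));
  dec_inK : forall a, dec_out a ∘ dec_in a = \id_(s (dec_idx a));
  dec_in0 : forall a b, a != b -> dec_out b ∘ dec_in a = 0;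
  dec_sum : \sum_a (dec_in a ∘ dec_out a) = \id_X
}.

Arguments dec_in {X} d a.
Arguments dec_out {X} d a.
Arguments dec_idx {X} d a.

Lemma decomposition_ex X : inhabited (decomposition X).
Proof.
have [m [t [st [i [p [pi1 pi0 ip]]]]]] := ss_decomp C_ss X.
have h a : exists j, t a ≅ s j by apply: s_ex.
pose j a := sval (cid (h a)).
have hj a : exists u : iso (t a) (s (j a)), True.
  by have [u] := svalP (cid (h a)); exists u.
pose u a := sval (cid (hj a)).
exists; apply: (@Decomposition X m j (fun a => i a ∘ bwd (u a))
  (fun a => fwd (u a) ∘ p a)).
- by move=> a; rewrite -kcompA [p a ∘ _]kcompA pi1 kcomp1m fwdK.
- by move=> a b ab; rewrite -kcompA [p b ∘ _]kcompA pi0 // comp0m compm0.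
rewrite -ip; apply: eq_bigr => a _.
by rewrite -kcompA [bwd _ ∘ _]kcompA bwdK kcomp1m.
Qed.

Definition dec X : decomposition X :=
  sval (cid (let: inhabits h := decomposition_ex X in
             ex_intro (fun=> True) h Logic.I)).

Section NaturalExtension.
Variables (A : kcat k) (G H : kfunctor C A).
Variable u : forall i, hom (G (s i)) (H (s i)).

(** Any family [u] is natural on the family of simple objects, whose morphisms are multiples of
    identities or zero. *)
Lemma simple_natural i j (f : hom (s i) (s j)) :
  fmor H f ∘ u i = u j ∘ fmor G f.
Proof.
have [c ->] := hom_delta f; rewrite !fmorZ compZl compZr; congr (_ *: _).
case: (eqVneq i j) => [ij|/delta_neq->]; last by rewrite !fmor0 comp0m compm0.
by case: _ / ij; rewrite delta_id !fmor1 kcomp1m kcompm1.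
Qed.

Definition nat_ext Z : hom (G Z) (H Z) :=
  \sum_a fmor H (dec_in (dec Z) a) ∘ u _ ∘ fmor G (dec_out (dec Z) a).

Lemma nat_ext_natural : natural nat_ext.
Proof.
move=> X Y f; rewrite /nat_ext comp_suml comp_sumr.
transitivity (\sum_b \sum_a fmor H (dec_in (dec Y) b) ∘ u _ ∘
  fmor G (dec_out (dec Y) b ∘ f ∘ dec_in (dec X) a) ∘
  fmor G (dec_out (dec X) a)).
  apply: eq_bigr => b _.
  rewrite -[f in LHS]kcompm1 -(dec_sum (dec X)) comp_sumr fmor_sum comp_sumr.
  by apply: eq_bigr => a _; rewrite !fmorM !kcompA.
rewrite exchange_big /=; apply: eq_bigr => a _.
rewrite -[f in RHS]kcomp1m -(dec_sum (dec Y)) comp_suml fmor_sum !comp_suml.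
apply: eq_bigr => b _; rewrite -[_ ∘ u _ ∘ fmor G (_ ∘ f ∘ _)]kcompA.
by rewrite -simple_natural !fmorM !kcompA.
Qed.

Lemma nat_ext_simple i : nat_ext (s i) = u i.
Proof.
rewrite /nat_ext -[RHS]kcomp1m -fmor1 -(dec_sum (dec (s i))) fmor_sum comp_suml.
by apply: eq_bigr => a _; rewrite -kcompA -simple_natural fmorM !kcompA.
Qed.

Lemma nat_ext_uniq (v : forall Z, hom (G Z) (H Z)) :
  natural v -> (forall i, v (s i) = u i) -> forall Z, v Z = nat_ext Z.
Proof.
move=> nv vu Z; rewrite -[LHS]kcompm1 -fmor1 -(dec_sum (dec Z)) fmor_sum comp_sumr.
apply: eq_bigr => a _; rewrite fmorM kcompA nv vu.
by [].
Qed.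

End NaturalExtension.

Section FunctorExtension.
Variables (A : kcat k) (A_ab : abelian_cat A) (t : I -> A).

Definition coef i j (f : hom (s i) (s j)) : k := sval (cid (hom_delta f)).
Lemma coefP i j (f : hom (s i) (s j)) : f = coef f *: delta s i j.
Proof. exact: (svalP (cid (hom_delta f))). Qed.

(** Keeps the scalar and replaces the objects. This is functorial because the [s i] are pairwise
    non-isomorphic and have scalar endomorphisms; the [t i] may be arbitrary. *)
Definition tr i j (f : hom (s i) (s j)) : hom (t i) (t j) :=
  coef f *: delta t i j.

Lemma tr_scalar i (c : k) : tr (c *: \id_(s i)) = c *: \id_(t i).
Proof.
rewrite /tr delta_id; congr (_ *: _).
have := coefP (c *: \id_(s i)); rewrite delta_id => /eqP.
rewrite -subr_eq0 -scalerBl scaler_eq0 (negPf (simple_id_neq0 (s_simple i))) orbF.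
by rewrite subr_eq0 => /eqP.
Qed.
Lemma tr_neq i j (f : hom (s i) (s j)) : i != j -> tr f = 0.
Proof. by move=> ij; rewrite /tr delta_neq ?scaler0. Qed.
Lemma hom_neq i j (f : hom (s i) (s j)) : i != j -> f = 0.
Proof. by move=> ij; rewrite (coefP f) delta_neq ?scaler0. Qed.

Lemma tr_linear i j : linear (@tr i j).
Proof.
move=> c f g; case: (eqVneq i j) => [ij|ij]; last first.
  by rewrite !tr_neq // scaler0 addr0.
case: _ / ij f g => f g.
rewrite [f]coefP [g]coefP delta_id scalerA -scalerDl !tr_scalar.
by rewrite scalerDl scalerA.
Qed.

Lemma tr1 i : tr \id_(s i) = \id_(t i).
Proof. by rewrite -[\id_(s i)]scale1r tr_scalar scale1r. Qed.

Lemma trM i j l (g : hom (s j) (s l)) (f : hom (s i) (s j)) :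
  tr (g ∘ f) = tr g ∘ tr f.
Proof.
case: (eqVneq i j) => [ij|ij]; last first.
  by rewrite (tr_neq f) // (hom_neq f) // !compm0 (lin0 (@tr_linear i l)).
case: (eqVneq j l) => [jl|jl]; last first.
  by rewrite (tr_neq g) // (hom_neq g) // !comp0m (lin0 (@tr_linear i l)).
case: _ / jl g => g; case: _ / ij f g => f g.
rewrite [f]coefP [g]coefP delta_id compZl compZr kcomp1m scalerA !tr_scalar.
by rewrite compZl compZr kcomp1m scalerA.
Qed.

Lemma ext_obj_ex X : exists Y, is_dsum (fun a => t (dec_idx (dec X) a)) Y.
Proof. by case: A_ab => h _ _ _ _; apply: h. Qed.
Definition ext_obj X : A := sval (cid (ext_obj_ex X)).
Lemma ext_dsum X : is_dsum (fun a => t (dec_idx (dec X) a)) (ext_obj X).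
Proof. exact: (svalP (cid (ext_obj_ex X))). Qed.
Definition ext_in X := sval (cid (ext_dsum X)).
Lemma ext_out_ex X : exists p : forall a, hom (ext_obj X) (t (dec_idx (dec X) a)),
    [/\ forall a, p a ∘ @ext_in X a = \id_(_),
        forall a b, a != b -> p b ∘ @ext_in X a = 0
      & \sum_a (@ext_in X a ∘ p a) = \id_(ext_obj X)].
Proof. exact: (svalP (cid (ext_dsum X))). Qed.
Definition ext_out X := sval (cid (ext_out_ex X)).
Lemma ext_inK X a : ext_out a ∘ @ext_in X a = \id_(_).
Proof. by case: (svalP (cid (ext_out_ex X))). Qed.
Lemma ext_in0 X a b : a != b -> ext_out b ∘ @ext_in X a = 0.
Proof. by case: (svalP (cid (ext_out_ex X))) => _ h _; apply: h. Qed.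
Lemma ext_sum X : \sum_a (@ext_in X a ∘ ext_out a) = \id_(ext_obj X).
Proof. by case: (svalP (cid (ext_out_ex X))). Qed.

Definition ext_mor X Y (f : hom X Y) : hom (ext_obj X) (ext_obj Y) :=
  \sum_a \sum_b @ext_in Y b ∘ tr (dec_out (dec Y) b ∘ f ∘ dec_in (dec X) a)
    ∘ @ext_out X a.

Lemma ext_mor1 X : ext_mor \id_X = \id_(ext_obj X).
Proof.
rewrite /ext_mor -[RHS]ext_sum; apply: eq_bigr => a _.
rewrite (bigD1 a) //= kcompm1 dec_inK tr1 kcompm1 big1 ?addr0 // => b ba.
rewrite kcompm1 dec_in0 1?eq_sym // (lin0 (@tr_linear _ _)) compm0 comp0m.
by [].
Qed.

Lemma ext_morM X Y Z (g : hom Y Z) (f : hom X Y) :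
  ext_mor (g ∘ f) = ext_mor g ∘ ext_mor f.
Proof.
rewrite /ext_mor comp_sumr; apply: eq_bigr => a _.
rewrite comp_sumr.
transitivity (\sum_c \sum_b @ext_in Z c ∘ tr (dec_out (dec Z) c ∘ g ∘ dec_in (dec Y) b)
  ∘ tr (dec_out (dec Y) b ∘ f ∘ dec_in (dec X) a) ∘ @ext_out X a).
  apply: eq_bigr => c _.
  have -> : dec_out (dec Z) c ∘ (g ∘ f) ∘ dec_in (dec X) a =
    \sum_b (dec_out (dec Z) c ∘ g ∘ dec_in (dec Y) b) ∘
           (dec_out (dec Y) b ∘ f ∘ dec_in (dec X) a).
    transitivity (dec_out (dec Z) c ∘ g ∘
      (\sum_b dec_in (dec Y) b ∘ dec_out (dec Y) b) ∘ f ∘ dec_in (dec X) a).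
      by rewrite dec_sum kcompm1 !kcompA.
    rewrite comp_sumr !comp_suml; apply: eq_bigr => b _.
    by rewrite !kcompA.
  rewrite (lin_sum (@tr_linear _ _)) comp_sumr comp_suml.
  by apply: eq_bigr => b _; rewrite trM !kcompA.
rewrite exchange_big /=; apply: eq_bigr => b _.
rewrite comp_suml (bigD1 b) //= [X in _ + X]big1 ?addr0.
  rewrite comp_suml; apply: eq_bigr => c _.
  by rewrite !kcompA -[_ ∘ ext_out b ∘ _]kcompA ext_inK kcompm1.
move=> b' bb; rewrite comp_suml big1 // => c _.
by rewrite !kcompA -[_ ∘ ext_out b' ∘ _]kcompA ext_in0 1?eq_sym // compm0 !comp0m.
Qed.

Lemma ext_mor_linear X Y : linear (@ext_mor X Y).
Proof.
move=> c f g; rewrite /ext_mor scaler_sumr -big_split; apply: eq_bigr => a _ /=.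
rewrite scaler_sumr -big_split; apply: eq_bigr => b _ /=.
by rewrite compDr compDl compZr compZl tr_linear compDr compDl compZr compZl.
Qed.

Definition ext_functor : kfunctor C A := KFunctor ext_mor1 ext_morM ext_mor_linear.

(** The chosen decomposition of [s i] need not be the obvious one, so its value is only isomorphic
    to [t i]. The existential form allows the isomorphism to be extracted by choice. *)
Lemma ext_functor_iso i : exists _ : iso (ext_functor (s i)) (t i), True.
Proof.
pose f := \sum_a tr (dec_in (dec (s i)) a) ∘ @ext_out (s i) a.
pose g := \sum_a @ext_in (s i) a ∘ tr (dec_out (dec (s i)) a).
have gf : g ∘ f = \id_(ext_functor (s i)).
  rewrite -[RHS]ext_sum /g comp_suml; apply: eq_bigr => b _.
  rewrite /f comp_sumr (bigD1 b) //= big1 ?addr0 => [|a ab].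
    by rewrite kcompA -[_ ∘ tr _ ∘ tr _]kcompA -trM dec_inK tr1 kcompm1.
  rewrite kcompA -[_ ∘ tr _ ∘ tr _]kcompA -trM dec_in0 //.
  by rewrite (lin0 (@tr_linear _ _)) compm0 comp0m.
have fg : f ∘ g = \id_(t i).
  rewrite -tr1 -(dec_sum (dec (s i))) (lin_sum (@tr_linear _ _)) /f comp_suml.
  apply: eq_bigr => a _; rewrite /g comp_sumr (bigD1 a) //= big1 ?addr0 => [|b ab].
    by rewrite kcompA -[_ ∘ ext_out a ∘ _]kcompA ext_inK kcompm1 trM.
  by rewrite kcompA -[_ ∘ ext_out a ∘ _]kcompA ext_in0 // compm0 comp0m.
by exists (Iso gf fg).
Qed.

End FunctorExtension.
End SimpleFamily.

Arguments dec_in {k C I s X} d a.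
Arguments dec_out {k C I s X} d a.
Arguments dec_idx {k C I s X} d a.

(** * Bifunctors on semisimple categories and the universal property *)

Section BinaturalExtension.
Variables (k : closedFieldType) (B E : kcat k).
Hypotheses (B_ss : semisimple_cat B) (E_ss : semisimple_cat E).
Hypothesis B_fin : forall X Y : B, exists n, has_dim (hom X Y) n.
Hypothesis E_fin : forall X Y : E, exists n, has_dim (hom X Y) n.
Variables (m n : nat) (b : 'I_m -> B) (e : 'I_n -> E).
Hypotheses (b_reps : simple_reps b) (e_reps : simple_reps e).

Let b_simple i : simple (b i). Proof. by case: b_reps. Qed.
Let b_inj i j : b i ≅ b j -> i = j. Proof. by case: b_reps => _ h _; apply: h. Qed.
Let b_ex X : simple X -> exists i, X ≅ b i. Proof. by case: b_reps => _ _ h; apply: h. Qed.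
Let e_simple i : simple (e i). Proof. by case: e_reps. Qed.
Let e_inj i j : e i ≅ e j -> i = j. Proof. by case: e_reps => _ h _; apply: h. Qed.
Let e_ex X : simple X -> exists i, X ≅ e i. Proof. by case: e_reps => _ _ h; apply: h. Qed.

Notation decB X := (dec B_ss b_ex X).
Notation decE Y := (dec E_ss e_ex Y).

Section Extension.
Variables (A : kcat k) (F G : bifunctor B E A).
Variable u : forall i j, hom (F (b i) (e j)) (G (b i) (e j)).

Lemma simple_binatural i i' j j' (f : hom (b i) (b i')) (g : hom (e j) (e j')) :
  bmor G f g ∘ u i j = u i' j' ∘ bmor F f g.
Proof.
have [c ->] := hom_delta B_ss B_fin b_simple b_inj f.
have [c' ->] := hom_delta E_ss E_fin e_simple e_inj g.
rewrite !bmorZl !bmorZr !compZl !compZr; do 2!congr (_ *: _).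
case: (eqVneq i i') => [ii|/delta_neq->]; last by rewrite !bmor0l comp0m compm0.
case: (eqVneq j j') => [jj|/delta_neq->]; last by rewrite !bmor0r comp0m compm0.
by case: _ / ii; case: _ / jj; rewrite !delta_id !bmor1 kcomp1m kcompm1.
Qed.

Definition bi_ext X Y : hom (F X Y) (G X Y) :=
  \sum_a \sum_c bmor G (dec_in (decB X) a) (dec_in (decE Y) c) ∘ u _ _
    ∘ bmor F (dec_out (decB X) a) (dec_out (decE Y) c).

Lemma bmor_dec (H : bifunctor B E A) X X' Y Y' (f : hom X X') (g : hom Y Y') :
  bmor H f g = \sum_a \sum_c
    bmor H (f ∘ dec_in (decB X) a) (g ∘ dec_in (decE Y) c)
    ∘ bmor H (dec_out (decB X) a) (dec_out (decE Y) c).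
Proof.
rewrite -{1}[f]kcompm1 -{1}(dec_sum (decB X)) comp_sumr bmor_suml.
apply: eq_bigr => a _.
rewrite -{1}[g]kcompm1 -{1}(dec_sum (decE Y)) comp_sumr bmor_sumr.
by apply: eq_bigr => c _; rewrite !kcompA bmorM.
Qed.

Lemma bmor_dec' (H : bifunctor B E A) X X' Y Y' (f : hom X X') (g : hom Y Y') :
  bmor H f g = \sum_a \sum_c
    bmor H (dec_in (decB X') a) (dec_in (decE Y') c)
    ∘ bmor H (dec_out (decB X') a ∘ f) (dec_out (decE Y') c ∘ g).
Proof.
rewrite -{1}[f]kcomp1m -{1}(dec_sum (decB X')) comp_suml bmor_suml.
apply: eq_bigr => a _.
rewrite -{1}[g]kcomp1m -{1}(dec_sum (decE Y')) comp_suml bmor_sumr.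
by apply: eq_bigr => c _; rewrite -!kcompA bmorM.
Qed.

Lemma bi_ext_natural : binatural bi_ext.
Proof.
move=> X X' Y Y' f g; rewrite /bi_ext.
transitivity (\sum_a' \sum_c' \sum_a \sum_c
  bmor G (dec_in (decB X') a') (dec_in (decE Y') c') ∘ u _ _ ∘
  bmor F (dec_out (decB X') a' ∘ f ∘ dec_in (decB X) a)
         (dec_out (decE Y') c' ∘ g ∘ dec_in (decE Y) c) ∘
  bmor F (dec_out (decB X) a) (dec_out (decE Y) c)).
  rewrite comp_suml; apply: eq_bigr => a' _.
  rewrite comp_suml; apply: eq_bigr => c' _.
  rewrite -kcompA -bmorM (bmor_dec F) comp_sumr; apply: eq_bigr => a _.
  by rewrite comp_sumr; apply: eq_bigr => c _; rewrite kcompA.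
under eq_bigr => a' _ do rewrite exchange_big /=.
rewrite exchange_big /= comp_sumr; apply: eq_bigr => a _.
under eq_bigr => a' _ do rewrite exchange_big /=.
rewrite exchange_big /= comp_sumr; apply: eq_bigr => c _.
rewrite !kcompA -bmorM (bmor_dec' G) !comp_suml; apply: eq_bigr => a' _.
rewrite !comp_suml; apply: eq_bigr => c' _.
rewrite -[_ ∘ u _ _ ∘ bmor F (_ ∘ _ ∘ _) _]kcompA -simple_binatural.
by rewrite !kcompA.
Qed.

Lemma bi_ext_uniq (v : forall X Y, hom (F X Y) (G X Y)) :
  binatural v -> (forall i j, v (b i) (e j) = u i j) ->
  forall X Y, v X Y = bi_ext X Y.
Proof.
move=> nv vu X Y.
rewrite -[LHS]kcompm1 -bmor1 bmor_dec comp_sumr; apply: eq_bigr => a _.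
rewrite comp_sumr; apply: eq_bigr => c _.
by rewrite !kcomp1m kcompA nv vu.
Qed.

Lemma bi_ext_simple i j : bi_ext (b i) (e j) = u i j.
Proof.
rewrite -[RHS]kcomp1m -bmor1 bmor_dec comp_suml; apply: eq_bigr => a _.
rewrite comp_suml; apply: eq_bigr => c _.
by rewrite !kcomp1m -[RHS]kcompA [in RHS]simple_binatural !kcompA.
Qed.

End Extension.

Lemma binatural_comp (A : kcat k) (F G H : bifunctor B E A)
    (u : forall X Y, hom (F X Y) (G X Y)) (v : forall X Y, hom (G X Y) (H X Y)) :
  binatural u -> binatural v -> binatural (fun X Y => v X Y ∘ u X Y).
Proof.
by move=> nu nv X X' Y Y' f g; rewrite -kcompA nu kcompA nv kcompA.
Qed.

Lemma binatural_id (A : kcat k) (F : bifunctor B E A) :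
  binatural (fun X Y => \id_(F X Y)).
Proof. by move=> X X' Y Y' f g; rewrite kcomp1m kcompm1. Qed.

Lemma bi_ext_inv (A : kcat k) (F G : bifunctor B E A)
    (u : forall i j, iso (F (b i) (e j)) (G (b i) (e j))) X Y :
  bi_ext (fun i j => bwd (u i j)) X Y ∘ bi_ext (fun i j => fwd (u i j)) X Y =
  \id_(F X Y).
Proof.
pose w := bi_ext (F := F) (G := F) (fun i j => \id_(F (b i) (e j))).
transitivity (w X Y).
  apply: (bi_ext_uniq (binatural_comp (bi_ext_natural _) (bi_ext_natural _))).
  by move=> i j; rewrite !bi_ext_simple bwdK.
by symmetry; apply: (bi_ext_uniq (binatural_id F)).
Qed.

Lemma bi_isomorphic_simple (A : kcat k) (F G : bifunctor B E A)
    (u : forall i j, iso (F (b i) (e j)) (G (b i) (e j))) :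
  bi_isomorphic F G.
Proof.
exists (fun X Y => Iso (bi_ext_inv u X Y)
  (bi_ext_inv (fun i j => iso_inv (u i j)) X Y)).
exact: bi_ext_natural.
Qed.

Section Deligne.
Variables (P : kcat k) (T : bifunctor B E P).
Hypothesis P_ss : semisimple_cat P.
Hypothesis P_fin : forall X Y : P, exists n, has_dim (hom X Y) n.
Hypothesis T_simple : forall i j, simple (T (b i) (e j)).
Hypothesis T_inj : forall i j i' j', T (b i) (e j) ≅ T (b i') (e j') ->
  i = i' /\ j = j'.
Hypothesis T_ex : forall Z, simple Z -> exists i j, Z ≅ T (b i) (e j).

Theorem deligne_universal_simple : deligne_universal T.
Proof.
pose s (x : 'I_m * 'I_n) := T (b x.1) (e x.2).
have s_simple x : simple (s x) by apply: T_simple.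
have s_inj x y : s x ≅ s y -> x = y.
  by case: x y => [i j] [i' j'] /T_inj/= [-> ->].
have s_ex Z : simple Z -> exists x, Z ≅ s x.
  by move=> /T_ex[i [j h]]; exists (i, j).
split; first exact: ss_right_exact2.
move=> A A_ab; split.
  move=> F _; pose t (x : 'I_m * 'I_n) := F (b x.1) (e x.2).
  pose G := ext_functor P_ss P_fin s_simple s_inj s_ex A_ab t.
  exists G; split; first exact: ss_right_exact.
  apply: bi_isomorphic_simple => i j.
  exact: (sval (cid (ext_functor_iso P_ss P_fin s_simple s_inj s_ex A_ab t (i, j)))).
move=> G H _ _ t nt.
pose u0 x : hom (G (s x)) (H (s x)) := t (b x.1) (e x.2).
pose u := nat_ext P_ss s_ex u0.
have nu : natural u by apply: nat_ext_natural.
have us x : u (s x) = u0 x by apply: nat_ext_simple.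
exists u; split.
  (* [u] along [T] and [t] are both binatural and agree on pairs of simple objects, so uniqueness of
     extensions identifies them. *)
  split=> // X Y; pose v X Y : hom (bicomp G T X Y) (bicomp H T X Y) := u (T X Y).
  have nv : binatural v by move=> X1 X2 Y1 Y2 f g; apply: nu.
  have E1 := @bi_ext_uniq A (bicomp G T) (bicomp H T)
    (fun i j => t (b i) (e j)) t nt (fun i j => erefl) X Y.
  have E2 := @bi_ext_uniq A (bicomp G T) (bicomp H T)
    (fun i j => t (b i) (e j)) v nv (fun i j => us (i, j)) X Y.
  exact: etrans E2 (esym E1).
move=> u' [nu' u't]; apply/esym/functional_extensionality_dep => Z.
apply: (nat_ext_uniq P_ss s_ex nu') => x; exact: u't.
Qed.

End Deligne.
End BinaturalExtension.

(** * The decomposition *)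

Section Grading.
Variables (k : closedFieldType) (q : nat).
Variables (C D : fusionCat k).

Lemma fully_faithful_simple (F : kfunctor D C) (Y : D) :
  (forall X Y : D, bijective (fmor F : hom X Y -> hom (F X) (F Y))) ->
  simple (F Y) -> simple Y.
Proof.
move=> ff sFY; apply: (scalar_end_simple (fus_ss D)).
  by move=> z; case: (proj1 sFY); rewrite /is_zero -fmor1 z fmor0.
move=> f; have [c fc] := schur_scalar (fus_ss C) (@fus_fin k C) (fmor F f) sFY.
by exists c; apply: (bij_inj (ff _ _)); rewrite fc fmorZ fmor1.
Qed.

Lemma monfunctor_invertible (F : monfunctor D C) (Y : D) :
  invertible Y -> invertible (F Y).
Proof.
have FM X X' : F X ⊗ F X' ≅ F (X ⊗ X') by exists; apply: mfunJ.
have F1 : 𝟙 ≅ F 𝟙 by exists; apply: mfun1.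
have FI (X X' : D) : X ≅ X' -> F X ≅ F X'.
  move=> [i]; exists; apply: (@Iso _ _ _ _ (fmor F (fwd i)) (fmor F (bwd i))).
    by rewrite -fmorM bwdK fmor1.
  by rewrite -fmorM fwdK fmor1.
move=> [Y' [YY' Y'Y]]; exists (F Y').
by split; rewrite FM F1; apply: FI.
Qed.

Lemma extension_degree : pointed D -> is_extension 'Z_q C D ->
  exists d : C -> 'Z_q, degree_map d.
Proof.
move=> pD [Cg [[Cab Cdec Chom Cdual Ctens] _ [F [ff F1]]]].
have gex X : simple X -> exists g, Cg g X.
  move=> sX; have [s [sg [i [p [pi1 pi0 ip]]]]] := Cdec X.
  have [g ng] : exists g, i g ∘ p g != 0.
    apply: contrapT => no; case: (proj1 sX); rewrite /is_zero -ip big1 // => g _.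
    by apply/eqP/negP => /negP ng; apply: no; exists g.
  exists g; have [c ec] := schur_scalar (fus_ss C) (@fus_fin k C) (i g ∘ p g) sX.
  have c0 : c != 0 by apply: contraNneq ng => c0; rewrite ec c0 scale0r.
  (* The projector onto a graded component is an idempotent scalar on a simple object; being nonzero
     it is the identity, so [X] is homogeneous of degree [g]. *)
  have e1 : i g ∘ p g = \id_X.
    have : (i g ∘ p g) ∘ (i g ∘ p g) = i g ∘ p g.
      by rewrite kcompA -[i g ∘ p g ∘ i g]kcompA pi1 kcompm1.
    rewrite {1}ec compZl kcomp1m ec scalerA => /eqP.
    rewrite -subr_eq0 -scalerBl scaler_eq0 (negPf (simple_id_neq0 sX)) orbF.
    rewrite -{3}[c]mulr1 -mulrBr mulf_eq0 (negPf c0) subr_eq0 => /eqP ->.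
    by rewrite scale1r.
  have [iso_closed _ _ _] := Cab g.
  by apply: iso_closed (sg g); exists; apply: (Iso (pi1 g) e1).
have guniq X g h : simple X -> Cg g X -> Cg h X -> g = h.
  move=> sX gX hX; apply/eqP/negP => /negP gh; case: (proj1 sX).
  exact: Chom gh gX hX _.
(* The default 0 concerns objects that are homogeneous of no degree, hence never simple ones. The
   group law of ['Z_q] is its addition, so [Ctens] reads additively. *)
pose d X : 'Z_q := if pselect (exists g, Cg g X) is left h then sval (cid h) else 0.
have dP X : simple X -> Cg (d X) X.
  move=> sX; rewrite /d; case: pselect => [h|/(_ (gex X sX))//].
  exact: (svalP (cid h)).
exists d; split.
  move=> X Y Z sX sY sZ [f f0].
  have XY := Ctens _ _ _ _ (dP X sX) (dP Y sY).
  apply/eqP/negP => /negP ne; case/eqP: f0.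
  exact: Chom ne (dP Z sZ) XY f.
move=> X sX d0; have := dP X sX; rewrite d0 => /(F1 X)[Y FY].
have sY : simple Y by apply: fully_faithful_simple ff _; rewrite FY.
by rewrite -FY; apply: monfunctor_invertible; apply: pD.
Qed.

End Grading.

Section Equivalence.
Variables (k : fieldType) (C : fusionCat k).

Definition id_kfunctor : kfunctor C C.
Proof.
refine (@KFunctor k C C (fun X => X) (fun X Y f => f) _ _ _) => //.
Defined.

Definition id_monfunctor : monfunctor C C.
Proof.
refine (@MonFunctor k C C id_kfunctor (fun X Y => iso_id (X ⊗ Y)) (iso_id 𝟙) _ _ _ _).
- by move=> *; rewrite /= kcomp1m kcompm1.
- by move=> *; rewrite /= !bmor1 !kcompm1 !kcomp1m.
- by move=> *; rewrite /= !bmor1 !kcompm1.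
- by move=> *; rewrite /= !bmor1 !kcompm1.
Defined.

Lemma fusion_equivalent_refl : fusion_equivalent C C.
Proof.
exists id_monfunctor; split; first by move=> X Y; exists id.
by move=> Z; exists Z.
Qed.

End Equivalence.

Section SubProduct.
Variables (k : closedFieldType) (C : fusionCat k) (bc : braiding C).
Variables (P1 P2 : C -> Prop).
Variables (one1 : P1 𝟙) (one2 : P2 𝟙).
Variables (tens1 : forall X Y : C, P1 X -> P1 Y -> P1 (X ⊗ Y)).
Variables (tens2 : forall X Y : C, P2 X -> P2 Y -> P2 (X ⊗ Y)).
Notation B := (sub_moncat one1 tens1).
Notation E := (sub_moncat one2 tens2).

Definition sub_product_bifunctor : bifunctor B E C.
Proof.
refine (@BiFunctor k B E C (fun X Y => sval X ⊗ sval Y)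
  (fun X X' Y Y' f g => @bmor k C C C tens (sval X) (sval X') (sval Y) (sval Y') f g)
  _ _ _ _).
- by move=> X Y; apply: (@bmor1 k C C C).
- by move=> *; apply: (@bmorM k C C C).
- by move=> X X' Y Y' g; apply: (@bmor_linearl k C C C).
- by move=> X X' Y Y' f; apply: (@bmor_linearr k C C C).
Defined.

Definition sub_product : monbifunctor B E C.
Proof.
refine (@MonBiFunctor k B E C sub_product_bifunctor
  (fun X Y X' Y' => swap_iso bc (sval X) (sval Y) (sval X') (sval Y'))
  (iso_inv (lun 𝟙)) _ _ _ _).
- by move=> *; apply: swap_natural.
- by move=> *; apply: swap_asc.
- by move=> *; apply: swap_lun.
- by move=> *; apply: swap_run.
Defined.

End SubProduct.

Section Powers.
Variables (k : closedFieldType) (C : fusionCat k) (bc : braiding C).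
Implicit Types (X Y Z W U V T a b c : C).

Let ss := fus_ss C.

Lemma coprime_trivial a x y : invertible a -> coprime x y ->
  itens a x 𝟙 ≅ 𝟙 -> itens a y 𝟙 ≅ 𝟙 -> a ≅ 𝟙.
Proof.
move=> ia cxy /(itens_eq1 _ ia)/eqP ax /(itens_eq1 _ ia)/eqP ay.
apply: iperm_inj => //; first exact: invertible1.
rewrite iperm_one; apply/eqP; rewrite -order_eq1 -dvdn1 -(eqP cxy) dvdn_gcd.
by rewrite !order_dvdn ax ay.
Qed.

Lemma power_dvd a x y : itens a x 𝟙 ≅ 𝟙 -> (x %| y)%N -> itens a y 𝟙 ≅ 𝟙.
Proof. by move=> e /dvdnP[z ->]; rewrite mulnC itensM e itens1. Qed.

Lemma power_inv a c m : a ⊗ c ≅ 𝟙 -> itens a m 𝟙 ≅ 𝟙 -> itens c m 𝟙 ≅ 𝟙.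
Proof.
move=> ac am; have -> : itens c m 𝟙 ≅ itens (a ⊗ c) m 𝟙.
  by rewrite (itens_tens bc) am tens1X.
by rewrite ac itens1.
Qed.

Lemma occurs_itens Z V W n : simple Z -> occurs Z V ->
  occurs W (itens Z n 𝟙) -> occurs W (itens V n 𝟙).
Proof.
move=> sZ ZV; elim: n W => //= n IH W /occurs_tens[U [sU UZ WU]].
apply: (tens_occurs sU (IH U UZ)); move: WU.
rewrite !(tensC bc _ U); exact: tens_occurs sZ ZV.
Qed.

Lemma occurs_inv_tens a V Z : invertible a -> simple Z -> occurs Z (a ⊗ V) ->
  exists W, [/\ simple W, occurs W V & Z ≅ a ⊗ W].
Proof.
move=> ia sZ /occurs_tens[W [sW WV ZW]]; exists W; split=> //.
by apply: (simple_occurs ss sZ) => //; apply: inv_simple.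
Qed.

End Powers.

Lemma bezout_neg x m : (0 < m)%N -> coprime m x -> exists w, (m %| w * x + 1)%N.
Proof.
move=> m0 cmx; have [km kn e _] := egcdnP x m0.
by exists kn; rewrite -(eqP cmx) -e dvdn_mull.
Qed.

(** * Splitting simple objects into a prime-to-q and a q-primary factor *)

Section Decomposition.
Variables (k : closedFieldType) (C : fusionCat k) (bc : braiding C).
Variables (q : nat) (q_prime : prime q) (d : C -> 'Z_q).
Hypothesis d_deg : degree_map d.
Implicit Types (X Y Z W U V T a b c : C).

Let ss := fus_ss C.
Let one1 := fus_one C.

(* [h] is a power of [q] with a spare factor [q], so that it also kills the
   stabilisers of simple objects. *)
Variables (h m : nat).
Hypotheses (m_gt0 : (0 < m)%N) (q_h : (q %| h)%N) (m_h : coprime m h).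
Hypothesis inv_exp : forall a, invertible a -> itens a (h * m) 𝟙 ≅ 𝟙.

Definition coprime_part X := invertible X /\ itens X m 𝟙 ≅ 𝟙.
(* The q-primary part of the universal grading, in a form for which stability
   under tensor products only uses [(X ⊗ Y)^q ≅ X^q ⊗ Y^q]. *)
Definition primary_part X :=
  forall W, simple W -> occurs W (itens X q 𝟙) -> itens W h 𝟙 ≅ 𝟙.

Lemma m_qh : coprime m (q * h).
Proof.
rewrite coprimeMr m_h andbT; apply: coprime_dvdr q_h m_h.
Qed.

Lemma qpower_inv X W : simple X -> simple W -> occurs W (itens X q 𝟙) ->
  invertible W.
Proof.
move=> sX sW o; apply: (deg0_inv d_deg sW).
by rewrite (deg_itens d_deg sX sW o) -mulr_natr pchar_Zp ?mulr0 ?prime_gt1.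
Qed.

Lemma stab_h S X : simple S -> simple X -> S ⊗ X ≅ X -> itens S h 𝟙 ≅ 𝟙.
Proof.
by move=> sS sX e; apply: power_dvd q_h; apply: (stab_exponent bc q_prime d_deg sS sX e).
Qed.

Lemma coprime_part_iso X Y : simple X -> X ≅ Y -> coprime_part X -> coprime_part Y.
Proof. by move=> _ e [iX Xm]; split; rewrite -e. Qed.
Lemma coprime_part_one : coprime_part 𝟙.
Proof. by split; [exact: invertible1 | exact: itens1]. Qed.
Lemma coprime_part_tens X Y Z : simple X -> simple Y -> simple Z ->
  coprime_part X -> coprime_part Y -> occurs Z (X ⊗ Y) -> coprime_part Z.
Proof.
move=> sX sY sZ [iX Xm] [iY Ym] o.
have e : Z ≅ X ⊗ Y by apply: (simple_occurs ss sZ) => //; apply: inv_simple.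
split; first by rewrite e; apply: invertible_tens.
by rewrite e (itens_tens bc) Xm Ym tens1X.
Qed.
Lemma coprime_part_dual X Z : simple X -> simple Z -> coprime_part X ->
  occurs 𝟙 (X ⊗ Z) -> coprime_part Z.
Proof.
move=> sX sZ [iX Xm] o.
have e : X ⊗ Z ≅ 𝟙.
  by symmetry; apply: (simple_occurs ss one1) => //; apply: inv_simple.
split; last exact: (power_inv bc e Xm).
by exists X; rewrite (tensC bc).
Qed.

Lemma primary_part_iso X Y : simple X -> X ≅ Y -> primary_part X -> primary_part Y.
Proof. by move=> _ e pX W sW; rewrite -e; apply: pX. Qed.
Lemma primary_part_one : primary_part 𝟙.
Proof.
move=> W sW; rewrite itens1 => o.
by rewrite (simple_occurs ss sW one1 o) itens1.
Qed.
Lemma primary_part_tens X Y Z : simple X -> simple Y -> simple Z ->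
  primary_part X -> primary_part Y -> occurs Z (X ⊗ Y) -> primary_part Z.
Proof.
move=> sX sY sZ pX pY ZXY W sW /(occurs_itens bc sZ ZXY).
rewrite (itens_tens bc) => /(occurs_tens2 bc)[U [V [sU sV UX VY WUV]]].
have iU := qpower_inv sX sU UX.
have -> : W ≅ U ⊗ V by apply: (simple_occurs ss sW) => //; apply: inv_simple.
by rewrite (itens_tens bc) (pX U sU UX) (pY V sV VY) tens1X.
Qed.
(** As [𝟙] occurs in [X^q ⊗ Z^q], some constituent [V] of [Z^q] is inverse to one of [X^q]. All
    others differ from [V] by stabilisers of [Z], which [h] kills. *)
Lemma primary_part_dual X Z : simple X -> simple Z -> primary_part X ->
  occurs 𝟙 (X ⊗ Z) -> primary_part Z.
Proof.
move=> sX sZ pX o W sW WZ.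
have : occurs 𝟙 (itens (X ⊗ Z) q 𝟙).
  by apply: (occurs_itens bc one1 o); rewrite itens1; apply: occurs_simple.
rewrite (itens_tens bc) => /(occurs_tens2 bc)[U [V [sU sV UX VZ UV]]].
have iU := qpower_inv sX sU UX.
have e : U ⊗ V ≅ 𝟙.
  by symmetry; apply: (simple_occurs ss one1) => //; apply: inv_simple.
have Vh := power_inv bc e (pX U sU UX).
have [T [sT iT eT <-]] := orbit_itens bc d_deg sZ sV sW VZ WZ.
by rewrite (itens_tens bc) Vh (stab_h sT sZ eT) tens1X.
Qed.

(** The quotient [u] of [b] by [b'] has [m]-th power [𝟙] and carries [e] to [e']. It shifts the
    constituents of [e^q] by [u^q] to constituents of [e'^q]; both are killed by [h], so [u^(q h)]
    is [𝟙], and [m] is prime to [q * h]. *)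
Lemma primary_coprime_inj b b' e e' : coprime_part b -> coprime_part b' ->
  simple e -> simple e' -> primary_part e -> primary_part e' ->
  b ⊗ e ≅ b' ⊗ e' -> b ≅ b' /\ e ≅ e'.
Proof.
move=> [ib bm] [ib' b'm] se se' pe pe' E.
have [c [ic b'c cb']] := invertible_inv ib'.
have cm := power_inv bc b'c b'm.
pose u := c ⊗ b; have iu : invertible u by apply: invertible_tens.
have um : itens u m 𝟙 ≅ 𝟙 by rewrite (itens_tens bc) cm bm tens1X.
have ue : u ⊗ e ≅ e' by rewrite /u tensA E -tensA cb' tens1X.
have [W [sW WE]] := exists_constituent ss (@nonzero_itens _ _ e q (proj1 se)).
have iW := qpower_inv se sW WE.
have uq := invertible_itens q iu.
have sUW : simple (itens u q 𝟙 ⊗ W) by apply: inv_simple.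
have o : occurs (itens u q 𝟙 ⊗ W) (itens e' q 𝟙).
  rewrite -ue (itens_tens bc); apply: (tens_occurs sW WE).
  exact: occurs_simple.
have := pe' _ sUW o; rewrite (itens_tens bc) (pe W sW WE) tensX1 -itensM => uqh.
have u1 := coprime_trivial iu m_qh um uqh.
split; last by rewrite -ue u1 tens1X.
by rewrite -(tens1X b) -b'c tensA -/u u1 tensX1.
Qed.

Lemma primary_coprime_ex X : simple X -> exists b e,
  [/\ coprime_part b, simple e, primary_part e & X ≅ b ⊗ e].
Proof.
move=> sX.
have [a [sa aX]] := exists_constituent ss (@nonzero_itens _ _ X q (proj1 sX)).
have ia := qpower_inv sX sa aX.
(* With [b'] the power [a^(h w)], the constituent [a] of [X^q] becomes [a^(h w q + 1)] in
   [(b' ⊗ X)^q]. Its [h]-th power has exponent [h * (w * (q * h) + 1)], a multiple of [h * m]. *)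
have [w wP] : exists w, (m %| w * (q * h) + 1)%N by apply: bezout_neg m_qh.
pose b' := itens a (h * w) 𝟙.
have ib' : invertible b' by apply: invertible_itens.
have b'm : itens b' m 𝟙 ≅ 𝟙.
  rewrite -itensM; apply: (power_dvd (inv_exp ia)).
  by rewrite mulnAC dvdn_mulr.
have [b [ib b'b bb']] := invertible_inv ib'.
have bm := power_inv bc b'b b'm.
exists b, (b' ⊗ X); split=> //; first exact: inv_simple.
  move=> W sW; rewrite (itens_tens bc).
  move=> /(occurs_inv_tens (invertible_itens q ib') sW)[U [sU UX ->]].
  have [T [sT iT eT <-]] := orbit_itens bc d_deg sX sa sU aX UX.
  rewrite (itens_tens bc) (itens_tens bc T) (stab_h sT sX eT) tens1X.
  rewrite -itensM /b' -itensM -itensE -itensD.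
  apply: (power_dvd (inv_exp ia)).
  have -> : (h * w * (q * h) + h = h * (w * (q * h) + 1))%N.
    by rewrite mulnDr muln1 !mulnA.
  exact: dvdn_mul.
by rewrite -tensA bb' tens1X.
Qed.

End Decomposition.

Section SubFusionSimples.
Variables (k : closedFieldType) (C : fusionCat k) (bc : braiding C).
Variable Q : C -> Prop.
Hypothesis Q_iso : forall X Y, simple X -> X ≅ Y -> Q X -> Q Y.
Hypothesis Q_one : Q 𝟙.
Hypothesis Q_tens : forall X Y Z, simple X -> simple Y -> simple Z ->
  Q X -> Q Y -> occurs Z (X ⊗ Y) -> Q Z.
Hypothesis Q_dual : forall X Z, simple X -> simple Z -> Q X ->
  occurs 𝟙 (X ⊗ Z) -> Q Z.
Notation D := (sub_fusion bc Q_iso Q_one Q_tens Q_dual).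

Lemma sub_fusion_simple (X : D) : simple X -> simple (sval X) /\ Q (sval X).
Proof.
move=> /(sub_simple (fus_ss C) (@ac_retract k C Q)) sX; split=> //.
by apply/(ac_simple Q_iso sX)/(svalP X).
Qed.

Lemma sub_fusion_ex (X : C) : simple X -> Q X ->
  exists2 Y : D, simple Y & sval Y = X.
Proof.
move=> sX QX; have PX : all_constituents Q X by apply/(ac_simple Q_iso sX).
exists (exist _ X PX) => //.
by apply/(sub_simple (fus_ss C) (@ac_retract k C Q)).
Qed.

Lemma sub_fusion_isomorphic (X Y : D) : X ≅ Y <-> sval X ≅ sval Y.
Proof. exact: sub_isomorphic. Qed.

Lemma sub_fusion_invertible (X : D) : simple X -> invertible (sval X) ->
  invertible X.
Proof.
move=> /sub_fusion_simple[sX QX] iX; have [c [ic Xc cX]] := invertible_inv iX.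
have sc := invertible_simple ic.
have Qc : Q c.
  apply: (Q_dual sX sc QX); apply: (occurs_simple (fus_one C)).
  exact: isomorphic_sym.
have [Y _ Yc] := sub_fusion_ex sc Qc; exists Y; rewrite -Yc in Xc cX.
by split; apply/sub_fusion_isomorphic.
Qed.

Lemma invertible_sub_fusion (X : D) : invertible X -> invertible (sval X).
Proof.
by move=> [Y [/sub_fusion_isomorphic a /sub_fusion_isomorphic b]]; exists (sval Y).
Qed.

End SubFusionSimples.

Theorem theorem3p1 (R : realType) (k : closedFieldType)
    (char_k : [pchar k] =i pred0)
    (q : nat) (q_prime : prime q)
    (C : braidedFusionCat k)
    (C_ext : exists D : fusionCat k, pointed D /\ is_extension 'Z_q C D)
    (C_not_pointed : ~ pointed C) :
  exists B E P : fusionCat k,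
    [/\ pointed B,
        is_deligne_product B E P,
        fusion_equivalent C P,
        exists N : nat, FPdim_cat R E = q%:R ^+ N
      & exists (m n : nat) (alpha : R),
          [/\ (0 < m)%N, (0 < n)%N, 1 < alpha,
              exists M : nat, alpha ^+ 2 = q%:R ^+ M
            & of_type E [:: (1, m); (alpha, n)]]].
Proof.
pose bc := bfbraiding C.
have [D [pD ext]] := C_ext; have [d d_deg] := extension_degree pD ext.
(* [m] is the prime-to-[q] part of the order of the group of invertible objects. *)
have [m qm Nm] := pfactor_coprime q_prime (cardG_gt0 (inv_group C)).
pose l := logn q #|inv_group C|; pose h := (q ^ l.+1)%N.
have q_h : (q %| h)%N by rewrite /h expnS dvdn_mulr.
have m_h : coprime m h by rewrite coprime_sym coprimeXl.
have m_gt0 : (0 < m)%N.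
  by have := cardG_gt0 (inv_group C); rewrite Nm muln_gt0 => /andP[].
have inv_exp (a : C) : invertible a -> itens a (h * m) 𝟙 ≅ 𝟙.
  move=> ia; apply: power_dvd (inv_exponent ia) _.
  have -> : (h * m = q * #|inv_group C|)%N.
    by rewrite [in RHS]Nm /h expnS -mulnA [(m * _)%N]mulnC.
  exact: dvdn_mull.
pose B := sub_fusion bc (@coprime_part_iso k C m) (coprime_part_one C m)
  (@coprime_part_tens k C bc m) (@coprime_part_dual k C bc m).
pose E := sub_fusion bc (@primary_part_iso k C q h) (@primary_part_one k C q h)
  (@primary_part_tens k C bc q q_prime d d_deg h)
  (@primary_part_dual k C bc q q_prime d d_deg h q_h).
have simpleB (X : B) := @sub_fusion_simple _ _ _ _ _ _ _ _ X.
have simpleE (X : E) := @sub_fusion_simple _ _ _ _ _ _ _ _ X.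
pose dE (X : E) : 'Z_q := d (sval X).
have dE_deg : degree_map dE.
  split=> [X Y Z /simpleE[sX _] /simpleE[sY _] /simpleE[sZ _]|X sX dX].
    exact: (proj1 d_deg).
  apply: sub_fusion_invertible => //; apply: (proj2 d_deg) => //.
  by case: (simpleE X sX).
have q_power (a : E) : invertible a -> exists K, itens a (q ^ K) 𝟙 ≅ 𝟙.
  (* [q ^ l.+2] is [q * h]: the object [a^q] is its own constituent, and [primary_part] says that
     [h] kills it. *)
  move=> ia; exists l.+2; have sa := invertible_simple ia.
  have [sa' pa] := simpleE a sa.
  apply/sub_fusion_isomorphic; rewrite sub_itens expnS.
  rewrite itensM; have ia' := invertible_sub_fusion ia.
  have iaq := invertible_itens q ia'.
  have sq := invertible_simple iaq.
  by apply: pa => //; apply: occurs_simple.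
have [X [sX niX]] : exists X : C, simple X /\ ~ invertible X.
  by apply: contrapT => no; apply: C_not_pointed => X sX; apply: contrapT => ni;
    apply: no; exists X.
have [b [e [pb se pe Xe]]] :=
  primary_coprime_ex bc q_prime d_deg m_gt0 q_h m_h inv_exp sX.
(* The factor [b] is invertible, so the failure of [X] to be invertible lies in [e]. *)
have [x0 nx0] : exists x0, ~ invertible (@simple_obj k E x0).
  have [e' se' ee'] : exists2 e' : E, simple e' & sval e' = e by exact: sub_fusion_ex.
  exists (idx e'); rewrite -(idxP se') => ie.
  have := invertible_sub_fusion ie; rewrite ee' => {}ie.
  by apply: niX; rewrite Xe; apply: invertible_tens => //; case: pb.
have bE : braiding E := sub_braiding _ _ bc.
(* The Deligne product is realised by [C] itself, through the tensor product of objects of [B] and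
   [E]. *)
exists B, E, C; split.
- move=> Y sY; apply: sub_fusion_invertible => //.
  by case: (simpleB Y sY) => _ [].
- pose T : monbifunctor B E C := sub_product bc _ _ _ _.
  exists T.
  apply: (deligne_universal_simple (fus_ss B) (fus_ss E) (@fus_fin k B)
    (@fus_fin k E) (r_reps B) (r_reps E) (fus_ss C) (@fus_fin k C)).
  + move=> i j; have [sb [ib _]] := simpleB _ (r_simple i).
    by have [se' _] := simpleE _ (r_simple j); apply: inv_simple.
  + move=> i j i' j' e1.
    have [_ pi] := simpleB _ (r_simple i); have [_ pi'] := simpleB _ (r_simple i').
    have [sj pj] := simpleE _ (r_simple j); have [sj' pj'] := simpleE _ (r_simple j').
    have [eb ee] := primary_coprime_inj bc q_prime d_deg q_h m_h pi pi' sj sj' pj pj' e1.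
    by split; apply: r_inj; apply/sub_fusion_isomorphic.
  move=> Y sY.
  have [b1 [e1 [pb1 se1 pe1 Ye]]] :=
    primary_coprime_ex bc q_prime d_deg m_gt0 q_h m_h inv_exp sY.
  have [b2 sb2 eb] : exists2 b2 : B, simple b2 & sval b2 = b1.
    by apply: sub_fusion_ex => //; apply: invertible_simple; case: pb1.
  have [e2 se2 ee] : exists2 e2 : E, simple e2 & sval e2 = e1.
    by apply: sub_fusion_ex.
  exists (idx b2), (idx e2); rewrite Ye -eb -ee.
  apply: tens_isomorphic; apply/sub_fusion_isomorphic; exact: idxP.
- exact: fusion_equivalent_refl.
- exact: (FPdim_cat_power bE q_prime dE_deg R nx0 q_power).
- exact: (nonpointed_type bE q_prime dE_deg R nx0 q_power).
Qed.
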